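(* Let $R$ be a Noetherian integrally closed domain with field of fractions $K$, let $A:=R[x_0^{\pm1},\ldots,x_m^{\pm1}]$, and let $H$ be an essential $A$-algebra. Let $\mathfrak{p}$ be a prime ideal of $R$, let $r\in\{1,\ldots,m+1\}$, let $\mathcal{R}:=R[y_r^{\pm1},\ldots,y_m^{\pm1}]$ (so $\mathcal{R}=R$ if $r=m+1$), let $\varphi:A\rightarrow\mathcal{R}$ be an adapted morphism and let $H_\varphi$ be the algebra obtained as the specialization of $H$ via $\varphi$. Let $M_1,\ldots,M_k$ be all the $\mathfrak{p}$-essential monomials for $H$ such that $\varphi(M_j)=1$ for all $j=1,\ldots,k$. Set $\mathfrak{q}_0:=\mathfrak{p}A$, $\mathfrak{q}_j:=\mathfrak{p}A+(M_j-1)A$ for $j=1,\ldots,k$, and $\mathcal{Q}:=\{\mathfrak{q}_0,\mathfrak{q}_1,\ldots,\mathfrak{q}_k\}$. For $\mathfrak{q}\in\mathcal{Q}$, write $\chi\sim_{\mathfrak{q}}\psi$ if the irreducible characters $\chi,\psi$ belong to the same block of $A_{\mathfrak{q}}H$. Two irreducible characters $\chi,\psi\in\mathrm{Irr}(K(\mathbf{x})H)$ are in the same block of $\mathcal{R}_{\mathfrak{p}\mathcal{R}}H_\varphi$ if and only if there exist a finite sequence $\chi_0,\chi_1,\ldots,\chi_n\in\mathrm{Irr}(K(\mathbf{x})H)$ and a finite sequence $\mathfrak{q}_{j_1},\ldots,\mathfrak{q}_{j_n}\in\mathcal{Q}$ such that - $\chi_0=\chi$ and $\chi_n=\psi$,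 - for all $i$ $(1\leq i\leq n)$, $\chi_{i-1}\sim_{\mathfrak{q}_{j_i}}\chi_i$.
   Context: $\mathbf{x}=(x_i)_{0\le i\le m}$ are indeterminates over $R$; $A=R[\mathbf{x},\mathbf{x}^{-1}]$. ''Monomial'' means a Laurent monomial $\prod_i x_i^{a_i}$, $a_i\in\mathbb{Z}$ (coefficient $1$); it is primitive if $\gcd(a_i)=1$. For a prime ideal $\mathfrak q$ of $A$, $A_{\mathfrak q}$ is the localization and $A_{\mathfrak q}H:=A_{\mathfrak q}\otimes_AH$ (similarly for $\mathcal{R}$). Standing assumptions on $H$: $H$ is an $A$-algebra, free and finitely generated as an $A$-module; there is an $A$-linear symmetrizing form $t:H\to A$ ($t(ab)=t(ba)$ and $h\mapsto(h'\mapsto t(hh'))$ is an isomorphism $H\to\mathrm{Hom}_A(H,A)$); and $K(\mathbf{x})H:=K(\mathbf{x})\otimes_AH$ is split semisimple. For $\chi\in\mathrm{Irr}(K(\mathbf{x})H)$ the Schur element is $s_\chi:=\omega_\chi(\chi^\vee)\in A$, where $\chi^\vee$ is the central element with $t(\chi^\vee h)=\chi(h)$ for all $h$, and $\omega_\chi$ is the central character of $\chi$. $H$ is essential if for each $\chi\in\mathrm{Irr}(K(\mathbf{x})H)$ $$s_\chi=\xi_\chi N_\chi\prod_{i\in I_\chi}\Psi_{\chi,i}(M_{\chi,i})^{n_{\chi,i}}$$ with $\xi_\chi\in R$, $N_\chi$ a monomial in $A$, $I_\chi$ an index set, $\Psi_{\chi,i}\in R[x]$ monic of degree at least $1$, irreducible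 over $K$, prime to $x$ and $x-1$, with constant term a unit in $R$, $M_{\chi,i}$ primitive monomials in $A$, and $n_{\chi,i}$ positive integers. A primitive monomial $M$ is $\mathfrak{p}$-essential for $\chi$ if some factor $\Psi_{\chi,i}(M_{\chi,i})$ of $s_\chi$ has $\Psi_{\chi,i}(1)\in\mathfrak{p}$ and $M=M_{\chi,i}^{\pm1}$; it is $\mathfrak{p}$-essential for $H$ if it is $\mathfrak{p}$-essential for some $\chi$. Adapted morphisms: for a primitive monomial $M=\prod_{i=0}^m x_i^{a_i}$ of a Laurent polynomial ring in $m+1$ indeterminates over $R$, a morphism associated with $M$ is an $R$-algebra morphism to a Laurent polynomial ring over $R$ in $m$ indeterminates induced, via identification of the groups of monomials with $\mathbb{Z}^{m+1}$ and $\mathbb{Z}^m$, by a surjective group homomorphism $\mathbb{Z}^{m+1}\to\mathbb{Z}^m$ with kernel $\mathbb{Z}(a_0,\ldots,a_m)$. An $R$-algebra morphism $\varphi:A\to\mathcal{R}$ is adapted if $\varphi=\varphi_r\circ\cdots\circ\varphi_1$ with each $\varphi_i$ associated with a (primitive) monomial. For adapted $\varphi$, $H_\varphi:=\mathcal{R}\otimes_AH$ (via $\varphi$), and $K(\mathbf{y})H_\varphi$ ($K(\mathbf y)$ the field of fractions of $\mathcal{R}$) is split semisimple; by Tits' deformation theorem $\varphi$ induces a bijection $\mathrm{Irr}(K(\mathbf{x})H)\leftrightarrow\mathrm{Irr}(K(\mathbf{y})H_\varphi)$, by which the two sets are identified. Blocks: if $\mathcal{O}'$ is an integral domain with field of fractions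 $K'$ and $H'$ is an $\mathcal{O}'$-algebra (free of finite rank) with $K'H'$ split semisimple, the blocks of $H'$ are the parts of the partition of $\mathrm{Irr}(K'H')$ into minimal non-empty subsets $C$ such that $\sum_{\chi\in C}e_\chi\in H'$, $e_\chi$ being the central primitive idempotent of $K'H'$ attached to $\chi$. *)

(* Defs.v *)
From HB Require Import structures.
From mathcomp Require Import all_boot all_order all_algebra.
From mathcomp Require Import finmap falgebra mpoly.
From mathcomp Require boolp.

Set Implicit Arguments.
Unset Strict Implicit.
Unset Printing Implicit Defensive.

Import GRing.Theory VectorInternalTheory.
Local Open Scope ring_scope.

Notation "x %:F" := (tofrac x) : ring_scope.

Definition is_ideal (B : comNzRingType) (I : B -> Prop) : Prop :=
  [/\ I 0, forall x y, I x -> I y -> I (x + y) & forall b x, I x -> I (b * x)].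

Definition is_prime_ideal (B : comNzRingType) (I : B -> Prop) : Prop :=
  [/\ is_ideal I, ~ I 1 & forall x y, I (x * y) -> I x \/ I y].

Definition ideal_gen (B : comNzRingType) (S : B -> Prop) (x : B) : Prop :=
  exists n (c g : 'I_n -> B), (forall i, S (g i)) /\ x = \sum_i c i * g i.

Definition noetherian (B : comNzRingType) : Prop :=
  forall I : B -> Prop, is_ideal I ->
  exists gens : seq B, forall x, I x <-> ideal_gen (fun g => g \in gens) x.

Definition integrally_closed (B : idomainType) : Prop :=
  forall z : {fraction B}, integralOver (@tofrac B) z -> exists b, z = b%:F.

(** [laurent R n] is the subring of the field of fractions of R[X_1, .., X_n]
    consisting of the quotients of a polynomial by a monomial. *)

Definition laurent_pred (R : idomainType) (n : nat) : pred {fraction {mpoly R[n]}} :=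
  fun z => boolp.asbool
    (exists (a : 'X_{1..n}) (f : {mpoly R[n]}), z * ('X_[a])%:F = f%:F).

Section LaurentRing.
Variables (R : idomainType) (n : nat).
Local Notation F := {fraction {mpoly R[n]}}.

Lemma laurent_predP (z : F) :
  reflect (exists (a : 'X_{1..n}) (f : {mpoly R[n]}), z * ('X_[a])%:F = f%:F)
          (laurent_pred z).
Proof. exact: boolp.asboolP. Qed.

Lemma laurent_tofrac (f : {mpoly R[n]}) : laurent_pred f%:F.
Proof. by apply/laurent_predP; exists 0%MM, f; rewrite mpolyX0 rmorph1 mulr1. Qed.

Fact laurent_subring : subring_closed (@laurent_pred R n).
Proof.
split=> [|x y /laurent_predP[a [f xE]] /laurent_predP[b [g yE]]|
          x y /laurent_predP[a [f xE]] /laurent_predP[b [g yE]]].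
- by rewrite -[X in X \in _](rmorph1 (@tofrac {mpoly R[n]})); exact: laurent_tofrac.
- apply/laurent_predP; exists (a + b)%MM, (f * 'X_[b] - g * 'X_[a]).
  rewrite mpolyXD !rmorphM rmorphB !rmorphM /= -xE -yE.
  by rewrite mulrBl [X in _ - y * X]mulrC !mulrA.
- apply/laurent_predP; exists (a + b)%MM, (f * g).
  by rewrite mpolyXD !rmorphM /= -xE -yE mulrACA.
Qed.

Record laurent : predArgType :=
  Laurent { laurent_val : F; laurent_valP : laurent_pred laurent_val }.

HB.instance Definition _ := [isSub for laurent_val].
HB.instance Definition _ := [Choice of laurent by <:].
HB.instance Definition _ :=
  GRing.SubChoice_isSubComNzRing.Build F (@laurent_pred R n) laurent laurent_subring.

Definition laurent_unit : pred laurent :=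
  fun x => (val x != 0) && laurent_pred (val x)^-1.
Definition laurent_inv (x : laurent) : laurent :=
  if laurent_unit x then insubd x (val x)^-1 else x.

Fact laurent_mulVx : {in laurent_unit, left_inverse 1 laurent_inv *%R}.
Proof.
move=> x Ux; apply/val_inj; rewrite rmorphM rmorph1 /laurent_inv (ifT _ _ Ux).
have /andP[x0 xV] : laurent_unit x := Ux.
transitivity ((val x)^-1 * val x); last exact: mulVf.
by congr (_ * _); exact: insubdK.
Qed.

Fact laurent_unitPl x y : y * x = 1 -> laurent_unit x.
Proof.
move=> yx; have yx1 : val y * val x = 1 := congr1 val yx.
have x0 : val x != 0.
  by apply/eqP => x0; move: yx1; rewrite x0 mulr0 => /esym/eqP; rewrite oner_eq0.
apply/andP; split=> //; suff -> : (val x)^-1 = val y by exact: laurent_valP.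
by apply: (mulIf x0); rewrite mulVf // -yx1.
Qed.

Fact laurent_inv_out : {in [predC laurent_unit], laurent_inv =1 id}.
Proof. by move=> x; rewrite inE => Ux; rewrite /laurent_inv (ifF _ _ (negbTE Ux)). Qed.

HB.instance Definition _ := GRing.ComNzRing_hasMulInverse.Build laurent
  laurent_mulVx laurent_unitPl laurent_inv_out.

Fact laurent_idomain : GRing.integral_domain_axiom laurent.
Proof.
move=> x y xy; have /eqP : val x * val y = 0 := congr1 val xy.
by rewrite mulf_eq0 -!(inj_eq val_inj).
Qed.

HB.instance Definition _ :=
  GRing.ComUnitRing_isIntegral.Build laurent laurent_idomain.

Definition laurentC (c : R) : laurent := Laurent (laurent_tofrac c%:MP).
Definition laurentX (i : 'I_n) : laurent := Laurent (laurent_tofrac 'X_i).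

Definition laurent_mono (a : 'rV[int]_n) : laurent :=
  \prod_(i < n) laurentX i ^ a 0 i.

End LaurentRing.

(** For a free [A]-algebra [H] of finite rank and [f : A -> B], the [B]-algebra
    [B (x)_A H] is realised on the coordinate vectors with respect to the basis
    [1 (x) b_i], where [b_i] is the basis of [H] given by its [vectType]
    structure. *)

Definition scalext (A B : comNzRingType) (f : {rmorphism A -> B})
  (H : falgType A) : Type := 'rV[B]_(dim H).

Section ScalarExtension.
Variables (A B : comNzRingType) (f : {rmorphism A -> B}) (H : falgType A).
Local Notation d := (dim H).
Local Notation T := (scalext f H).

HB.instance Definition _ := GRing.Lmodule.on T.

(** The canonical map [h |-> 1 (x) h]. *)
Definition scalext_in (h : H) : T := map_mx f (v2r h).

Definition scalext_basis (i : 'I_d) : H := r2v (delta_mx 0 i).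

Definition scalext_one : T := scalext_in 1.

Definition scalext_mul (u v : T) : T :=
  \sum_(i < d) \sum_(j < d) ((u : 'rV[B]_d) 0 i * (v : 'rV[B]_d) 0 j) *:
    scalext_in (scalext_basis i * scalext_basis j).

Lemma scalext_inD : {morph scalext_in : x y / x + y}.
Proof. by move=> x y; rewrite /scalext_in linearD map_mxD. Qed.

Lemma scalext_inZ a x : scalext_in (a *: x) = f a *: scalext_in x.
Proof. by rewrite /scalext_in linearZ /= map_mxZ. Qed.

Lemma scalext_in_sum I (r : seq I) (P : pred I) (F : I -> H) :
  scalext_in (\sum_(i <- r | P i) F i) = \sum_(i <- r | P i) scalext_in (F i).
Proof.
apply: (big_morph _ scalext_inD).
by rewrite /scalext_in linear0 map_mx0.
Qed.

Lemma scalext_basisE (x : H) : x = \sum_(i < d) v2r x 0 i *: scalext_basis i.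
Proof.
apply: (can_inj (@v2rK _ _)); rewrite {1}[v2r x]row_sum_delta linear_sum.
by apply: eq_bigr => i _; rewrite linearZ /= r2vK.
Qed.

Lemma scalext_in_basis i : scalext_in (scalext_basis i) = delta_mx 0 i.
Proof. by rewrite /scalext_in /scalext_basis r2vK map_delta_mx. Qed.

Lemma scalext_spanE (u : T) :
  u = \sum_(i < d) (u : 'rV[B]_d) 0 i *: scalext_in (scalext_basis i).
Proof.
rewrite {1}[u]row_sum_delta; apply: eq_bigr => i _.
by rewrite scalext_in_basis.
Qed.

Lemma scalext_mulDl : left_distributive scalext_mul +%R.
Proof.
move=> u v w; rewrite /scalext_mul -big_split; apply: eq_bigr => i _ /=.
by rewrite -big_split; apply: eq_bigr => j _; rewrite mxE mulrDl scalerDl.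
Qed.

Lemma scalext_mulDr : right_distributive scalext_mul +%R.
Proof.
move=> u v w; rewrite /scalext_mul -big_split; apply: eq_bigr => i _ /=.
by rewrite -big_split; apply: eq_bigr => j _; rewrite mxE mulrDr scalerDl.
Qed.

Lemma scalext_mulZl a u v : a *: scalext_mul u v = scalext_mul (a *: u) v.
Proof.
rewrite /scalext_mul scaler_sumr; apply: eq_bigr => i _.
by rewrite scaler_sumr; apply: eq_bigr => j _; rewrite mxE scalerA mulrA.
Qed.

Lemma scalext_mulZr a u v : a *: scalext_mul u v = scalext_mul u (a *: v).
Proof.
rewrite /scalext_mul scaler_sumr; apply: eq_bigr => i _.
by rewrite scaler_sumr; apply: eq_bigr => j _; rewrite mxE scalerA mulrCA.
Qed.

Lemma scalext_mul_suml I (r : seq I) (F : I -> T) v :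
  scalext_mul (\sum_(i <- r) F i) v = \sum_(i <- r) scalext_mul (F i) v.
Proof.
apply: (big_morph (scalext_mul^~ v)); first by move=> x y; exact: scalext_mulDl.
by rewrite -[X in scalext_mul X v](scale0r (0 : T)) -scalext_mulZl scale0r.
Qed.

Lemma scalext_mul_sumr I (r : seq I) (F : I -> T) v :
  scalext_mul v (\sum_(i <- r) F i) = \sum_(i <- r) scalext_mul v (F i).
Proof.
apply: (big_morph (scalext_mul v)); first by move=> x y; exact: scalext_mulDr.
by rewrite -[X in scalext_mul v X](scale0r (0 : T)) -scalext_mulZr scale0r.
Qed.

Lemma scalext_inM : {morph scalext_in : x y / x * y >-> scalext_mul x y}.
Proof.
move=> x y; rewrite {1}(scalext_basisE x) {1}(scalext_basisE y).
rewrite big_distrlr /= scalext_in_sum; apply: eq_bigr => i _.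
rewrite scalext_in_sum; apply: eq_bigr => j _.
by rewrite -scalerAl -scalerAr !scalext_inZ !mxE scalerA.
Qed.

Lemma scalext_ind (P : T -> Prop) :
    (forall x, P (scalext_in x)) -> (forall u v, P u -> P v -> P (u + v)) ->
    (forall a u, P u -> P (a *: u)) -> forall u, P u.
Proof.
move=> Pin PD PZ u; rewrite (scalext_spanE u).
elim/big_rec: _ => [|i v _ Pv]; last by apply: PD => //; exact/PZ/Pin.
by rewrite -(scale0r (scalext_in 0)); exact/PZ/Pin.
Qed.

Fact scalext_mulA : associative scalext_mul.
Proof.
elim/scalext_ind=> [x|u1 u2 IH1 IH2|a u IH] v w; last 2 first.
- by rewrite !scalext_mulDl IH1 IH2.
- by rewrite -!scalext_mulZl IH.
elim/scalext_ind: v => [y|v1 v2 IH1 IH2|a v IH]; last 2 first.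
- by rewrite !(scalext_mulDl, scalext_mulDr) IH1 IH2.
- by rewrite -!(scalext_mulZl, scalext_mulZr) IH.
elim/scalext_ind: w => [z|w1 w2 IH1 IH2|a w IH]; last 2 first.
- by rewrite !scalext_mulDr IH1 IH2.
- by rewrite -!scalext_mulZr IH.
by rewrite -!scalext_inM mulrA.
Qed.

Fact scalext_mul1 : left_id scalext_one scalext_mul.
Proof.
elim/scalext_ind=> [x|u1 u2 IH1 IH2|a u IH].
- by rewrite -scalext_inM mul1r.
- by rewrite scalext_mulDr IH1 IH2.
- by rewrite -scalext_mulZr IH.
Qed.

Fact scalext_mulr1 : right_id scalext_one scalext_mul.
Proof.
elim/scalext_ind=> [x|u1 u2 IH1 IH2|a u IH].
- by rewrite -scalext_inM mulr1.
- by rewrite scalext_mulDl IH1 IH2.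
- by rewrite -scalext_mulZl IH.
Qed.

Fact scalext_one_neq0 : scalext_one != 0.
Proof.
apply/eqP => one0.
have all0 (u : T) : u = 0.
  by rewrite -(scalext_mul1 u) one0; have := scalext_mulZl 0 0 u; rewrite !scale0r => <-.
case: (posnP d) => [d0|d_gt0].
  have /eqP[] := oner_neq0 H; apply: (can_inj (@v2rK _ _)); apply/rowP => i.
  by have := ltn_ord i; rewrite {2}d0.
have := congr1 (fun u : 'rV[B]_d => u 0 (Ordinal d_gt0)) (all0 (const_mx 1)).
by rewrite !mxE => /eqP; rewrite oner_eq0.
Qed.

HB.instance Definition _ := GRing.Zmodule_isNzRing.Build T
  scalext_mulA scalext_mul1 scalext_mulr1 scalext_mulDl scalext_mulDr
  scalext_one_neq0.
HB.instance Definition _ :=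
  GRing.Lmodule_isLalgebra.Build B T scalext_mulZl.
HB.instance Definition _ :=
  GRing.Lalgebra_isAlgebra.Build B T scalext_mulZr.

Definition scalext_unit : pred T :=
  fun u => boolp.asbool (exists v : T, v * u = 1 /\ u * v = 1).

Definition scalext_inv (u : T) : T :=
  if boolp.pselect (exists v : T, v * u = 1 /\ u * v = 1) is left uU
  then sval (boolp.cid uU) else u.

Fact scalext_mulVr : {in scalext_unit, left_inverse 1 scalext_inv *%R}.
Proof.
move=> u /boolp.asboolP uU; rewrite /scalext_inv.
by case: boolp.pselect => // ?; case: boolp.cid => v [].
Qed.

Fact scalext_mulrV : {in scalext_unit, right_inverse 1 scalext_inv *%R}.
Proof.
move=> u /boolp.asboolP uU; rewrite /scalext_inv.
by case: boolp.pselect => // ?; case: boolp.cid => v [].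
Qed.

Fact scalext_unitP (u v : T) : v * u = 1 /\ u * v = 1 -> scalext_unit u.
Proof. by move=> uv; apply/boolp.asboolP; exists v. Qed.

Fact scalext_inv_out : {in [predC scalext_unit], scalext_inv =1 id}.
Proof.
move=> u; rewrite inE => /boolp.asboolP uU; rewrite /scalext_inv.
by case: boolp.pselect.
Qed.

HB.instance Definition _ := GRing.NzRing_hasMulInverse.Build T
  scalext_mulVr scalext_mulrV scalext_unitP scalext_inv_out.

Fact scalext_vect : Vector.axiom d T.
Proof. by exists idfun => //; exists idfun. Qed.

HB.instance Definition _ := Lmodule_hasFinDim.Build B T scalext_vect.

(** The [B]-linear extension of an [A]-linear form. *)
Definition scalext_form (t : {scalar H}) (u : T) : B :=
  \sum_(i < d) (u : 'rV[B]_d) 0 i * f (t (scalext_basis i)).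

End ScalarExtension.


Arguments scalext_in {A B} f {H} h.
Arguments scalext_form {A B} f {H} t u.

Notation fracalg H := (scalext (@tofrac _) H).

(** A non-zero module is given by an algebra morphism to ['M_n.+1]; submodules
    are subspaces of row vectors, as everywhere in [mxalgebra].  (Row vectors form
    right modules; by transposition, simplicity, semisimplicity and splitness are
    the same as for the left modules of column vectors.)  Characters are elements
    of ['Hom(E, L^o)] so as to have an [eqType], hence finite sets of them. *)

Section Characters.
Variables (L : fieldType) (E : falgType L).

Definition submodule n (rho : {lrmorphism E -> 'M[L]_n.+1}) (U : 'M[L]_n.+1) : Prop :=
  forall h, stablemx U (rho h).

Definition irreducible_rep n (rho : {lrmorphism E -> 'M[L]_n.+1}) : Prop :=
  forall U, submodule rho U -> U = 0 \/ row_full U.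

Definition semisimple_algebra : Prop :=
  forall n (rho : {lrmorphism E -> 'M[L]_n.+1}) U, submodule rho U ->
  exists W, [/\ submodule rho W, (U :&: W)%MS = 0 & row_full (U + W)%MS].

Definition split_algebra : Prop :=
  forall n (rho : {lrmorphism E -> 'M[L]_n.+1}), irreducible_rep rho ->
  forall X : 'M[L]_n.+1, (forall h, X *m rho h = rho h *m X) -> is_scalar_mx X.

Definition split_semisimple : Prop := split_algebra /\ semisimple_algebra.

Definition affords n (rho : {lrmorphism E -> 'M[L]_n.+1}) (chi : 'Hom(E, L^o)) : Prop :=
  forall h, chi h = \tr (rho h).

Definition is_irr (chi : 'Hom(E, L^o)) : Prop :=
  exists n (rho : {lrmorphism E -> 'M[L]_n.+1}), irreducible_rep rho /\ affords rho chi.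

Definition central (z : E) : Prop := forall h, z * h = h * z.

(** [omega_chi z = w]: the central element [z] acts as [w] on the simple module
    affording [chi]. *)
Definition central_character (chi : 'Hom(E, L^o)) (z : E) (w : L) : Prop :=
  exists n (rho : {lrmorphism E -> 'M[L]_n.+1}),
    [/\ irreducible_rep rho, affords rho chi & rho z = w%:M].

Definition primitive_central_idempotent (e : E) : Prop :=
  [/\ central e, e * e = e, e != 0 &
      forall f, central f -> f * f = f -> e * f = f -> f = 0 \/ f = e].

Definition attached_idempotent (chi : 'Hom(E, L^o)) (e : E) : Prop :=
  primitive_central_idempotent e /\ central_character chi e 1.

End Characters.

Section Blocks.
Variables (B : idomainType) (H : falgType B).
Local Notation L := {fraction B}.
Local Notation charT := 'Hom(fracalg H, L^o).

(** [B_q H], seen inside [Frac(B) (x)_B H]. *)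
Definition in_localization (q : B -> Prop) (u : fracalg H) : Prop :=
  exists (h : H) (s : B), ~ q s /\ u = (s%:F)^-1 *: scalext_in (@tofrac B) h.

Definition integral_sum (q : B -> Prop) (C : {fset charT}) : Prop :=
  exists e : charT -> fracalg H,
    (forall chi, chi \in C -> attached_idempotent chi (e chi)) /\
    in_localization q (\sum_(chi <- C) e chi).

Definition is_block (q : B -> Prop) (C : {fset charT}) : Prop :=
  [/\ C != fset0, forall chi, chi \in C -> is_irr chi, integral_sum q C &
      forall C' : {fset charT}, (C' `<=` C)%fset -> C' != fset0 ->
        integral_sum q C' -> C' = C].

Definition same_block (q : B -> Prop) (chi psi : charT) : Prop :=
  exists C, [/\ is_block q C, chi \in C & psi \in C].

End Blocks.

Definition symmetrizing (A : comNzRingType) (H : falgType A) (t : {scalar H}) : Prop :=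
  (forall a b, t (a * b) = t (b * a)) /\
  (forall g : {scalar H}, exists! h, forall h', g h' = t (h * h')).

Definition is_schur_element (B : idomainType) (H : falgType B) (t : {scalar H})
    (chi : 'Hom(fracalg H, {fraction B}^o)) (s : B) : Prop :=
  exists chiv : fracalg H,
    [/\ central chiv,
        forall h, scalext_form (@tofrac B) t (chiv * h) = chi h &
        central_character chi chiv s%:F].

(** The monomial [prod_i x_i ^ (a_i)] is encoded by its exponent vector. *)

Definition primitive_mono (n : nat) (a : 'rV[int]_n) : Prop :=
  \big[gcdz/0]_(i < n) a 0 i = 1.

Record factorization (R : idomainType) (n : nat) := Factorization {
  fact_xi : R;
  fact_N : 'rV[int]_n;
  fact_size : nat;
  fact_Psi : 'I_fact_size -> {poly R};
  fact_M : 'I_fact_size -> 'rV[int]_n;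
  fact_mult : 'I_fact_size -> nat
}.

Section Essential.
Variables (R : idomainType) (n : nat).
Implicit Type F : factorization R n.

Definition fact_factor F (i : 'I_(fact_size F)) : laurent R n :=
  (map_poly (@laurentC R n) (fact_Psi i)).[laurent_mono R (fact_M i)].

Definition fact_value F : laurent R n :=
  laurentC n (fact_xi F) * laurent_mono R (fact_N F) *
  \prod_(i < fact_size F) fact_factor i ^+ fact_mult i.

Definition essential_poly (Psi : {poly R}) : Prop :=
  let PsiK := map_poly (@tofrac R) Psi in
  [/\ Psi \is monic, (1 < size Psi)%N, irreducible_poly PsiK,
      coprimep PsiK 'X /\ coprimep PsiK ('X - 1) & Psi`_0 \is a GRing.unit].

Definition essential_fact F : Prop :=
  forall i : 'I_(fact_size F),
  [/\ essential_poly (fact_Psi i), primitive_mono (fact_M i) & (0 < fact_mult i)%N].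

Definition essential (H : falgType (laurent R n)) (t : {scalar H})
    (F : 'Hom(fracalg H, {fraction laurent R n}^o) -> factorization R n) : Prop :=
  forall chi, is_irr chi ->
  essential_fact (F chi) /\ is_schur_element t chi (fact_value (F chi)).

Definition essential_monomial_of (p : R -> Prop) F (M : 'rV[int]_n) : Prop :=
  primitive_mono M /\
  exists i : 'I_(fact_size F),
    p (fact_Psi i).[1] /\ (M = fact_M i \/ M = - fact_M i).

Definition essential_monomial (H : falgType (laurent R n)) (p : R -> Prop)
    (F : 'Hom(fracalg H, {fraction laurent R n}^o) -> factorization R n)
    (M : 'rV[int]_n) : Prop :=
  exists chi, is_irr chi /\ essential_monomial_of p (F chi) M.

Definition ext_ideal (p : R -> Prop) : laurent R n -> Prop :=
  ideal_gen (fun x => exists2 c, p c & x = laurentC n c).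

Definition q_ideal (p : R -> Prop) (Ms : seq 'rV[int]_n) (j : nat)
    (x : laurent R n) : Prop :=
  if j is j'.+1 then
    exists a b, ext_ideal p a /\ x = a + (laurent_mono R (nth 0 Ms j') - 1) * b
  else ext_ideal p x.

End Essential.

Section Adapted.
Variable R : idomainType.

Definition associated_morphism n (M : 'rV[int]_n.+1)
    (f : laurent R n.+1 -> laurent R n) : Prop :=
  (forall c, f (laurentC _ c) = laurentC _ c) /\
  exists g : {additive 'rV[int]_n.+1 -> 'rV[int]_n},
    [/\ forall b, exists a, g a = b,
        forall a, g a = 0 <-> exists z : int, a = z *: M &
        forall a, f (laurent_mono R a) = laurent_mono R (g a)].

Inductive adapted : forall n k, (laurent R n -> laurent R k) -> Prop :=
| AdaptedOne n M (f : {rmorphism laurent R n.+1 -> laurent R n}) :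
    primitive_mono M -> associated_morphism M f -> adapted f
| AdaptedComp n k M (f : {rmorphism laurent R n.+1 -> laurent R n})
    (g : {rmorphism laurent R n -> laurent R k}) (h : laurent R n.+1 -> laurent R k) :
    primitive_mono M -> associated_morphism M f -> adapted g -> h =1 g \o f -> adapted h.

End Adapted.

(** The bijection given by Tits' deformation theorem: [chi] takes values in [A]
    on [H], and the corresponding character takes the value [phi (chi h)] on the
    image of [h]. *)

Definition specializes (A B : idomainType) (phi : {rmorphism A -> B}) (H : falgType A)
    (chi : 'Hom(fracalg H, {fraction A}^o))
    (chi' : 'Hom(fracalg (scalext phi H), {fraction B}^o)) : Prop :=
  forall h : H, exists a : A,
    chi (scalext_in (@tofrac A) h) = a%:F /\
    chi' (scalext_in (@tofrac B) (scalext_in phi h)) = (phi a)%:F.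

Definition same_block_specialization (A B : idomainType) (phi : {rmorphism A -> B})
    (H : falgType A) (q : B -> Prop) (chi psi : 'Hom(fracalg H, {fraction A}^o)) : Prop :=
  exists chi' psi' : 'Hom(fracalg (scalext phi H), {fraction B}^o),
    [/\ is_irr chi', is_irr psi', specializes chi chi', specializes psi psi' &
        same_block q chi' psi'].

(* Main.v *)
Require Import Defs.
From HB Require Import structures.
From mathcomp Require Import all_boot all_order all_algebra.
From mathcomp Require Import finmap falgebra mpoly.
From mathcomp Require Import ring zify.
From mathcomp Require boolp.

Set Implicit Arguments.
Unset Strict Implicit.
Unset Printing Implicit Defensive.

Import Order.TTheory Num.Theory GRing.Theory VectorInternalTheory.
Local Open Scope ring_scope.

(** Write [A] for the Laurent polynomial ring, [q] for the preimage under [phi]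
    of the extension of [p], and [s_chi] for the Schur elements.

    Over the field of fractions, the central idempotent attached to [chi] is
    [e_chi = d_chi / s_chi], where [d_chi] lies in [H]: it is the dual element of
    the character [chi] for the symmetrizing form.  A set of characters is a union
    of blocks at a prime ideal exactly when the sum of its idempotents is integral
    there, so the theorem compares denominators of such sums.

    The blocks of the specialized algebra are those of [H] at [q].  The
    Schur elements are not in the kernel of [phi], because the value at a
    nontrivial monomial of a monic polynomial is nonzero, and [Psi(1)] is nonzero
    as [Psi] is prime to [x - 1].  Hence the idempotents themselves specialize,
    and the image of [e_chi] is attached to the specialization of [chi]
    ([schur_denominator]).  To specialize representations, [phi] is extended to a
    place of the field of fractions, composed of monomial-adic ones
    ([adapted_place]), and a lattice over its valuation ring is reduced
    ([reduction]).  The image of an integral sum is integral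
    ([specialize_integral]); the converse replaces the lifting of
    idempotents by an argument with characteristic polynomials
    ([lift_integral]), whose coefficients lie in [A] because [A] is completely
    integrally closed ([char_poly_integral]).

    Each ideal [q_j] is contained in [q], so a set that is integral at [q] is
    integral at every [q_j], and a chain cannot leave a block at [q]
    ([same_block_chain]).

    Conversely, the characters that are linked to a given one by chains form a
    union of blocks at every [q_j]; it has to be shown that the sum of their
    idempotents is integral at [q] ([essential_descent]).  Its denominator divides
    a product of Schur elements.  A factor [Psi(M)] of it that lies in [q]
    satisfies [phi(M) = 1] and has [Psi(1)] in [p] ([factor_value_in]): so [M] is
    one of the [M_j], and [Psi(M)] lies in [q_j].  Moreover [Psi(M)] is a prime
    element ([essential_factor_prime]).  Being integral at [q_j], the sum does not
    have [Psi(M)] in its denominator, and the factor can be cancelled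
    ([removable_prime]).  In the end only a constant is left in the denominator,
    and integrality at [q_0] removes it by McCoy's theorem ([mccoy_laurent]). *)

(** * Polynomials with coefficients in an ideal *)

Lemma fraction_quotient (B : idomainType) (z : {fraction B}) :
  exists a b : B, b != 0 /\ z = a%:F / b%:F.
Proof.
elim/quotW: z => x; exists x.1, x.2; split; first exact: denom_ratioP.
apply: (mulIf (_ : (x.2)%:F != 0)); first by rewrite tofrac_eq0 denom_ratioP.
rewrite divfK ?tofrac_eq0 ?denom_ratioP // -{1}[x]Ratio_numden.
have -> : (x.2)%:F = (\pi_({fraction B}) (Ratio x.2 1))%qT by unlock tofrac.
have -> : (x.1)%:F = (\pi_({fraction B}) (Ratio x.1 1))%qT by unlock tofrac.
rewrite -[LHS]FracField.pi_mul; apply/eqmodP; rewrite /= FracField.equivfE /FracField.mulf.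
rewrite !numden_Ratio ?mulr1 ?mul1r ?oner_neq0 ?denom_ratioP //.
by rewrite mulrC.
Qed.

Definition coefs_in (C : nzRingType) (P : C -> Prop) n (f : {mpoly C[n]}) : Prop :=
  forall u, P f@_u.

Lemma principal_ideal (B : comNzRingType) (m : B) : is_ideal (fun x => exists q, x = m * q).
Proof.
split; first by exists 0; rewrite mulr0.
  by move=> _ _ [x ->] [y ->]; exists (x + y); rewrite mulrDr.
by move=> b _ [x ->]; exists (b * x); rewrite mulrCA.
Qed.

Section PrimeCoefficients.
Variables (C : comNzRingType) (P : C -> Prop) (n : nat).
Implicit Types f g : {mpoly C[n]}.

Lemma ideal_sum (B : comNzRingType) (J : B -> Prop) I (r : seq I) (Q : pred I) (F : I -> B) :
  is_ideal J -> (forall i, Q i -> J (F i)) -> J (\sum_(i <- r | Q i) F i).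
Proof. by case=> J0 JD _ JF; elim/big_ind: _. Qed.

Lemma idealB (B : comNzRingType) (J : B -> Prop) x y :
  is_ideal J -> J x -> J y -> J (x - y).
Proof. by case=> _ JD JM Jx Jy; apply: JD => //; rewrite -mulN1r; apply: JM. Qed.

Lemma coefs_in_ideal : is_ideal P -> is_ideal (@coefs_in C P n).
Proof.
move=> idP; have [P0 PD PM] := idP; split=> [u|f g Pf Pg u|f g Pg u].
- by rewrite mcoeff0.
- by rewrite mcoeffD; apply: PD.
by rewrite mcoeffM; apply: ideal_sum => // k _; apply: PM.
Qed.

Hypothesis primeP : is_prime_ideal P.

(** If neither factor has all its coefficients in [P], remove from both the terms
    with coefficients in [P]: the leading coefficient of the product of what
    remains is outside [P], although the product is unchanged modulo [P]. *)
Lemma coefs_in_prime f g : coefs_in P (f * g) -> coefs_in P f \/ coefs_in P g.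
Proof.
have [idP P1 PM] := primeP; have [P0 PD _] := idP.
pose trunc (h : {mpoly C[n]}) := \sum_(u <- msupp h | ~~ boolp.asbool (P h@_u)) h@_u *: 'X_[u].
have truncE h u : (trunc h)@_u = if boolp.asbool (P h@_u) then 0 else h@_u.
  rewrite /trunc raddf_sum /=.
  under eq_bigr => v _ do rewrite mcoeffZ mcoeffX.
  case: (boolP (u \in msupp h)) => [uh|/memN_msupp_eq0 hu0]; last first.
    rewrite hu0 if_same big1_seq // => v /andP[_ vh].
    by case: eqP => [vu|_]; [move: vh; rewrite vu mcoeff_msupp hu0 eqxx | rewrite mulr0].
  rewrite big_mkcond (bigD1_seq u) ?msupp_uniq //= big1 => [|v /negbTE->].
    by rewrite eqxx mulr1 addr0; case: boolp.asbool.
  by rewrite mulr0 if_same.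
have trunc_mod h : coefs_in P (h - trunc h).
  move=> u; rewrite mcoeffB truncE; case: boolp.asboolP => [Ph|_]; first by rewrite subr0.
  by rewrite subrr.
have trunc_neq0 h : ~ coefs_in P h -> trunc h != 0.
  move=> Ph; apply/eqP => h0; apply: Ph => u; have := truncE h u.
  by rewrite h0 mcoeff0; case: boolp.asboolP => // _ <-.
have trunc_lead h : trunc h != 0 -> ~ P (trunc h)@_(mlead (trunc h)).
  move=> h0; have := mlead_supp h0; rewrite mcoeff_msupp truncE.
  by case: boolp.asboolP => //; rewrite eqxx.
have idc := coefs_in_ideal idP; have [_ cD cM] := idc.
move=> Pfg; apply: boolp.contrapT => /boolp.not_orP[/trunc_neq0 f0 /trunc_neq0 g0].
have /(_ (mlead (trunc f) + mlead (trunc g))%MM) : coefs_in P (trunc f * trunc g).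
  have -> : trunc f * trunc g = f * g - (g * (f - trunc f) + trunc f * (g - trunc g)).
    by rewrite !mulrBr [g * f]mulrC [g * trunc f]mulrC addrA subrK subKr.
  by apply: (idealB idc) => //; apply: cD; apply: cM; apply: trunc_mod.
by rewrite mleadcM => /PM[]; apply: trunc_lead.
Qed.

End PrimeCoefficients.

(** A form of McCoy's theorem on zero divisors of polynomial rings, modulo [xi],
    with powers of the given coefficients of [d] as annihilators.  The product of the two leading
    coefficients vanishes modulo [xi], so multiplying [a] by the one of [d]
    shortens [a]; this in turn allows one to shorten [d]. *)
Lemma mccoy (C : comNzRingType) n (xi : C) (a d : {mpoly C[n]}) :
  coefs_in (fun c => exists q, c = xi * q) (a * d) ->
  forall l, exists N, coefs_in (fun c => exists q, c = xi * q) (d@_l ^+ N *: a).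
Proof.
set P := fun c => _; have idP : is_ideal P := principal_ideal xi.
have idc := coefs_in_ideal n idP; have [c0 cD cM] := idc.
have cZ c (f : {mpoly C[n]}) : coefs_in P f -> coefs_in P (c *: f).
  by rewrite -mul_mpolyC; apply: cM.
have rem_size (f : {mpoly C[n]}) : f != 0 ->
    (size (msupp (f - f@_(mlead f) *: 'X_[mlead f])) < size (msupp f))%N.
  move=> f0; rewrite (perm_size (msupp_rem f (mlead f))) size_rem ?mlead_supp //.
  by rewrite prednK // lt0n size_eq0 msupp_eq0.
(* Induction on the number of terms of [d], then on that of [a]. *)
move: {2}(size _) (leqnn (size (msupp d))) => k.
elim: k d a => [|k IHk] d a szd.
  by move: szd; rewrite leqn0 size_eq0 msupp_eq0 => /eqP-> _ l; exists 1%N;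
    rewrite mcoeff0 expr1 scale0r.
move: {2}(size _) (leqnn (size (msupp a))) => j.
elim: j a => [|j IHj] a sza ad l.
  by move: sza; rewrite leqn0 size_eq0 msupp_eq0 => /eqP->; exists 0%N; rewrite scaler0.
have [->|a0] := eqVneq a 0; first by exists 0%N; rewrite scaler0.
have [->|d0] := eqVneq d 0; first by exists 1%N; rewrite mcoeff0 expr1 scale0r.
set ca := a@_(mlead a); set cd := d@_(mlead d).
have Pcc : P (ca * cd) by have := ad (mlead a + mlead d)%MM; rewrite mleadcM.
have cXX u : coefs_in P ((cd * ca) *: 'X_[u]).
  by move=> v; rewrite mcoeffZ mulrC; case: idP => _ _; apply; rewrite mulrC.
have [||N Na] := IHj (cd *: (a - ca *: 'X_[mlead a])) _ _ l.
- rewrite -ltnS; apply: leq_trans sza; apply: leq_ltn_trans (rem_size a a0).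
  by apply: uniq_leq_size (msupp_uniq _) _; apply: msuppZ_le.
- rewrite -scalerAl mulrBl scalerBr; apply: (idealB idc) => //; first exact: cZ.
  by rewrite -scalerAl scalerA [X in coefs_in _ X]scalerAl mulrC; apply: cM.
have {}Na : coefs_in P ((cd * d@_l ^+ N) *: a).
  move: Na; rewrite scalerA scalerBr mulrC => Na.
  rewrite -[X in coefs_in _ X](subrK ((cd * d@_l ^+ N) *: (ca *: 'X_[mlead a]))).
  by apply: cD => //; rewrite scalerA mulrAC mulrC -scalerA; apply: cZ.
have [lE|ld] := eqVneq l (mlead d).
  by exists N.+1; rewrite exprS; move: Na; rewrite lE.
have [||N' N'a] := IHk (d - cd *: 'X_[mlead d]) (d@_l ^+ N *: a) _ _ l.
- by rewrite -ltnS; apply: leq_trans szd; apply: rem_size.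
- rewrite mulrBr; apply: (idealB idc) => //; first by rewrite -scalerAl; apply: cZ.
  by rewrite -scalerAr scalerAl scalerA mulrC; apply: cM.
exists (N' + N)%N; move: N'a; rewrite mcoeffB mcoeffZ mcoeffX eq_sym (negbTE ld).
by rewrite mulr0 subr0 scalerA exprD.
Qed.

(** * Complete integral closedness *)

(** Complete integral closedness of the localization of [S] at the powers of
    [x], stated without fractions: if the powers of [a / b] have the common
    denominator [c], then [a / b] belongs to that localization. *)
Definition completely_closed (S : idomainType) (x : S) : Prop :=
  forall a b c : S, b != 0 -> c != 0 ->
  (forall n, exists k q, x ^+ k * c * a ^+ n = b ^+ n * q) ->
  exists j q, x ^+ j * a = b * q.

(** The quotients [c * (a / b) ^+ n] are elements [q n] of [R]; the ideal that they
    generate is finitely generated, so some [q N] is a combination of the previous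
    ones, and this is an integral equation for [a / b]. *)
Lemma noetherian_completely_closed (R : idomainType) :
  noetherian R -> integrally_closed R -> completely_closed (1 : R).
Proof.
move=> noethR closedR a b c b0 c0 abc.
have {abc} /boolp.choice[q qE] n : exists q, c * a ^+ n = b ^+ n * q.
  by have [k [q]] := abc n; rewrite expr1n mul1r; exists q.
pose J N (x : R) := exists r : nat -> R, x = \sum_(i < N) r i * q i.
have JS N x : J N x -> forall N', (N <= N')%N -> J N' x.
  case=> r -> N' NN'; exists (fun i => if (i < N)%N then r i else 0).
  rewrite (big_ord_widen N' (fun i => r i * q i) NN') big_mkcond /=.
  by apply: eq_bigr => i _; case: ifP => // _; rewrite mul0r.
have JD N x y : J N x -> J N y -> J N (x + y).
  move=> [r ->] [s ->]; exists (fun i => r i + s i); rewrite -big_split.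
  by apply: eq_bigr => i _; rewrite mulrDl.
have JM N e x : J N x -> J N (e * x).
  move=> [r ->]; exists (fun i => e * r i); rewrite mulr_sumr.
  by apply: eq_bigr => i _; rewrite mulrA.
have J0 N : J N 0 by exists (fun=> 0); rewrite big1 // => i _; rewrite mul0r.
have [|gens gensP] := noethR (fun x => exists N, J N x).
  split; first by exists 0%N.
    move=> x y [N Jx] [N' Jy]; exists (maxn N N').
    by apply: JD; [apply: JS Jx _ _ | apply: JS Jy _ _]; rewrite ?leq_maxl ?leq_maxr.
  by move=> e x [N Jx]; exists N; apply: JM.
have [N JN] : exists N, forall g, g \in gens -> J N g.
  have : forall g, g \in gens -> exists N, J N g.
    move=> g gg; apply/gensP; exists 1%N, (fun=> 1), (fun=> g); split=> //.
    by rewrite big_ord1 mul1r.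
  elim: (gens) => [|g s IHs] sJ; first by exists 0%N.
  have [N1 JN1] := sJ g (mem_head _ _).
  have [|N2 JN2] := IHs; first by move=> h hs; apply: sJ; rewrite inE hs orbT.
  exists (maxn N1 N2) => h; rewrite inE => /orP[/eqP->|/JN2 Jh].
    by apply: JS JN1 _ _; rewrite leq_maxl.
  by apply: JS Jh _ _; rewrite leq_maxr.
have [r qN] : J N (q N).
  have /gensP[k [e [g [gg ->]]]] : exists M, J M (q N).
    exists N.+1, (fun i => (i == N)%:R).
    by rewrite big_ord_recr /= eqxx mul1r big1 ?add0r // => i _; rewrite ltn_eqF ?mul0r.
  by elim/big_ind: _ => // [|i _]; [exact: JD | apply/JM/JN].
have bF : b%:F != 0 by rewrite tofrac_eq0.
have cF : c%:F != 0 by rewrite tofrac_eq0.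
have qz n : (q n)%:F = c%:F * (a%:F / b%:F) ^+ n.
  apply: (mulfI (expf_neq0 n bF)); transitivity (c * a ^+ n)%:F.
    by rewrite qE tofracM tofracXn.
  by rewrite expr_div_n mulrCA [b%:F ^+ n * _]mulrC divfK ?expf_neq0 // tofracM tofracXn.
have [|e zE] := closedR (a%:F / b%:F).
  exists ('X^N - \poly_(i < N) r i).
    by rewrite monicE lead_coefDl ?lead_coefXn // size_polyN size_polyXn ltnS size_poly.
  rewrite rootE rmorphB /= map_polyXn hornerD hornerN hornerXn subr_eq0.
  apply/eqP/(mulfI cF); rewrite -qz qN rmorph_sum /= (horner_coef_wide _ (n := N)); last first.
    by rewrite (leq_trans (size_poly _ _)) ?size_poly.
  rewrite mulr_sumr; apply: eq_bigr => i _.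
  by rewrite coef_map /= coef_poly ltn_ord mulrCA -qz tofracM.
exists 0%N, e; rewrite mul1r; apply/eqP; rewrite -tofrac_eq tofracM -zE.
by rewrite mulrC divfK.
Qed.

Lemma common_denominator (B : idomainType) (I : finType) (z : I -> {fraction B}) :
  exists2 b : B, b != 0 & exists a : I -> B, forall i, b%:F * z i = (a i)%:F.
Proof.
have /boolp.choice[n nP] i := fraction_quotient (z i).
have /boolp.choice[d dP] := nP.
exists (\prod_i d i); first by apply/prodf_neq0 => i _; case: (dP i).
exists (fun i => (\prod_(j | j != i) d j) * n i) => i.
have [d0 ->] := dP i; rewrite (bigD1 i) //= !tofracM mulrAC [(d i)%:F * _]mulrC.
by rewrite divfK ?tofrac_eq0 // mulrC.
Qed.

Section PolyCompletelyClosed.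
Variables (T : idomainType) (x : T).
Hypothesis closedT : completely_closed x.

(** Leading coefficients have to be divisible by [mu], after which the leading
    term can be removed from [g]. *)
Lemma completely_closed_const (mu : T) (c g : {poly T}) : mu != 0 -> c != 0 ->
  (forall n, exists k q, x ^+ k *: (c * g ^+ n) = mu ^+ n *: q) ->
  exists j q, x ^+ j *: g = mu *: q.
Proof.
move=> mu0 c0; move: {2}(size g) (leqnn (size g)) => s.
elim: s g => [|s IHs] g szg gP.
  by move: szg; rewrite leqn0 size_poly_eq0 => /eqP->; exists 0%N, 0; rewrite !scaler0.
have [->|g0] := eqVneq g 0; first by exists 0%N, 0; rewrite !scaler0.
have [||n|j [nu jE]] := closedT (a := lead_coef g) (b := mu) (c := lead_coef c) => //.
- by rewrite lead_coef_eq0.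
- have [k [q gq]] := gP n; exists k, q`_(size (c * g ^+ n)).-1.
  move: (congr1 (fun p : {poly T} => p`_(size (c * g ^+ n)).-1) gq).
  by rewrite !coefZ -mulrA -lead_coef_exp -lead_coefM.
set d := (size g).-1; pose g1 := x ^+ j *: g - (mu * nu) *: 'X^d.
have szd : size g = d.+1 by rewrite prednK // lt0n size_poly_eq0.
have szg1 : (size g1 <= s)%N.
  apply/leq_sizeP => i; rewrite leq_eqVlt => /orP[/eqP si|si]; last first.
    rewrite coefB !coefZ coefXn nth_default ?(leq_trans szg) // gtn_eqF ?mulr0 ?subr0 //.
    by apply: leq_trans si; rewrite -szd (leq_trans szg).
  move: szg; rewrite szd ltnS leq_eqVlt si => /orP[/eqP<-|di].
    by rewrite coefB !coefZ coefXn eqxx mulr1 -jE subrr.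
  by rewrite coefB !coefZ coefXn nth_default ?szd // gtn_eqF ?mulr0 ?subrr.
have [|i [q g1q]] := IHs g1 szg1.
  have [k /boolp.choice[h hE]] := boolp.choice gP.
  move=> n; pose K := (\sum_(i < n.+1) k i)%N; exists K.
  have [q ->] : exists q, x ^+ K *: (c * g1 ^+ n) = (mu ^+ n)%:P * q; last first.
    by exists q; rewrite mul_polyC.
  rewrite exprBn mulr_sumr scaler_sumr; apply: ideal_sum (principal_ideal _) _ => i _.
  have Ki : (k (n - i) <= K)%N.
    have lt_ni : (n - i < n.+1)%N by rewrite ltnS leq_subr.
    by rewrite /K (bigD1 (Ordinal lt_ni)) //= leq_addr.
  set e := (n - i)%N; have nE : n = (e + i)%N by rewrite /e subnK // -ltnS.
  set B := (nu *: 'X^d) ^+ i; set S := (-1) ^+ i : {poly T}.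
  exists ((x ^+ (K - k e) * x ^+ (j * e))%:P * S * B * h e *+ 'C(n, i)).
  rewrite -mul_polyC !mulrnAr; congr (_ *+ _).
  have -> : ((mu * nu) *: 'X^d) ^+ i = (mu ^+ i)%:P * B.
    by rewrite -scalerA exprZn mul_polyC.
  have -> : (x ^+ j *: g) ^+ e = (x ^+ (j * e))%:P * g ^+ e.
    by rewrite exprZn mul_polyC exprM.
  have := hE e; rewrite -!mul_polyC => he.
  have -> : x ^+ K = x ^+ (K - k e) * x ^+ k e by rewrite -exprD subnK.
  have -> : mu ^+ n = mu ^+ e * mu ^+ i by rewrite -exprD -nE.
  rewrite !polyCM.
  transitivity ((x ^+ (K - k e))%:P * (x ^+ (j * e))%:P * (mu ^+ i)%:P * S * B *
     ((x ^+ k e)%:P * (c * g ^+ e))); first by ring.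
  by rewrite he; ring.
exists (i + j)%N, (q + x ^+ i *: (nu *: 'X^d)).
rewrite scalerDr -g1q /g1 scalerBr !scalerA exprD.
have -> : mu * x ^+ i * nu = x ^+ i * (mu * nu) by ring.
by rewrite subrK.
Qed.

(** Clearing common factors over the field of fractions, the denominator [b]
    becomes a power of ['X] times a constant; the constant is handled by
    [completely_closed_const]. *)
Lemma completely_closed_poly : x != 0 -> completely_closed ('X * x%:P : {poly T}).
Proof.
move=> x0 a b c b0 c0 abc.
have inj : injective (map_poly (@tofrac T)).
  by apply/map_inj_poly/rmorph0 => y z /eqP; rewrite tofrac_eq => /eqP.
pose io := map_poly (@tofrac T).
have [->|a0] := eqVneq a 0; first by exists 0%N, 0; rewrite !mulr0.
have io0 p : p != 0 -> io p != 0 by rewrite -(inj_eq inj) rmorph0.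
pose D := gcdp (io a) (io b).
have D0 : D != 0 by rewrite gcdp_eq0 negb_and io0.
pose A' := io a %/ D; pose B' := io b %/ D.
have aE : io a = A' * D by rewrite divpK ?dvdp_gcdl.
have bE : io b = B' * D by rewrite divpK ?dvdp_gcdr.
have copAB : coprimep B' A' by rewrite coprimep_sym coprimep_div_gcd // io0.
have B'0 : B' != 0 by apply: contra_neq (io0 _ b0) => B0; rewrite bE B0 mul0r.
have B'dvd n : exists k, B' ^+ n %| 'X^k * io c.
  have [k [q abq]] := abc n; exists k.
  have : B' ^+ n %| 'X^k * io c * A' ^+ n.
    have xk0 : (x%:F) ^+ k != 0 by rewrite expf_neq0 // tofrac_eq0.
    rewrite -(dvdpZr _ _ xk0); apply/dvdpP; exists (io q).
    apply: (mulIf (expf_neq0 n D0)).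
    move: (congr1 io abq); rewrite /io !rmorphM !rmorphXn !rmorphM /= map_polyX map_polyC.
    rewrite -/io aE bE !exprMn => E; transitivity (B' ^+ n * D ^+ n * io q); last by ring.
    by rewrite -E -mul_polyC polyC_exp; ring.
  by rewrite mulrC Gauss_dvdpr // coprimep_expl // coprimep_expr.
(* Up to a power of ['X], the denominator [B'] divides all its powers into [c]. *)
have [i [B2 [B2n B'E]]] : exists i, exists B2, ~~ root B2 0 /\ B' = B2 * 'X^i.
  have [i [B2 B2n B2E]] := multiplicity_XsubC B' 0.
  by exists i, B2; rewrite B2E polyC0 subr0; split=> //; move: B2n; rewrite B'0.
have szB2 : (size B2 <= 1)%N.
  rewrite leqNgt; apply/negP => sz1.
  have [k] := B'dvd (size c).
  rewrite B'E exprMn => /(dvdp_trans (dvdp_mulr _ (dvdpp _))).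
  rewrite mulrC Gauss_dvdpl; last first.
    by rewrite coprimep_expl // coprimep_expr // coprimepX.
  move=> /(dvdp_leq (io0 c c0)); rewrite size_map_inj_poly ?rmorph0 //; last first.
    by move=> y z /eqP; rewrite tofrac_eq => /eqP.
  move=> le1; have B20 : B2 != 0 by rewrite -size_poly_gt0 (ltn_trans _ sz1).
  have : (size c <= (size (B2 ^+ size c)).-1)%N.
    by rewrite size_exp leq_pmull // -ltnS prednK // ltnW.
  rewrite -ltnS prednK ?size_poly_gt0 ?expf_neq0 // => /leq_trans/(_ le1).
  by rewrite ltnn.
have {szB2} [la la0 B2E] : exists2 la : {fraction T}, la != 0 & B2 = la%:P.
  apply/size_poly1P; rewrite eqn_leq szB2 lt0n size_poly_eq0.
  by apply: contraNneq B2n => ->; rewrite root0.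
have [g [mu [mu0 gE]]] : exists g : {poly T}, exists mu, mu != 0 /\ io g = (mu%:F / la) *: A'.
  have [mu mu0 [a' a'E]] := common_denominator (fun i : 'I_(size A') => A'`_i / la).
  exists (\sum_(i < size A') a' i *: 'X^i), mu; split=> //.
  rewrite /io rmorph_sum /= -[A' in RHS]coefK poly_def scaler_sumr; apply: eq_bigr => h _.
  by rewrite map_polyZ /= map_polyXn -a'E scalerA mulrA mulrAC.
have aE' : 'X^i * mu%:P * a = g * b.
  apply: inj; rewrite !rmorphM /= map_polyXn map_polyC /= -/io gE aE bE B'E B2E.
  rewrite -!mul_polyC polyCM; transitivity ((la^-1 * la)%:P * 'X^i * (mu%:F)%:P * (A' * D)).
    by rewrite mulVf // mul1r.
  rewrite !polyCM; move: (la^-1)%:P la%:P (mu%:F)%:P => la1 la2 mu1; ring.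
have [n|j [q gq]] := @completely_closed_const mu c g mu0 c0.
  have [k [q abq]] := abc n.
  have E : 'X^k * (x ^+ k *: (c * g ^+ n)) = (mu ^+ n) *: ('X^(i * n) * q).
    apply: (mulIf (expf_neq0 n b0)).
    transitivity (('X * x%:P) ^+ k * c * (g * b) ^+ n).
      by rewrite -mul_polyC polyC_exp !exprMn; ring.
    rewrite -aE' -mul_polyC polyC_exp exprM.
    transitivity ('X^i ^+ n * mu%:P ^+ n * (('X * x%:P) ^+ k * c * a ^+ n)).
      by rewrite !exprMn; ring.
    by rewrite abq; ring.
  exists k, (drop_poly k ('X^(i * n) * q)); apply/polyP => l.
  move: (congr1 (fun p : {poly T} => p`_(l + k)) E).
  by rewrite coefXnM ltnNge leq_addl /= addnK => ->; rewrite !coefZ coef_drop_poly.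
exists (maxn i j), ('X^(maxn i j - i) * (x ^+ (maxn i j - j))%:P * q).
apply: (mulIf (_ : mu%:P != 0)); first by rewrite polyC_eq0.
rewrite exprMn -{1}(subnK (leq_maxl i j)) -{2}(subnK (leq_maxr i j)) !exprD -!polyC_exp.
transitivity ('X^(maxn i j - i) * (x ^+ (maxn i j - j))%:P * (x ^+ j)%:P * ('X^i * mu%:P * a)).
  by rewrite polyC_exp; ring.
rewrite aE'; transitivity ('X^(maxn i j - i) * (x ^+ (maxn i j - j))%:P * ((x ^+ j)%:P * g) * b).
  by ring.
by rewrite mul_polyC gq -mul_polyC; ring.
Qed.

End PolyCompletelyClosed.

(** * Laurent polynomials *)

Lemma completely_closed_retract (S T : idomainType) (f : {rmorphism S -> T})
    (g : {rmorphism T -> S}) (x : S) :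
  cancel f g -> completely_closed (f x) -> completely_closed x.
Proof.
move=> fK clT a b c b0 c0 abc; have injf := can_inj fK.
have f0 y : y != 0 -> f y != 0 by rewrite -(inj_eq injf) rmorph0.
have [n|j [q fq]] := clT (f a) (f b) (f c) (f0 _ b0) (f0 _ c0).
  have [k [q E]] := abc n; exists k, (f q).
  by rewrite -!rmorphXn -!rmorphM E rmorphM rmorphXn.
by exists j, (g q); rewrite -[LHS]fK rmorphM rmorphXn fq rmorphM fK.
Qed.

Section MpolyUnivariate.
Variables (R : idomainType) (n : nat).

Definition last_variable (i : 'I_n.+1) : {poly {mpoly R[n]}} :=
  if unlift ord_max i is Some j then ('X_j)%:P else 'X.

(** [{mpoly R[n.+1]}] as polynomials in the last variable. *)
Definition to_univariate : {mpoly R[n.+1]} -> {poly {mpoly R[n]}} :=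
  mmap (polyC \o @mpolyC n R) last_variable.
HB.instance Definition _ := GRing.RMorphism.on to_univariate.

Definition of_univariate : {poly {mpoly R[n]}} -> {mpoly R[n.+1]} :=
  horner_eval 'X_ord_max \o map_poly (@mwiden n R).
HB.instance Definition _ := GRing.RMorphism.on of_univariate.

Lemma to_univariateX i : to_univariate 'X_i = last_variable i.
Proof. by rewrite /to_univariate mmapX mmap1U. Qed.

Lemma to_univariateK : cancel to_univariate of_univariate.
Proof.
move=> p; rewrite {1}(mpolyE p) (rmorph_sum to_univariate) (rmorph_sum of_univariate) [RHS]mpolyE.
apply: eq_bigr => u _ /=.
rewrite -mul_mpolyC mpolyXE_id !rmorphM !rmorph_prod /=; congr (_ * _).
  rewrite /to_univariate mmapC /= /of_univariate /= /horner_eval map_polyC hornerC /=.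
  by rewrite mwidenC.
apply: eq_bigr => i _; rewrite (rmorphXn to_univariate) (rmorphXn of_univariate); congr (_ ^+ _).
rewrite /= to_univariateX /last_variable.
case: unliftP => [j|] ->; rewrite /of_univariate /= /horner_eval.
  rewrite map_polyC hornerC /= mwidenX mnmwiden1; congr 'X_[U_(_)].
  by apply: val_inj; rewrite /= /bump leqNgt ltn_ord.
by rewrite map_polyX hornerX.
Qed.

End MpolyUnivariate.

(** The localization of the polynomial ring at this element is the Laurent
    polynomial ring, so [completely_closed (all_variables R n)] speaks about the
    latter without mentioning it. *)
Definition all_variables (R : idomainType) n : {mpoly R[n]} := \prod_(i < n) 'X_i.

Lemma all_variables_neq0 (R : idomainType) n : all_variables R n != 0.
Proof. by apply/prodf_neq0 => i _; rewrite -msupp_eq0 msuppX. Qed.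

Lemma completely_closed_mpoly (R : idomainType) n :
  completely_closed (1 : R) -> completely_closed (all_variables R n).
Proof.
move=> closedR; elim: n => [|n IHn].
  have c0K : cancel (mcoeff 0%MM) (@mpolyC 0 R).
    by move=> p; apply/mpolyP => u; rewrite mcoeffC (_ : u = 0%MM) ?eqxx ?mulr1 //; apply/mnmP => -[].
  apply: (completely_closed_retract (f := mcoeff 0%MM) (g := @mpolyC 0 R)) => //.
  by rewrite /all_variables big_ord0 rmorph1.
suff: completely_closed (to_univariate (all_variables R n.+1)).
  exact: (completely_closed_retract (@to_univariateK R n)).
have -> : to_univariate (all_variables R n.+1) = 'X * (all_variables R n)%:P.
  rewrite /all_variables big_ord_recr rmorphM rmorph_prod /= mulrC; congr (_ * _).
    by rewrite to_univariateX /last_variable unlift_none.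
  rewrite rmorph_prod; apply: eq_bigr => i _.
  rewrite to_univariateX /last_variable.
  suff -> : widen_ord (leqnSn n) i = lift ord_max i by rewrite liftK.
  by apply: val_inj; rewrite /= /bump leqNgt ltn_ord.
exact/completely_closed_poly/all_variables_neq0.
Qed.

Section LaurentPolynomials.
Variables (R : idomainType) (n : nat).
Local Notation A := (laurent R n).

Definition laurent_poly (f : {mpoly R[n]}) : A := Laurent (laurent_tofrac f).

Fact laurent_poly_is_zmod_morphism : zmod_morphism laurent_poly.
Proof. by move=> f g; apply: val_inj; rewrite rmorphB /= rmorphB. Qed.
Fact laurent_poly_is_monoid_morphism : monoid_morphism laurent_poly.
Proof.
by split=> [|f g]; apply: val_inj; rewrite ?rmorph1 ?rmorphM /= ?rmorph1 ?rmorphM.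
Qed.
HB.instance Definition _ :=
  GRing.isZmodMorphism.Build _ _ laurent_poly laurent_poly_is_zmod_morphism.
HB.instance Definition _ :=
  GRing.isMonoidMorphism.Build _ _ laurent_poly laurent_poly_is_monoid_morphism.

Lemma laurent_poly_inj : injective laurent_poly.
Proof. by move=> f g /(congr1 val) /eqP; rewrite /= tofrac_eq => /eqP. Qed.

Lemma laurentCE c : laurentC n c = laurent_poly c%:MP.
Proof. by []. Qed.

Fact laurentC_is_zmod_morphism : zmod_morphism (@laurentC R n).
Proof. by move=> c d; rewrite !laurentCE mpolyCB rmorphB. Qed.
Fact laurentC_is_monoid_morphism : monoid_morphism (@laurentC R n).
Proof. by split=> [|c d]; rewrite !laurentCE ?mpolyCM ?rmorphM // mpolyC1 rmorph1. Qed.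
HB.instance Definition _ :=
  GRing.isZmodMorphism.Build R A (@laurentC R n) laurentC_is_zmod_morphism.
HB.instance Definition _ :=
  GRing.isMonoidMorphism.Build R A (@laurentC R n) laurentC_is_monoid_morphism.

Lemma laurentX_unit (i : 'I_n) : laurentX R i \is a GRing.unit.
Proof.
have X0 : ('X_i : {mpoly R[n]})%:F != 0 by rewrite tofrac_eq0 -msupp_eq0 msuppX.
apply/andP; split=> //; apply/laurent_predP; exists U_(i)%MM, 1.
by rewrite /= mulVf // rmorph1.
Qed.

Lemma laurent_monoD a b : laurent_mono R (a + b) = laurent_mono R a * laurent_mono R b :> A.
Proof.
by rewrite -big_split; apply: eq_bigr => i _; rewrite mxE exprzDr ?laurentX_unit.
Qed.

Lemma laurent_mono0 : laurent_mono R 0 = 1 :> A.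
Proof. by rewrite /laurent_mono big1 // => i _; rewrite mxE expr0z. Qed.

Lemma laurent_monoK a : laurent_mono R a * laurent_mono R (- a) = 1 :> A.
Proof. by rewrite -laurent_monoD subrr laurent_mono0. Qed.

Lemma laurent_mono_unit a : laurent_mono R a \is a @GRing.unit A.
Proof. by apply/unitrPr; exists (laurent_mono R (- a)); rewrite laurent_monoK. Qed.

Lemma laurent_monoMn a k : laurent_mono R (a *+ k) = laurent_mono R a ^+ k :> A.
Proof.
elim: k => [|k IHk]; first by rewrite mulr0n laurent_mono0.
by rewrite mulrS laurent_monoD IHk exprS.
Qed.

Definition exponent (u : 'X_{1..n}) : 'rV[int]_n := \row_i (u i)%:Z.

Lemma laurent_mono_exponent u : laurent_mono R (exponent u) = laurent_poly 'X_[u].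
Proof.
rewrite mpolyXE_id rmorph_prod; apply: eq_bigr => i _.
by rewrite mxE rmorphXn.
Qed.

Lemma laurent_clear (z : A) : exists u f, z * laurent_mono R (exponent u) = laurent_poly f.
Proof.
have /laurent_predP[u [f zE]] := laurent_valP z.
by exists u, f; rewrite laurent_mono_exponent; apply: val_inj; rewrite rmorphM.
Qed.

Lemma laurent_sum (z : A) : exists (s : seq 'rV[int]_n) (c : 'rV[int]_n -> R),
  uniq s /\ z = \sum_(a <- s) laurentC n (c a) * laurent_mono R a.
Proof.
have [u [f zE]] := laurent_clear z.
pose e (v : 'X_{1..n}) := exponent v - exponent u.
have e_inj : injective e.
  move=> v w /addIr vw; apply/mnmP => i.
  by move/matrixP: vw => /(_ 0 i); rewrite !mxE => -[].
pose d (a : 'rV[int]_n) := [multinom absz ((a + exponent u) 0 i)%R | i < n].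
have eK : cancel e d by move=> v; apply/mnmP => i; rewrite mnmE subrK mxE.
exists (map e (msupp f)), (fun a => f@_(d a)); split.
  by rewrite map_inj_uniq // msupp_uniq.
have -> : z = laurent_poly f * laurent_mono R (- exponent u).
  by rewrite -zE -mulrA laurent_monoK mulr1.
rewrite big_map {1}(mpolyE f) rmorph_sum mulr_suml; apply: eq_bigr => v _ /=.
rewrite -mul_mpolyC rmorphM /= -laurent_mono_exponent -mulrA -laurent_monoD.
by rewrite eK laurentCE.
Qed.

Lemma completely_closed_laurent : completely_closed (1 : R) -> completely_closed (1 : A).
Proof.
move=> /(@completely_closed_mpoly R n) closedM a b c b0 c0 abc.
pose X := laurent_poly (all_variables R n).
have X_unit : X \is a GRing.unit.
  by rewrite /X /all_variables rmorph_prod rpred_prod // => i _; apply: laurentX_unit.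
have clear (z : A) : exists N f, z * X ^+ N = laurent_poly f.
  have [u [f zE]] := laurent_clear z; pose N := mdeg u.
  have uN : (u <= [multinom N | i < n])%MM.
    by apply/mnm_lepP => i; rewrite mnmE /N mdegE (bigD1 i) //= leq_addr.
  exists N, (f * 'X_[[multinom N | i < n] - u]); rewrite rmorphM /= -zE -mulrA; congr (_ * _).
  rewrite laurent_mono_exponent -rmorphM -mpolyXD addmC submK //.
  rewrite /X -rmorphXn mpolyXE_id; congr laurent_poly.
  by rewrite /all_variables -prodrXl; apply: eq_bigr => i _; rewrite mnmE.
have [i [al alE]] := clear a; have [j [be beE]] := clear b; have [l [ga gaE]] := clear c.
have nz z N f : z * X ^+ N = laurent_poly f -> z != 0 -> f != 0.
  move=> zE; apply: contra_neq => f0; apply: (mulIr (unitrX N X_unit)).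
  by rewrite zE f0 rmorph0 mul0r.
have [n0|j' [q qE]] := closedM al be ga (nz _ _ _ beE b0) (nz _ _ _ gaE c0).
  have [k0 [q]] := abc n0; rewrite expr1n mul1r => E; have [K [f fE]] := clear q.
  exists (j * n0 + K)%N, (f * all_variables R n ^+ (l + i * n0)%N).
  apply: laurent_poly_inj; rewrite !rmorphM !rmorphXn /= -/X -alE -beE -gaE -fE.
  rewrite !exprMn !exprD !exprM.
  transitivity (X ^+ j ^+ n0 * X ^+ K * X ^+ l * X ^+ i ^+ n0 * (c * a ^+ n0)).
    by ring.
  by rewrite E; ring.
exists 0%N, (laurent_poly q * X ^+ j / X ^+ (j' + i)).
rewrite mul1r mulrA; apply: (canRL (mulrK (unitrX _ X_unit))).
move: (congr1 laurent_poly qE); rewrite !rmorphM rmorphXn /= -/X -alE -beE => E.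
by rewrite exprD mulrCA E; ring.
Qed.

End LaurentPolynomials.

(** * Extended ideals of Laurent polynomial rings *)

Lemma ideal_gen_ideal (B : comNzRingType) (S : B -> Prop) : is_ideal (ideal_gen S).
Proof.
split.
- by exists 0%N, (fun=> 0), (fun=> 0); split=> [[]|] //; rewrite big_ord0.
- move=> _ _ [k [c [g [gS ->]]]] [l [d [h [hS ->]]]].
  exists (k + l)%N, (fun i => match split i with inl j => c j | inr j => d j end),
    (fun i => match split i with inl j => g j | inr j => h j end); split.
    by move=> i; case: (split i).
  rewrite big_split_ord; congr (_ + _); apply: eq_bigr => i _ /=.
    by rewrite (unsplitK (inl i)).
  by rewrite (unsplitK (inr i)).
- move=> b _ [k [c [g [gS ->]]]]; exists k, (fun i => b * c i), g; split=> //.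
  by rewrite mulr_sumr; apply: eq_bigr => i _; rewrite mulrA.
Qed.

Lemma ideal_gen_min (B : comNzRingType) (S J : B -> Prop) x :
  is_ideal J -> (forall y, S y -> J y) -> ideal_gen S x -> J x.
Proof.
move=> idJ SJ [k [c [g [gS ->]]]]; apply: ideal_sum => // i _.
by case: idJ => _ _; apply; apply/SJ/gS.
Qed.

Lemma ideal_gen_mem (B : comNzRingType) (S : B -> Prop) x : S x -> ideal_gen S x.
Proof. by move=> Sx; exists 1%N, (fun=> 1), (fun=> x); split=> //; rewrite big_ord1 mul1r. Qed.

Section ExtendedIdeals.
Variables (R : idomainType) (n : nat) (p : R -> Prop).
Local Notation A := (laurent R n).
Hypothesis p_ideal : is_ideal p.

Lemma ext_ideal_ideal : is_ideal (@ext_ideal R n p).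
Proof. exact: ideal_gen_ideal. Qed.

Lemma coefs_inMX (C : nzRingType) (P : C -> Prop) k (f : {mpoly C[k]}) u :
  P 0 -> coefs_in P (f * 'X_[u]) <-> coefs_in P f.
Proof.
move=> P0; split=> Pf v; first by rewrite -(mcoeffMX f u).
have [uv|nuv] := boolP (u <= v)%MM; first by rewrite -(submK uv) addmC mcoeffMX.
suff -> : (f * 'X_[u])@_v = 0 by [].
apply: contraNeq nuv; rewrite -mcoeff_msupp (perm_mem (msuppMX _ _)) => /mapP[w _ ->].
exact: lem_addr.
Qed.

(** Clearing denominators multiplies by a unit, and a polynomial is a combination
    of monomials, which makes the extension of [p] a condition on coefficients. *)
Lemma ext_idealP (z : A) u f : z * laurent_mono R (exponent u) = laurent_poly f ->
  ext_ideal p z <-> coefs_in p f.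
Proof.
have [p0 _ pM] := p_ideal; move=> zE; split; last first.
  move=> pf; have -> : z = laurent_mono R (- exponent u) * laurent_poly f.
    by rewrite -zE mulrCA [X in _ * X]mulrC laurent_monoK mulr1.
  have [_ _ JM] := ext_ideal_ideal; apply: (JM); rewrite (mpolyE f) rmorph_sum.
  refine (@ideal_sum _ (@ext_ideal R n p) _ _ xpredT _ ext_ideal_ideal _) => v _ /=.
  rewrite -mul_mpolyC rmorphM mulrC; apply: (JM); apply: ideal_gen_mem.
  by exists f@_v.
pose J (y : A) := exists v g, y * laurent_mono R (exponent v) = laurent_poly g /\ coefs_in p g.
have [c0 cD cM] := coefs_in_ideal n p_ideal.
have idJ : is_ideal J.
  split.
  - by exists 0%MM, 0; rewrite mul0r rmorph0.
  - move=> y y' [v [g [yE pg]]] [v' [g' [yE' pg']]].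
    exists (v + v')%MM, (g * 'X_[v'] + g' * 'X_[v]); split; last first.
      by apply: cD; apply/coefs_inMX.
    rewrite rmorphD !rmorphM /= -yE -yE' laurent_mono_exponent mpolyXD rmorphM /=.
    by rewrite -!laurent_mono_exponent; ring.
  - move=> b y [v [g [yE pg]]]; have [w [h bE]] := laurent_clear b.
    exists (w + v)%MM, (h * g); split; last exact: cM.
    rewrite rmorphM /= -yE -bE laurent_mono_exponent mpolyXD rmorphM /=.
    by rewrite -!laurent_mono_exponent; ring.
move=> /(ideal_gen_min idJ)[].
  move=> _ [c pc ->]; exists 0%MM, c%:MP.
  rewrite laurent_mono_exponent mpolyX0 rmorph1 mulr1 laurentCE; split=> // v.
  by rewrite mcoeffC mulrC; apply: pM.
move=> v [g [yE pg]]; apply/(coefs_inMX f v p0).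
have -> : f * 'X_[v] = g * 'X_[u].
  apply: laurent_poly_inj; rewrite !rmorphM /= -yE -zE -!laurent_mono_exponent.
  by rewrite mulrAC.
exact/coefs_inMX.
Qed.

Lemma ext_idealC c : ext_ideal p (laurentC n c) <-> p c.
Proof.
have /ext_idealP-> : laurentC n c * laurent_mono R (exponent 0%MM) = laurent_poly c%:MP.
  by rewrite laurent_mono_exponent mpolyX0 rmorph1 mulr1.
have [p0 _ pM] := p_ideal.
split=> [/(_ 0%MM)|pc v]; first by rewrite mcoeffC eqxx mulr1.
by rewrite mcoeffC mulrC; apply: pM.
Qed.

(** After multiplication by a high power of all the variables, the monomials are
    distinct monomials of the polynomial ring, so that the coefficients can be
    read off. *)
Lemma ext_ideal_free (I : eqType) (s : seq I) (c : I -> R) (e : I -> 'rV[int]_n) :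
  uniq s -> {in s &, injective e} ->
  ext_ideal p (\sum_(i <- s) laurentC n (c i) * laurent_mono R (e i)) -> {in s, forall i, p (c i)}.
Proof.
move=> s_uniq e_inj sum_p.
pose N := (\sum_(i <- s) \sum_j absz (e i 0 j)%R)%N.
pose u i := [multinom absz (e i 0 j + N%:Z)%R | j < n].
have uE i : i \in s -> exponent (u i) = e i + const_mx N%:Z.
  move=> si; apply/rowP => j; rewrite !mxE mnmE gez0_abs //.
  have : (absz (e i 0 j)%R <= N)%N.
    by rewrite /N (bigD1_seq i) //= (bigD1 j) //= -addnA leq_addr.
  by move: (e i 0 j) => x; clear -x; move: N => K; lia.
have NE : const_mx N%:Z = exponent [multinom N | i < n].
  by apply/rowP => j; rewrite !mxE mnmE.
have sumE : (\sum_(i <- s) laurentC n (c i) * laurent_mono R (e i)) *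
    laurent_mono R (exponent [multinom N | i < n]) = laurent_poly (\sum_(i <- s) c i *: 'X_[u i]).
  rewrite (rmorph_sum (@laurent_poly R n)) mulr_suml; apply: eq_big_seq => i si /=.
  rewrite -mulrA -laurent_monoD -NE -uE // laurent_mono_exponent -mul_mpolyC rmorphM.
  by rewrite laurentCE.
move/(ext_idealP sumE): sum_p => E i si; have := E (u i).
rewrite raddf_sum (bigD1_seq i) //= mcoeffZ mcoeffX eqxx mulr1 big_seq_cond.
rewrite big1 ?addr0 // => j /andP[sj ji]; rewrite mcoeffZ mcoeffX.
case: eqP => [uji|_]; last by rewrite mulr0.
case/eqP: ji; apply: e_inj => //; apply: (addIr (const_mx N%:Z)).
by rewrite -!uE // uji.
Qed.

End ExtendedIdeals.

Lemma laurent_mono_free (R : idomainType) n (I : eqType) (s : seq I) (c : I -> R)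
    (e : I -> 'rV[int]_n) : uniq s -> {in s &, injective e} ->
  \sum_(i <- s) laurentC n (c i) * laurent_mono R (e i) = 0 -> {in s, forall i, c i = 0}.
Proof.
move=> s_uniq e_inj sum0.
have zero_ideal : is_ideal (fun x : R => x = 0).
  by split=> // [x y -> ->|b x ->]; rewrite ?addr0 ?mulr0.
apply: (ext_ideal_free zero_ideal s_uniq e_inj).
by rewrite sum0; case: (@ext_ideal_ideal R n (fun x : R => x = 0)).
Qed.

Section ExtendedPrimes.
Variables (R : idomainType) (n : nat) (p : R -> Prop).
Local Notation A := (laurent R n).
Hypothesis p_prime : is_prime_ideal p.

Lemma ext_ideal_prime : is_prime_ideal (@ext_ideal R n p).
Proof.
have [p_ideal p1 pM] := p_prime; split; first exact: ext_ideal_ideal.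
  by rewrite -(rmorph1 (@laurentC R n)) ext_idealC.
move=> x y; have [u [f xE]] := laurent_clear x; have [v [g yE]] := laurent_clear y.
rewrite (ext_idealP p_ideal xE) (ext_idealP p_ideal yE).
have /(ext_idealP p_ideal)-> : x * y * laurent_mono R (exponent (u + v)%MM) = laurent_poly (f * g).
  rewrite rmorphM /= -xE -yE laurent_mono_exponent mpolyXD rmorphM /=.
  by rewrite -!laurent_mono_exponent; ring.
exact: coefs_in_prime.
Qed.

(** Denominators cleared, some coefficient of [d] lies outside [p]; [mccoy] says
    that a power of it kills [a] modulo [xi]. *)
Lemma mccoy_laurent (xi : R) (a d : A) :
  (exists q, a * d = laurentC n xi * q) -> ~ ext_ideal p d ->
  exists2 s, ~ p s & exists q, laurentC n s * a = laurentC n xi * q.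
Proof.
have [p_ideal p1 pM] := p_prime; move=> [q adE].
have [u [f aE]] := laurent_clear a; have [v [g dE]] := laurent_clear d.
have [w [h qE]] := laurent_clear q.
rewrite (ext_idealP p_ideal dE) => /boolp.existsNP[l pgl].
have fg : coefs_in (fun c => exists q, c = xi * q) (f * g).
  apply/(coefs_inMX _ w); first by exists 0; rewrite mulr0.
  have -> : f * g * 'X_[w] = xi *: (h * 'X_[(u + v)%MM]).
    apply: laurent_poly_inj; rewrite -mul_mpolyC mpolyXD !rmorphM /= -aE -dE -qE.
    rewrite -laurentCE -!laurent_mono_exponent.
    transitivity (laurent_mono R (exponent u) * laurent_mono R (exponent v)
      * laurent_mono R (exponent w) * (a * d)); first by ring.
    by rewrite adE; ring.
  by move=> x; exists (h * 'X_[(u + v)%MM])@_x; rewrite mcoeffZ.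
have [N /boolp.choice[k kE]] := mccoy fg l; exists (g@_l ^+ N).
  elim: N {kE} => [|N IHN]; first by rewrite expr0.
  by rewrite exprS => /pM[].
pose F := \sum_(x <- msupp (g@_l ^+ N *: f)) k x *: 'X_[x].
exists (laurent_poly F * laurent_mono R (- exponent u)).
apply: (mulIr (laurent_mono_unit R (exponent u))).
rewrite -[LHS]mulrA aE -!mulrA [laurent_mono R (- _) * _]mulrC laurent_monoK mulr1.
rewrite !laurentCE -!rmorphM; congr laurent_poly; rewrite !mul_mpolyC.
rewrite [LHS]mpolyE scaler_sumr; apply: eq_bigr => x _.
by rewrite scalerA -kE.
Qed.

End ExtendedPrimes.

(** * Prime ideals in monomial coordinates *)

(** The rows [M] and [g i] form a basis of the group of exponents. *)
Definition complement n (M : 'rV[int]_n.+1) (g : 'I_n -> 'rV[int]_n.+1) : Prop :=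
  (forall a, exists k (b : 'I_n -> int), a = k *: M + \sum_i b i *: g i) /\
  (forall k (b : 'I_n -> int), k *: M + \sum_i b i *: g i = 0 -> k = 0 /\ forall i, b i = 0).

(** The Smith normal form of the row [M] is [(1, 0, .., 0)] up to sign, so [M] is
    up to sign the first row of a unimodular matrix. *)
Lemma primitive_complement n (M : 'rV[int]_n.+1) :
  primitive_mono M -> exists g, complement M g.
Proof.
move=> primM; have [L L_unit [U U_unit [d _ ME]]] := int_Smith_normal_form M.
pose u := L 0 0 * d`_0; have MuU : M = u *: row 0 U.
  apply/rowP => j; rewrite ME !mxE; rewrite (bigD1 0) //= !mxE big_ord1 !mxE eqxx mulr1n.
  rewrite big1 ?addr0 ?mulrA // => i i0; rewrite !mxE big_ord1 !mxE /=.
  by rewrite eq_sym (negbTE (_ : _ != _)) ?mulr0n ?mulr0 ?mul0r.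
have u_unit : u \is a GRing.unit.
  have : (d`_0 %| \big[gcdz/0]_(i < n.+1) M 0%R i)%Z.
    apply: (big_ind (fun x => d`_0 %| x)%Z) => // [x y dx dy|i _].
      by rewrite dvdz_gcd dx.
    by rewrite MuU !mxE mulrAC dvdz_mull.
  rewrite primM dvdz1 => /eqP d1; rewrite unitrM; apply/andP; split.
    by move: L_unit; rewrite unitmxE det_mx11.
  by rewrite unitrE; move: (d`_0) d1 => [[|[|e]]|[|e]].
exists (fun i => row (lift 0 i) U); split=> [a|k b E].
  exists ((a *m invmx U) 0 0 * u^-1), (fun i => (a *m invmx U) 0 (lift 0 i)).
  rewrite {1}MuU scalerA divrK // -[LHS](mulmxKV U_unit) mulmx_sum_row big_ord_recl.
  by [].
have /(congr1 (mulmxr (invmx U))) : (\row_i (if unlift 0 i is Some j then b j else k * u)) *m U = 0.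
  rewrite mulmx_sum_row big_ord_recl -[RHS]E MuU mxE unlift_none scalerA.
  by congr (_ + _); apply: eq_bigr => i _; rewrite mxE liftK.
rewrite /= mulmxK // mul0mx => /rowP b0; split=> [|i].
  by move: (b0 0); rewrite !mxE unlift_none => ku0; apply: (mulIr u_unit); rewrite ku0 mul0r.
by move: (b0 (lift 0 i)); rewrite !mxE liftK.
Qed.

Lemma natz_scale (V : lmodType int) (v : V) k : k%:Z *: v = v *+ k.
Proof. by rewrite -[k%:Z]intz scaler_int -pmulrn. Qed.

Section MonomialCoordinates.
Variables (R : idomainType) (n : nat).
Local Notation A := (laurent R n.+1).
Variables (M : 'rV[int]_n.+1) (g : 'I_n -> 'rV[int]_n.+1).
Hypothesis Mg : complement M g.

Definition eval_at : {poly R} -> A := horner_eval (laurent_mono R M) \o map_poly (@laurentC R n.+1).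
HB.instance Definition _ := GRing.RMorphism.on eval_at.

(** In the coordinates [M, g], the ring [A] is a localization of the polynomial
    ring in [n] variables over [{poly R}]. *)
Definition coord : {mpoly {poly R}[n]} -> A := mmap eval_at (fun i => laurent_mono R (g i)).
HB.instance Definition _ := GRing.RMorphism.on coord.

Definition coord_exponent (u : 'X_{1..n}) : 'rV[int]_n.+1 := \sum_i (u i)%:Z *: g i.

Lemma coordX u : coord 'X_[u] = laurent_mono R (coord_exponent u).
Proof.
rewrite /coord mmapX /mmap1 /coord_exponent (big_morph _ (@laurent_monoD R n.+1) (laurent_mono0 R n.+1)).
by apply: eq_bigr => i _; rewrite -laurent_monoMn natz_scale.
Qed.

Lemma coordC P : coord P%:MP = eval_at P.
Proof. by rewrite /coord mmapC. Qed.

Lemma eval_atC c : eval_at c%:P = laurentC _ c.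
Proof. by rewrite /eval_at /= /horner_eval map_polyC hornerC. Qed.

Lemma eval_atX : eval_at 'X = laurent_mono R M.
Proof. by rewrite /eval_at /= /horner_eval map_polyX hornerX. Qed.

Lemma coordE f :
  coord f = \sum_(u <- msupp f) eval_at f@_u * laurent_mono R (coord_exponent u).
Proof.
rewrite {1}[f]mpolyE (rmorph_sum coord); apply: eq_bigr => u _.
by rewrite -mul_mpolyC rmorphM /= coordC coordX.
Qed.

Lemma eval_atE (P : {poly R}) k : (size P <= k)%N ->
  eval_at P = \sum_(i < k) laurentC _ P`_i * laurent_mono R (M *+ i).
Proof.
move=> sP; rewrite /eval_at /= /horner_eval (horner_coef_wide _ (n := k)); last first.
  by rewrite (leq_trans _ sP) // size_poly.
by apply: eq_bigr => i _; rewrite coef_map laurent_monoMn.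
Qed.

Lemma coord_free (k k' : nat) u v :
  M *+ k + coord_exponent u = M *+ k' + coord_exponent v -> k = k' /\ u = v.
Proof.
move=> /eqP; rewrite -subr_eq0 opprD addrACA -sumrB => /eqP E.
have [|kk uv] := (Mg.2 (k%:Z - k'%:Z) (fun i => (u i)%:Z - (v i)%:Z)).
  rewrite -[RHS]E; congr (_ + _); last by apply: eq_bigr => i _; rewrite scalerBl.
  by rewrite scalerBl !natz_scale.
split; first by apply/eqP; rewrite -eqz_nat -subr_eq0 kk.
by apply/mnmP => i; apply/eqP; rewrite -eqz_nat -subr_eq0 uv.
Qed.

Lemma coord_inj : injective coord.
Proof.
suff ker0 f : coord f = 0 -> f = 0.
  by move=> f f' E; apply/subr0_eq/ker0; rewrite rmorphB /= E subrr.
pose K := (\sum_(u <- msupp f) size f@_u)%N.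
have sK u : u \in msupp f -> (size f@_u <= K)%N.
  by move=> fu; rewrite /K (bigD1_seq u) ?msupp_uniq //= leq_addr.
rewrite coordE => f0.
pose s := [seq (u, i) | u <- msupp f, i <- enum 'I_K].
have s_uniq : uniq s by apply: allpairs_uniq (msupp_uniq f) (enum_uniq _) _ => -[? ?] [? ?].
have e_inj : {in s &, injective (fun ui : 'X_{1..n} * 'I_K => M *+ ui.2 + coord_exponent ui.1)}.
  by move=> [u i] [v j] _ _ /= /coord_free[/val_inj-> ->].
have sum0 : \sum_(ui <- s) laurentC n.+1 (f@_(ui.1)`_(ui.2 : 'I_K)) *
    laurent_mono R (M *+ ui.2 + coord_exponent ui.1) = 0.
  rewrite -[RHS]f0 big_allpairs; apply: eq_big_seq => u fu.
  rewrite (eval_atE (sK u fu)) mulr_suml big_enum; apply: eq_bigr => i _ /=.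
  by rewrite laurent_monoD mulrA.
have c0 := laurent_mono_free s_uniq e_inj sum0.
apply/mpolyP => u; rewrite mcoeff0; have [fu|/memN_msupp_eq0//] := boolP (u \in msupp f).
apply/polyP => i; rewrite coef0; have [iK|Ki] := ltnP i K; last first.
  by rewrite nth_default // (leq_trans (sK u fu)).
by apply: (c0 (u, Ordinal iK)); apply: allpairs_f => //; rewrite mem_enum.
Qed.

(** Adding a high multiple of [M] and of all the [g i] to an exponent makes its
    coordinates nonnegative. *)
Lemma coord_clear_mono a : exists N0, forall N, (N0 <= N)%N ->
  exists k u, laurent_mono R a * laurent_mono R ((M + \sum_i g i) *+ N)
    = coord (('X^k)%:MP * 'X_[u]).
Proof.
have [k [b aE]] := Mg.1 a; exists (absz k + \sum_i absz (b i))%N => N N2N.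
exists (absz (k + N%:Z)), [multinom absz (b i + N%:Z)%R | i < n].
rewrite rmorphM /= coordC coordX rmorphXn /= eval_atX -laurent_monoMn -!laurent_monoD.
congr (laurent_mono R _).
have kN : (absz (k + N%:Z))%:Z = k + N%:Z.
  by rewrite gez0_abs //; move: N2N; clear; move: (\sum_i _)%N => x; lia.
have bN i : (absz (b i + N%:Z))%:Z = b i + N%:Z.
  rewrite gez0_abs //; move: N2N; rewrite (bigD1 i) //=; clear.
  by move: (\sum_(_ | _) _)%N (b i) => x y; lia.
rewrite -[M *+ _]natz_scale kN {1}aE scalerDl -addrA -[RHS]addrA; congr (_ + _).
rewrite mulrnDl -sumrMnl addrCA natz_scale; congr (_ + _); rewrite -big_split.
by apply: eq_bigr => i _; rewrite mnmE bN scalerDl natz_scale.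
Qed.

Lemma coord_clear (z : A) : exists N0, forall N, (N0 <= N)%N ->
  exists f, z * laurent_mono R ((M + \sum_i g i) *+ N) = coord f.
Proof.
have [s [c [_ ->]]] := laurent_sum z.
elim: s => [|a s [N1 IHs]]; first by exists 0%N => N _; exists 0; rewrite big_nil mul0r rmorph0.
have [N2 aN] := coord_clear_mono a.
exists (maxn N1 N2) => N; rewrite geq_max => /andP[N1N N2N].
have [f fE] := IHs _ N1N; have [k [u aE]] := aN _ N2N.
exists ((c a)%:P%:MP * (('X^k)%:MP * 'X_[u]) + f).
by rewrite big_cons mulrDl fE rmorphD (rmorphM coord) /= -aE coordC eval_atC mulrA.
Qed.

End MonomialCoordinates.

Section CoordinateIdeals.
Variables (R : idomainType) (n : nat).
Local Notation A := (laurent R n.+1).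
Variables (M : 'rV[int]_n.+1) (g : 'I_n -> 'rV[int]_n.+1).
Hypothesis Mg : complement M g.
Local Notation coord := (@coord R n M g).

(** The ideal of [A] generated by the values at [M] of the elements of [P]. *)
Definition coord_ideal (P : {poly R} -> Prop) (z : A) : Prop :=
  exists a f, z * laurent_mono R a = coord f /\ coefs_in P f.

Variable P : {poly R} -> Prop.
Hypotheses (P_prime : is_prime_ideal P) (P_X : ~ P 'X).

Lemma coefs_in_monomial k (u : 'X_{1..n}) : ~ coefs_in P (('X^k)%:MP * 'X_[u]).
Proof.
have [_ P1 PM] := P_prime; move=> /(_ u); rewrite mcoeffCM mcoeffX eqxx mulr1.
by elim: k => [|k IHk]; rewrite ?expr0 // exprS => /PM[].
Qed.

(** Two clearings of the denominators of [z] differ by monomials in the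
    coordinates, which are not in the prime ideal of polynomials with coefficients
    in [P]; so one of them decides membership. *)
Lemma coord_idealP z a f : z * laurent_mono R a = coord f ->
  coord_ideal P z <-> coefs_in P f.
Proof.
have [P_ideal _ _] := P_prime; have [_ _ cM] := coefs_in_ideal n P_ideal.
move=> zE; split=> [[b [h [zE' Ph]]]|Pf]; last by exists a, f.
have [N1 abN] := coord_clear_mono R Mg (b - a); have [N2 oneN] := coord_clear_mono R Mg 0.
have [k [u abE]] := abN _ (leq_maxl N1 N2); have [l [v oneE]] := oneN _ (leq_maxr N1 N2).
have [//|/coefs_in_monomial//] : coefs_in P f \/ coefs_in P (('X^k)%:MP * 'X_[u]).
apply: coefs_in_prime => //.
suff -> : f * (('X^k)%:MP * 'X_[u]) = (('X^l)%:MP * 'X_[v]) * h by apply: cM.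
apply: (coord_inj Mg); rewrite (rmorphM coord) [RHS](rmorphM coord) /= -zE -zE' -abE -oneE.
rewrite laurent_mono0 mul1r laurent_monoD.
transitivity (laurent_mono R a * laurent_mono R (- a) *
  laurent_mono R ((M + \sum_i g i) *+ maxn N1 N2) * (z * laurent_mono R b)).
  by ring.
by rewrite laurent_monoK mul1r.
Qed.

Lemma coord_ideal_prime : is_prime_ideal (coord_ideal P).
Proof.
have [P_ideal P1 _] := P_prime; have [c0 cD cM] := coefs_in_ideal n P_ideal.
split.
- split.
  + by exists 0, 0; rewrite mul0r rmorph0.
  + move=> x y Jx Jy; have [N1 xN] := coord_clear Mg x; have [N2 yN] := coord_clear Mg y.
    have [f xE] := xN _ (leq_maxl N1 N2); have [h yE] := yN _ (leq_maxr N1 N2).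
    move: Jx Jy; rewrite (coord_idealP xE) (coord_idealP yE) => Pf Ph.
    exists ((M + \sum_i g i) *+ maxn N1 N2), (f + h); rewrite mulrDl xE yE rmorphD.
    by split=> //; apply: cD.
  + move=> b x [a [f [xE Pf]]]; have [N bN] := coord_clear Mg b; have [h bE] := bN _ (leqnn N).
    exists ((M + \sum_i g i) *+ N + a), (h * f); split; last exact: cM.
    by rewrite laurent_monoD rmorphM /= -xE -bE mulrACA.
- have /coord_idealP-> : 1 * laurent_mono R 0 = coord 1 by rewrite mul1r laurent_mono0 rmorph1.
  by move=> /(_ 0%MM); rewrite mcoeff1 eqxx.
move=> x y; have [N1 xN] := coord_clear Mg x; have [N2 yN] := coord_clear Mg y.
have [f xE] := xN _ (leqnn _); have [h yE] := yN _ (leqnn _).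
rewrite (coord_idealP xE) (coord_idealP yE).
have /coord_idealP-> : x * y * (laurent_mono R ((M + \sum_i g i) *+ N1 + (M + \sum_i g i) *+ N2))
    = coord (f * h).
  by rewrite laurent_monoD rmorphM /= -xE -yE mulrACA.
exact: coefs_in_prime.
Qed.

Lemma coord_ideal_eval h : P h -> coord_ideal P (eval_at M h).
Proof.
have [[_ _ PM] _ _] := P_prime.
move=> Ph; exists 0, h%:MP; rewrite laurent_mono0 mulr1 coordC; split=> // u.
by rewrite mcoeffC mulrC; apply: PM.
Qed.

Lemma coord_ideal_min (J : A -> Prop) z : is_ideal J ->
  (forall h, P h -> J (eval_at M h)) -> coord_ideal P z -> J z.
Proof.
move=> idJ PJ [a [f [zE Pf]]]; have [_ _ JM] := idJ.
have -> : z = laurent_mono R (- a) * coord f.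
  by rewrite -zE mulrCA [X in _ * X]mulrC laurent_monoK mulr1.
apply: (JM); rewrite coordE; refine (ideal_sum _ (Q := xpredT) idJ _) => u _.
by rewrite mulrC; apply/JM/PJ/Pf.
Qed.

End CoordinateIdeals.

Lemma prime_ideal_ext (B : comNzRingType) (I J : B -> Prop) :
  (forall x, I x <-> J x) -> is_prime_ideal I -> is_prime_ideal J.
Proof. by move=> IJ; suff -> : J = I by []; apply/boolp.predeqP => x; apply: iff_sym. Qed.

Section PolynomialPrimes.
Variable R : idomainType.

(** Evaluated at a monomial [M], these polynomials generate the same ideal as [p]
    and [M - 1]. *)
Lemma value_at1_prime (p : R -> Prop) :
  is_prime_ideal p -> is_prime_ideal (fun h : {poly R} => p h.[1]).
Proof.
move=> [[p0 pD pM] p1 p_prime]; split; first split.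
- by rewrite horner0.
- by move=> x y px py; rewrite hornerD; apply: pD.
- by move=> b x px; rewrite hornerM; apply: pM.
- by rewrite hornerC.
by move=> x y; rewrite hornerM; apply: p_prime.
Qed.

Lemma zero_prime : is_prime_ideal (fun x : R => x = 0).
Proof.
split; first by split=> // [x y -> ->|b x ->]; rewrite ?addr0 ?mulr0.
  by move/eqP; rewrite oner_eq0.
by move=> x y /eqP; rewrite mulf_eq0 => /orP[]/eqP; [left | right].
Qed.

Lemma map_poly_value1 (A : comNzRingType) (f : {rmorphism R -> A}) (h : {poly R}) x :
  exists b, (map_poly f h).[x] = f h.[1] + (x - 1) * b.
Proof.
have /factor_theorem[k kE] : root (h - h.[1]%:P) 1 by rewrite rootE hornerD hornerN hornerC subrr.
exists (map_poly f k).[x]; rewrite -[h in LHS](subrK h.[1]%:P) kE rmorphD rmorphM /= rmorphB /=.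
by rewrite map_polyX !map_polyC /= rmorph1 !hornerE addrC mulrC.
Qed.

Variable Psi : {poly R}.
Hypothesis Psi_ess : essential_poly Psi.
Local Notation PsiK := (map_poly (@tofrac R) Psi).

Let size_K (h : {poly R}) : size (map_poly (@tofrac R) h) = size h.
Proof.
by rewrite size_map_inj_poly ?rmorph0 // => y z /eqP; rewrite tofrac_eq => /eqP.
Qed.

(** Division by a monic polynomial commutes with the extension of scalars to the
    field of fractions. *)
Lemma monic_dvd_fraction (h : {poly R}) :
  PsiK %| map_poly (@tofrac R) h -> exists q, h = Psi * q.
Proof.
have [Psi_monic sPsi _ _ _] := Psi_ess.
have hE := Pdiv.IdomainMonic.divp_eq Psi_monic h.
rewrite {1}hE rmorphD rmorphM /= dvdp_addr ?dvdp_mull // => /dvdp_leq dvd_le.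
exists (h %/ Psi); rewrite {1}hE mulrC; apply/eqP; rewrite -subr_eq0 addrC addKr.
apply/negPn/negP => r0.
have : (size Psi <= size (h %% Psi)%R)%N.
  by rewrite -!size_K; apply: dvd_le; rewrite -size_poly_gt0 size_K size_poly_gt0.
by rewrite leqNgt ltn_modpN0 ?monic_neq0.
Qed.

(** [Psi] is irreducible over the field of fractions, and divisibility by [Psi]
    can be tested there. *)
Lemma essential_poly_prime : is_prime_ideal (fun h : {poly R} => exists q, h = Psi * q).
Proof.
have [Psi_monic sPsi [_ irrPsi] _ _] := Psi_ess.
split; first exact: principal_ideal.
  move=> [q /esym/(congr1 (fun h : {poly R} => size h))]; rewrite size_poly1 => sq.
  have q0 : q != 0 by apply: contra_eq_neq sq => ->; rewrite mulr0 size_poly0.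
  move: sq; rewrite (size_monicM Psi_monic q0); case: (size Psi) sPsi => [|[|k]] // _.
  by rewrite addSn /= addSn => -[] /eqP; rewrite addn_eq0 size_poly_eq0 (negbTE q0) andbF.
move=> x y [q xyE].
have dvd_xy : PsiK %| map_poly (@tofrac R) x * map_poly (@tofrac R) y.
  by rewrite -rmorphM xyE rmorphM dvdp_mulr.
have [cop|ncop] := boolP (coprimep PsiK (map_poly (@tofrac R) x)).
  by right; apply: monic_dvd_fraction; rewrite -(Gauss_dvdpr _ cop).
left; apply: monic_dvd_fraction.
by rewrite -(eqp_dvdl _ (irrPsi _ ncop (dvdp_gcdl _ _))) dvdp_gcdr.
Qed.

Lemma essential_poly_X : ~ exists q, 'X = Psi * q.
Proof.
have [Psi_monic sPsi _ [copX _] _] := Psi_ess; move=> [q /(congr1 (map_poly (@tofrac R)))].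
rewrite map_polyX rmorphM /= => XE; have dvdX : PsiK %| 'X by rewrite XE dvdp_mulr.
have : PsiK %| gcdp PsiK 'X by rewrite dvdp_gcd dvdpp.
have gcd1 : size (gcdp PsiK 'X) = 1%N by apply/eqP; rewrite -coprimep_def.
move/(dvdp_leq (_ : gcdp PsiK 'X != 0)); rewrite -size_poly_gt0 gcd1 size_K.
by move=> /(_ isT); rewrite leqNgt sPsi.
Qed.

Lemma essential_poly_value1 : Psi.[1] != 0.
Proof.
have [Psi_monic sPsi _ [_ cop1] _] := Psi_ess.
move: cop1; rewrite -[1]polyC1 coprimep_XsubC rootE -[1](rmorph1 (@tofrac R)) horner_map tofrac_eq0.
by [].
Qed.

End PolynomialPrimes.

Section PrimesOfLaurent.
Variables (R : idomainType) (n : nat).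
Local Notation A := (laurent R n.+1).
Variable M : 'rV[int]_n.+1.
Hypothesis M_prim : primitive_mono M.

Lemma eval_at_value (h : {poly R}) : eval_at M h = (map_poly (@laurentC R n.+1) h).[laurent_mono R M].
Proof. by []. Qed.

(** The quotient of [A] by [Psi(M)] is a Laurent polynomial ring over
    [R[x] / Psi], so it is a domain. *)
Lemma essential_factor_prime (Psi : {poly R}) : essential_poly Psi ->
  is_prime_ideal (fun z : A => exists q, z = (map_poly (@laurentC R n.+1) Psi).[laurent_mono R M] * q).
Proof.
move=> Psi_ess; have [g Mg] := primitive_complement M_prim.
have P_prime := essential_poly_prime Psi_ess; have P_X := essential_poly_X Psi_ess.
apply: prime_ideal_ext (coord_ideal_prime Mg P_prime P_X) => z; split.
  apply: (coord_ideal_min (principal_ideal _)) => h [q ->].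
  by exists (eval_at M q); rewrite rmorphM.
have [[_ _ JM] _ _] := coord_ideal_prime Mg P_prime P_X.
move=> [q ->]; rewrite mulrC; apply: (JM).
by apply: coord_ideal_eval P_prime _ _; exists 1; rewrite mulr1.
Qed.

Lemma congruence_ideal_ideal (p : R -> Prop) : is_ideal p ->
  is_ideal (fun x : A => exists a b, ext_ideal p a /\ x = a + (laurent_mono R M - 1) * b).
Proof.
move=> p_ideal; have [J0 JD JM] := @ext_ideal_ideal R n.+1 p; split.
- by exists 0, 0; rewrite mulr0 addr0.
- move=> _ _ [a [b [pa ->]]] [c [d [pc ->]]]; exists (a + c), (b + d); split; first exact: JD.
  by rewrite mulrDr addrACA.
- move=> e _ [a [b [pa ->]]]; exists (e * a), (e * b); split; first exact: JM.
  by rewrite mulrDr [in RHS]mulrCA.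
Qed.

(** In monomial coordinates, these are the polynomials whose coefficients take
    values in [p] at [1]. *)
Lemma congruence_ideal_prime (p : R -> Prop) : is_prime_ideal p ->
  is_prime_ideal (fun x : A => exists a b, ext_ideal p a /\ x = a + (laurent_mono R M - 1) * b).
Proof.
move=> p_prime; have [p_ideal p1 _] := p_prime; have [p0 _ _] := p_ideal.
have [g Mg] := primitive_complement M_prim.
have P_prime := value_at1_prime p_prime.
have P_X : ~ p ('X : {poly R}).[1] by rewrite hornerX.
apply: prime_ideal_ext (coord_ideal_prime Mg P_prime P_X) => z; split.
  apply: (coord_ideal_min (congruence_ideal_ideal p_ideal)) => h ph.
  have [b hE] := map_poly_value1 (@laurentC R n.+1) h (laurent_mono R M).
  by exists (laurentC _ h.[1]), b; split; rewrite ?ext_idealC // eval_at_value hE.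
have [J_ideal _ _] := coord_ideal_prime Mg P_prime P_X; have [_ JD JM] := J_ideal.
move=> [a [b [pa ->]]]; apply: (JD); last first.
  rewrite mulrC; apply: (JM); rewrite -eval_atX -(rmorph1 (@eval_at R n M)) -rmorphB.
  by apply: coord_ideal_eval P_prime _ _; rewrite hornerD hornerN hornerX hornerC subrr.
apply: ideal_gen_min pa => // _ [c pc ->]; rewrite -(eval_atC M).
by apply: coord_ideal_eval P_prime _ _; rewrite hornerC.
Qed.

(** The elements whose image modulo [M - 1] vanishes, in terms of coordinates. *)
Definition vanishes_at1 g := coord_ideal M g (fun h : {poly R} => h.[1] = 0).

(** [M - 1] corresponds to ['X - 1] in monomial coordinates, and it divides a
    nonzero coefficient only finitely often. *)
Lemma adic_order g (z : A) : complement M g -> z != 0 ->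
  exists k y, z = (laurent_mono R M - 1) ^+ k * y /\ ~ vanishes_at1 g y.
Proof.
move=> Mg; have [N zN] := coord_clear Mg z; have [f zE] := zN _ (leqnn N).
move=> z0; have f0 : f != 0.
  apply: contra_neq z0 => f0; apply: (mulIr (laurent_mono_unit R ((M + \sum_i g i) *+ N))).
  by rewrite zE f0 rmorph0 mul0r.
move: zE f0; set c := laurent_mono R _; move=> {zN} zE.
rewrite -msupp_eq0 -size_eq0 -lt0n -has_predT => /hasP[u fu _].
move: {2}(size _) (leqnn (size f@_u)) => s; move: fu.
have P_prime := value_at1_prime (zero_prime R).
have P_X : ('X : {poly R}).[1] <> 0 by rewrite hornerX; apply/eqP/oner_neq0.
elim: s f z {z0} zE => [|s IHs] f z zE fu.
  by move: fu; rewrite mcoeff_msupp leqn0 size_poly_eq0 => /negbTE->.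
move=> sf; have [vz|] := boolp.pselect (vanishes_at1 g z); last by exists 0%N, z; rewrite mul1r.
have {}vz : forall v, exists h, f@_v = h * ('X - 1).
  move=> v; have /factor_theorem[h hE] : root f@_v 1.
    by rewrite rootE; apply/eqP; move/(coord_idealP Mg P_prime P_X zE): vz; apply.
  by exists h; rewrite hE polyC1.
have /boolp.choice[h hE] := vz.
pose f' := \sum_(v <- msupp f) h v *: 'X_[v].
have fE : f = ('X - 1)%:MP * f'.
  rewrite {1}[f]mpolyE mulr_sumr; apply: eq_bigr => v _.
  by rewrite mul_mpolyC scalerA hE mulrC.
pose z' := coord M g f' * laurent_mono R (- ((M + \sum_i g i) *+ N)).
have zE' : z = (laurent_mono R M - 1) * z'.
  apply: (mulIr (laurent_mono_unit R ((M + \sum_i g i) *+ N))).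
  rewrite zE fE (rmorphM (coord M g)) /= coordC rmorphB rmorph1 /= eval_atX -!mulrA; congr (_ * _).
  by rewrite [laurent_mono R (- _) * _]mulrC laurent_monoK mulr1.
have z'E : z' * c = coord M g f'.
  by rewrite -mulrA [laurent_mono R (- _) * _]mulrC laurent_monoK mulr1.
have f'u : f@_u = ('X - 1) * f'@_u by rewrite fE mcoeffCM.
have f'u0 : f'@_u != 0.
  by move: fu; rewrite mcoeff_msupp; apply: contraNneq => e; rewrite f'u e mulr0.
have [||k [y [yE vy]]] := IHs f' z' z'E.
- by rewrite mcoeff_msupp.
- move: sf; rewrite f'u -polyC1 size_monicM ?monicXsubC // size_XsubC.
  by rewrite add2n.
by exists k.+1, y; rewrite zE' yE exprS mulrA.
Qed.

(** Modulo the kernel of an associated morphism, [M] becomes [1] and the monomials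
    in the remaining coordinates stay independent. *)
Lemma associated_neq0 g (f : {rmorphism A -> laurent R n}) (y : A) :
  complement M g -> associated_morphism M f -> ~ vanishes_at1 g y -> f y != 0.
Proof.
move=> Mg [fC [ga [ga_surj ga_ker fmono]]] vy; apply/eqP => fy; apply: vy.
have [N yN] := coord_clear Mg y; have [h yE] := yN _ (leqnn N).
exists ((M + \sum_i g i) *+ N), h; split=> // u.
have [hu|/memN_msupp_eq0->] := boolP (u \in msupp h); last by rewrite horner0.
have fcoord : f (coord M g h) = \sum_(v <- msupp h) laurentC n (h@_v).[1] * laurent_mono R (ga (coord_exponent g v)).
  rewrite coordE rmorph_sum; apply: eq_bigr => v _.
  have [b bE] := map_poly_value1 (@laurentC R n.+1) h@_v (laurent_mono R M).
  rewrite eval_at_value bE rmorphM rmorphD rmorphM rmorphB rmorph1 /= fC !fmono.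
  have -> : ga M = 0 by apply/ga_ker; exists 1; rewrite scale1r.
  by rewrite laurent_mono0 subrr mul0r addr0.
apply: (laurent_mono_free (c := fun v => (h@_v).[1])
  (e := fun v => ga (coord_exponent g v)) (msupp_uniq h) _ _ hu).
  move=> v w _ _ /= /eqP; rewrite -subr_eq0 -raddfB => /eqP/ga_ker[k vwk].
  have [|_ vw] := Mg.2 (- k) (fun i => (v i)%:Z - (w i)%:Z).
    have -> : \sum_i ((v i)%:Z - (w i)%:Z) *: g i = coord_exponent g v - coord_exponent g w.
      by rewrite -sumrB; apply: eq_bigr => i _; rewrite scalerBl.
    by rewrite vwk scaleNr addNr.
  by apply/mnmP => i; apply/eqP; rewrite -eqz_nat -subr_eq0 vw.
by rewrite -fcoord -yE rmorphM fy mul0r.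
Qed.

End PrimesOfLaurent.

Lemma q_ideal_prime (R : idomainType) m (p : R -> Prop) (Ms : seq 'rV[int]_m.+1) j :
  is_prime_ideal p -> (forall M, M \in Ms -> primitive_mono M) -> (j <= size Ms)%N ->
  is_prime_ideal (@q_ideal R m.+1 p Ms j).
Proof.
move=> p_prime Ms_prim; case: j => [_|j jMs]; first exact: ext_ideal_prime.
by apply: congruence_ideal_prime => //; apply/Ms_prim/mem_nth.
Qed.

(** * Monomial morphisms and places *)

(** What all adapted morphisms have in common: they are induced by surjections of
    the groups of monomials. *)
Definition monomial_morphism (R : idomainType) n k (f : laurent R n -> laurent R k) : Prop :=
  (forall c, f (laurentC n c) = laurentC k c) /\
  exists ga : {additive 'rV[int]_n -> 'rV[int]_k},
    (forall b, exists a, ga a = b) /\ forall a, f (laurent_mono R a) = laurent_mono R (ga a).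

Lemma adapted_monomial (R : idomainType) n k (f : laurent R n -> laurent R k) :
  adapted f -> monomial_morphism f.
Proof.
elim=> {n k f} [n M f _ [fC [ga [ga_surj _ fmono]]]|].
  by split=> //; exists ga.
move=> n k M f g h _ [fC [ga [ga_surj _ fmono]]] _ [gC [de [de_surj gmono]]] hE.
split; first by move=> c; rewrite hE /= fC gC.
exists (de \o ga)%FUN; split=> [b|a]; last by rewrite hE /= fmono gmono.
by have [a <-] := de_surj b; have [a' <-] := ga_surj a; exists a'.
Qed.

Section MonomialMorphisms.
Variables (R : idomainType) (n k : nat) (f : {rmorphism laurent R n -> laurent R k}).
Hypothesis f_mono : monomial_morphism f.

Lemma monomial_surjective y : exists x, f x = y.
Proof.
have [fC [ga [ga_surj fmono]]] := f_mono; have [s [c [_ ->]]] := laurent_sum y.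
elim: s => [|b s [x xE]]; first by exists 0; rewrite big_nil rmorph0.
have [a aE] := ga_surj b; exists (laurentC n (c b) * laurent_mono R a + x).
by rewrite big_cons rmorphD rmorphM fC fmono aE xE.
Qed.

Lemma monomial_ext_ideal (p : R -> Prop) x : is_ideal p ->
  ext_ideal p x -> ext_ideal p (f x).
Proof.
have [fC _] := f_mono => p_ideal [l [c [g [gS ->]]]]; have [_ _ JM] := @ext_ideal_ideal R k p.
rewrite rmorph_sum; refine (ideal_sum _ (Q := xpredT) (@ext_ideal_ideal R k p) _) => i _.
have [d pd ->] := gS i; rewrite rmorphM fC; apply/JM/ideal_gen_mem; by exists d.
Qed.

Lemma monomial_horner (P : {poly R}) x :
  f (map_poly (@laurentC R n) P).[x] = (map_poly (@laurentC R k) P).[f x].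
Proof.
have [fC _] := f_mono; rewrite -horner_map -map_poly_comp; congr (_.[_]).
by apply: eq_map_poly => c /=.
Qed.

End MonomialMorphisms.

Lemma rV_int_torsion_free n (a : 'rV[int]_n) : a != 0 -> injective (fun i => a *+ i).
Proof.
move=> /eqP a0 i j; have /boolp.existsNP[l al] : ~ forall l, a 0 l = 0.
  by move=> al; apply: a0; apply/rowP => l; rewrite al mxE.
move=> /rowP/(_ l); rewrite !mulmxnE => E.
apply/eqP; rewrite -eqz_nat; apply/eqP; apply: (mulfI (introN eqP al)).
by rewrite -[i%:Z]natz -[j%:Z]natz !mulr_natr.
Qed.

(** The powers of a nontrivial monomial are distinct, so the leading coefficient
    [1] of [P] is also a coefficient of the value. *)
Lemma monic_value_notin (R : idomainType) n (p : R -> Prop) (P : {poly R}) (a : 'rV[int]_n) :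
  is_ideal p -> ~ p 1 -> P \is monic -> a != 0 ->
  ~ ext_ideal p (map_poly (@laurentC R n) P).[laurent_mono R a].
Proof.
move=> p_ideal p1 P_monic a0.
have -> : (map_poly (@laurentC R n) P).[laurent_mono R a] =
    \sum_(i <- iota 0 (size P)) laurentC n P`_i * laurent_mono R (a *+ i).
  rewrite (horner_coef_wide _ (n := size P)) ?size_poly //.
  have -> : iota 0 (size P) = index_iota 0 (size P) by rewrite /index_iota subn0.
  rewrite big_mkord.
  by apply: eq_bigr => i _; rewrite coef_map laurent_monoMn.
move/(ext_ideal_free p_ideal (iota_uniq _ _)) => /(_ _ (size P).-1) lead.
apply: p1; rewrite -(monicP P_monic); apply: lead.
  by move=> i j _ _; apply: rV_int_torsion_free.
by rewrite mem_iota /= add0n prednK // size_poly_gt0 monic_neq0.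
Qed.

(** A place is given by its valuation ring [V] and its residue map [res], which is
    only meaningful on [V]. *)
Definition place (L K : fieldType) (V : L -> Prop) (res : L -> K) : Prop :=
  [/\ V 1 /\ res 1 = 1,
      forall x y, V x -> V y -> V (x - y) /\ res (x - y) = res x - res y,
      forall x y, V x -> V y -> V (x * y) /\ res (x * y) = res x * res y &
      forall x, V x \/ V x^-1 /\ res x^-1 = 0].

Definition extends_to_place (A B : idomainType) (f : A -> B) (V : {fraction A} -> Prop)
    (res : {fraction A} -> {fraction B}) : Prop :=
  place V res /\ forall a, V a%:F /\ res a%:F = (f a)%:F.

(** The localization of [A] at the kernel of [f] is the valuation ring of the
    [M - 1]-adic valuation: up to powers of [M - 1], every nonzero element of [A]
    has a nonzero image. *)
Lemma associated_place (R : idomainType) n (M : 'rV[int]_n.+1)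
    (f : {rmorphism laurent R n.+1 -> laurent R n}) :
  primitive_mono M -> associated_morphism M f ->
  exists V res, extends_to_place f V res.
Proof.
move=> M_prim fM; have [g Mg] := primitive_complement M_prim.
pose A := laurent R n.+1.
pose V (z : {fraction A}) := exists a b, f b != 0 /\ z = a%:F / b%:F.
have f0 b : f b != 0 -> b%:F != 0.
  by rewrite tofrac_eq0; apply: contra_neq => ->; rewrite rmorph0.
have /boolp.choice[res resP] (z : {fraction A}) : exists w : {fraction laurent R n},
    forall a b, f b != 0 -> z = a%:F / b%:F -> w = (f a)%:F / (f b)%:F.
  have [[a [b [fb zE]]]|nV] := boolp.pselect (V z); last first.
    by exists 0 => a b fb zE; case: nV; exists a, b.
  exists ((f a)%:F / (f b)%:F) => c d fd; rewrite zE => /eqP.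
  rewrite eqr_div ?f0 // -!tofracM tofrac_eq => /eqP E.
  have fb' : (f b)%:F != 0 by rewrite tofrac_eq0; exact: fb.
  have fd' : (f d)%:F != 0 by rewrite tofrac_eq0; exact: fd.
  by apply/eqP; rewrite (eqr_div _ _ fb' fd') -!tofracM -!(rmorphM f) E eqxx.
have VE a b : f b != 0 -> V (a%:F / b%:F) /\ res (a%:F / b%:F) = (f a)%:F / (f b)%:F.
  by move=> fb; split; [exists a, b | apply: resP].
have Va a : V a%:F /\ res a%:F = (f a)%:F.
  have := VE a 1; rewrite !rmorph1 !divr1; apply; exact: oner_neq0.
exists V, res; split=> //; split.
- by have := Va 1; rewrite !rmorph1.
- move=> _ _ [a [b [fb ->]]] [c [d [fd ->]]].
  have fb' : (f b)%:F != 0 by rewrite tofrac_eq0; exact: fb.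
  have fd' : (f d)%:F != 0 by rewrite tofrac_eq0; exact: fd.
  rewrite (proj2 (VE _ _ fb)) (proj2 (VE _ _ fd)) -!mulNr -!tofracN.
  rewrite (addf_div _ _ (f0 _ fb) (f0 _ fd)) (addf_div _ _ fb' fd').
  rewrite -!tofracM -!tofracD -!(rmorphN f) -!(rmorphM f) -(rmorphD f).
  by apply: VE; rewrite rmorphM; exact: (mulf_neq0 fb fd).
- move=> _ _ [a [b [fb ->]]] [c [d [fd ->]]].
  rewrite (proj2 (VE _ _ fb)) (proj2 (VE _ _ fd)) !mulf_div.
  by rewrite -!tofracM -!(rmorphM f); apply: VE; rewrite rmorphM; exact: (mulf_neq0 fb fd).
move=> z; have [a [b [b0 ->]]] := fraction_quotient z.
have [->|a0] := eqVneq a 0; first by left; rewrite rmorph0 mul0r -(rmorph0 (@tofrac A)); case: (Va 0).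
have [k [a' [aE va]]] := adic_order Mg a0; have [l [b' [bE vb]]] := adic_order Mg b0.
have fa := associated_neq0 Mg fM va; have fb := associated_neq0 Mg fM vb.
have fm1 : f (laurent_mono R M - 1) = 0.
  have [_ [ga [_ ga_ker fmono]]] := fM.
  have gaM : ga M = 0 by apply/ga_ker; exists 1; rewrite scale1r.
  by rewrite rmorphB rmorph1 fmono gaM laurent_mono0 subrr.
have m10 : laurent_mono R M - 1 != 0.
  have -> : laurent_mono R M - 1 = coord M g ('X - 1%:P)%:MP.
    by rewrite coordC rmorphB /= eval_atX eval_atC rmorph1.
  rewrite -(rmorph0 (coord M g)) (inj_eq (coord_inj Mg)) -(mpolyC0 n) (can_eq (@mpolyCK n _)).
  by rewrite polyXsubC_eq0.
have ltkl i j c d : (i < j)%N -> f c != 0 -> f d != 0 ->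
    let x := ((laurent_mono R M - 1) ^+ i * c)%:F / ((laurent_mono R M - 1) ^+ j * d)%:F in
    V x^-1 /\ res x^-1 = 0.
  move=> ij fc fd x; have -> : x^-1 = ((laurent_mono R M - 1) ^+ (j - i) * d)%:F / c%:F.
    rewrite /x invf_div -{1}(subnKC (ltnW ij)) exprD -mulrA.
    rewrite (tofracM (_ ^+ i)) [in X in _ / X]tofracM.
    by rewrite -mulf_div divff ?mul1r // tofrac_eq0 expf_neq0.
  have [Vx ->] := VE ((laurent_mono R M - 1) ^+ (j - i) * d) c fc; split=> //.
  by rewrite (rmorphM f) (rmorphXn f) fm1 expr0n subn_eq0 leqNgt ij mul0r rmorph0 mul0r.
rewrite aE bE; have [lk|kl] := leqP l k; last first.
  by right; exact: (ltkl _ _ _ _ kl fa fb).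
left; rewrite -(subnKC lk) exprD -mulrA (tofracM (_ ^+ l)) [in X in _ / X]tofracM.
rewrite -mulf_div divff ?mul1r ?tofrac_eq0 ?expf_neq0 //.
by have [] := VE ((laurent_mono R M - 1) ^+ (k - l) * a') b' fb.
Qed.

Lemma place_comp (L K E : fieldType) (V : L -> Prop) (res : L -> K) (W : K -> Prop) (res' : K -> E) :
  place V res -> place W res' ->
  place (fun x => V x /\ W (res x)) (fun x => res' (res x)).
Proof.
move=> [[V1 r1] VB VM VV] [[W1 s1] WB WM WV]; split.
- by rewrite r1.
- move=> x y [Vx Wx] [Vy Wy]; have [Vxy ->] := VB _ _ Vx Vy.
  by have [Wxy ->] := WB _ _ Wx Wy.
- move=> x y [Vx Wx] [Vy Wy]; have [Vxy ->] := VM _ _ Vx Vy.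
  by have [Wxy ->] := WM _ _ Wx Wy.
have W0 : W 0 /\ res' 0 = 0 by have := WB _ _ W1 W1; rewrite !subrr.
have resV x : V x -> res x != 0 -> V x^-1 /\ res x^-1 = (res x)^-1.
  move=> Vx rx0; have [Vx'|[Vx' rx'0]] := VV x^-1.
    have x0 : x != 0.
      by apply: contra_neq rx0 => ->; have [] := VB _ _ V1 V1; rewrite !subrr.
    split=> //; apply: (mulfI rx0); rewrite divff //.
    by have [_ <-] := VM _ _ Vx Vx'; rewrite divff.
  by move: rx0; rewrite -[x]invrK rx'0 eqxx.
move=> x; have [Vx|[Vx' rx'0]] := VV x; last by right; rewrite rx'0; case: W0.
have [rx0|rx0] := eqVneq (res x) 0; first by left; rewrite rx0; case: W0.
have [Vx' rxV] := resV x Vx rx0.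
by have [Wx|[Wx' s0]] := WV (res x); [left | right; rewrite /= rxV].
Qed.

(** Places compose, so the adic places of the factors give one for the composite. *)
Lemma adapted_place (R : idomainType) n k (f : laurent R n -> laurent R k) :
  adapted f -> exists V res, extends_to_place f V res.
Proof.
elim=> {n k f} [n M f M_prim fM|n k M f g h M_prim fM _ [W [res' [plW gW]]] hE].
  exact: associated_place fM.
have [V [res [plV fV]]] := associated_place M_prim fM.
exists (fun x => V x /\ W (res x)), (fun x => res' (res x)).
split; first exact: place_comp.
move=> a; have [Va ->] := fV a; have [Wa ->] := gW (f a).
by rewrite hE.
Qed.

(** * Split blocks of an algebra over a field *)

Section DeltaMatrices.
Variable C : comNzRingType.

Lemma mul_delta_mxE m n k l (X : 'M[C]_(m, n)) (Y : 'M[C]_(k, l)) i j a b :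
  (X *m delta_mx i j *m Y) a b = X a i * Y j b.
Proof.
rewrite mxE (bigD1 j) //= mxE (bigD1 i) //= mxE !eqxx mulr1 big1 => [|h hi]; last first.
  by rewrite mxE (negbTE hi) mulr0.
rewrite addr0 big1 ?addr0 // => h hj; rewrite mxE big1 ?mul0r // => g _.
by rewrite mxE (negbTE hj) andbF mulr0.
Qed.

Lemma mxtrace_delta n (X : 'M[C]_n) i j : \tr (X *m delta_mx i j) = X j i.
Proof.
rewrite -[X *m _]mulmx1 /mxtrace (eq_bigr (fun a => X a i * (1%:M : 'M_n) j a)); last first.
  by move=> a _; rewrite mul_delta_mxE.
rewrite (bigD1 j) //= mxE eqxx mulr1 big1 ?addr0 // => a aj.
by rewrite mxE eq_sym (negbTE aj) mulr0.
Qed.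

Lemma commuting_scalar n (X : 'M[C]_n.+1) :
  (forall Y, X *m Y = Y *m X) -> X = (X 0 0)%:M.
Proof.
move=> cX; apply/matrixP => k i; have /matrixP/(_ k 0) := cX (delta_mx i 0).
rewrite -[X *m _]mulmx1 -[delta_mx _ _ *m X]mul1mx mulmxA !mul_delta_mxE !mxE eqxx mulr1 => ->.
by rewrite mulr_natl.
Qed.

End DeltaMatrices.

Section SplitBlocks.
Variables (L : fieldType) (E : falgType L).
Local Notation charT := 'Hom(E, L^o).

(** The central idempotent [e] cuts out a matrix algebra, on which [rho] is an
    isomorphism. *)
Definition splits n (rho : {lrmorphism E -> 'M[L]_n.+1}) (e : E) : Prop :=
  [/\ central e, rho e = 1, forall x, rho x = 0 -> e * x = 0 & forall X, exists x, rho x = X].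

Definition block_idempotent (chi : charT) (e : E) : Prop :=
  exists n (rho : {lrmorphism E -> 'M[L]_n.+1}), splits rho e /\ affords rho chi.

Section OneBlock.
Variables (n : nat) (rho : {lrmorphism E -> 'M[L]_n.+1}) (e : E).
Hypothesis rho_e : splits rho e.

Lemma splits_eq x y : rho x = rho y -> e * x = e * y.
Proof.
have [_ _ ker _] := rho_e; move=> xy; apply/subr0_eq.
by rewrite -mulrBr; apply: ker; rewrite rmorphB /= xy subrr.
Qed.

Lemma splits_idem : e * e = e.
Proof.
have [_ re _ _] := rho_e; rewrite -[RHS]mulr1; apply: splits_eq.
by rewrite re rmorph1.
Qed.

Lemma splits_irreducible : irreducible_rep rho.
Proof.
have [_ _ _ surj] := rho_e; move=> U subU.
have [->|U0] := eqVneq U 0; [by left | right].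
have [i [j Uij]] : exists i j, U i j != 0.
  apply: boolp.contrapT => nU; case/eqP: U0; apply/matrixP => i j; rewrite mxE.
  by apply/eqP/negPn/negP => Uij; apply: nU; exists i, j.
rewrite -sub1mx; apply/row_subP => k.
have [x xE] := surj ((U i j)^-1 *: delta_mx j k).
suff -> : row k 1%:M = row i U *m rho x.
  by apply: submx_trans (subU x); apply: submxMr; apply: row_sub.
rewrite xE -scalemxAr; apply/rowP => l; rewrite !mxE (bigD1 j) //= !mxE eqxx /=.
rewrite big1 => [|h hj]; last by rewrite !mxE (negbTE hj) mulr0.
by rewrite addr0 mulrA mulVf // mul1r eq_sym.
Qed.

Lemma splits_neq0 : e != 0.
Proof.
have [_ re _ _] := rho_e; apply/eqP => e0; move: re; rewrite e0 rmorph0 => /eqP.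
by rewrite eq_sym oner_eq0.
Qed.

Lemma splits_primitive : primitive_central_idempotent e.
Proof.
have [ce re ker surj] := rho_e; split=> //; [exact: splits_idem | exact: splits_neq0 |].
move=> f cf ff ef.
have [c fE] : exists c, rho f = c%:M.
  exists (rho f 0 0); apply: commuting_scalar => Y; have [x <-] := surj Y.
  by rewrite !mulmxE -!rmorphM /= cf.
have : c * c = c.
  have /matrixP/(_ 0 0) : rho (f * f) = rho f by rewrite ff.
  by rewrite rmorphM /= fE -mulmxE -scalar_mxM !mxE eqxx !mulr1n.
move/eqP; rewrite -subr_eq0 -{3}[c]mulr1 -mulrBr mulf_eq0 subr_eq0 => /orP[] /eqP cE.
  by left; rewrite -ef; apply: ker; rewrite fE cE raddf0.
right; rewrite -ef -[RHS]mulr1; apply: splits_eq; rewrite fE cE.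
exact: esym (rmorph1 rho).
Qed.

Variable chi : charT.
Hypothesis rho_chi : affords rho chi.

Lemma splits_attached : attached_idempotent chi e.
Proof.
have [_ re _ _] := rho_e; split; first exact: splits_primitive.
by exists n, rho; split=> //; exact: splits_irreducible.
Qed.

Lemma splits_irr : is_irr chi.
Proof. by exists n, rho; split=> //; exact: splits_irreducible. Qed.

Lemma splits_char_neq0 : exists x, chi x <> 0.
Proof.
have [_ _ _ surj] := rho_e; have [x xE] := surj (delta_mx 0 0); exists x.
rewrite rho_chi xE /mxtrace (bigD1 0) //= mxE eqxx big1 ?addr0 => [|i i0].
  exact/eqP/oner_neq0.
by rewrite mxE (negbTE i0).
Qed.

(** Two primitive central idempotents are equal or orthogonal; if [f] were
    orthogonal to [e], then [chi] would vanish. *)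
Lemma attached_unique f : attached_idempotent chi f -> f = e.
Proof.
move=> [[cf ff f0 f_prim] [m [sg [sg_irr sg_chi sg_f]]]].
have [ce ee e0 e_prim] := splits_primitive; have [_ re ker _] := rho_e.
have cef : central (e * f) by move=> h; rewrite -mulrA cf !mulrA ce.
have efef : (e * f) * (e * f) = e * f.
  by rewrite -mulrA [f * _]mulrA (cf e) !mulrA ee -mulrA ff.
have e_ef : e * (e * f) = e * f by rewrite mulrA ee.
have f_ef : f * (e * f) = e * f by rewrite mulrA (cf e) -mulrA ff.
have [ef0|efE] := e_prim _ cef efef e_ef; last first.
  have [ef0|<-//] := f_prim _ cef efef f_ef.
  by case/eqP: e0; rewrite -efE.
have [x []] := splits_char_neq0.
have -> : chi x = chi (x * e) by rewrite !rho_chi rmorphM /= re mulr1.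
rewrite sg_chi -[x * e]mulr1 !rmorphM rmorph1 /= -[1]sg_f -!rmorphM /=.
by rewrite -mulrA ef0 mulr0 rmorph0 mxtrace0.
Qed.

End OneBlock.

(** Matrix units of the block for [rho] are mapped by [sg] to elements whose traces
    are determined by their products. *)
Lemma splits_trace n (rho : {lrmorphism E -> 'M[L]_n.+1}) m (sg : {lrmorphism E -> 'M[L]_m.+1}) e :
  splits rho e -> splits sg e -> forall x, \tr (rho x) = \tr (sg x).
Proof.
move=> rho_e sg_e x; have [_ re _ surj] := rho_e; have [_ se ker' surj'] := sg_e.
have eqv y z : rho y = rho z -> sg y = sg z.
  move=> /(splits_eq rho_e)/(congr1 sg).
  by rewrite [LHS]rmorphM [RHS]rmorphM /= se !mul1r.
have /boolp.choice[u uE] (ij : 'I_n.+1 * 'I_n.+1) : exists y, rho y = delta_mx ij.1 ij.2.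
  exact: surj.
have uM i j k l : sg (u (i, j)) *m sg (u (k, l)) = (j == k)%:R *: sg (u (i, l)).
  rewrite mulmxE -rmorphM -linearZ; apply: eqv; rewrite rmorphM linearZ /= !uE -mulmxE.
  by rewrite mul_delta_mx_cond scaler_nat.
pose c := \tr (sg (u (0, 0))).
have tru i j : \tr (sg (u (i, j))) = (i == j)%:R * c.
  have := uM i 0 0 j; rewrite eqxx scale1r => <-; rewrite mxtrace_mulC uM mxtraceZ.
  by rewrite eq_sym.
have trE y : \tr (sg y) = \tr (rho y) * c.
  have -> : sg y = sg (\sum_i \sum_j rho y i j *: u (i, j)).
    apply: eqv; rewrite {1}[rho y]matrix_sum_delta linear_sum; apply: eq_bigr => i _.
    by rewrite linear_sum; apply: eq_bigr => j _; rewrite linearZ /= uE.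
  rewrite !linear_sum /mxtrace mulr_suml; apply: eq_bigr => i _.
  rewrite !linear_sum (bigD1 i) //= big1 => [|j ji].
    by rewrite !linearZ /= -/(mxtrace _) tru eqxx mul1r addr0.
  by rewrite !linearZ /= tru eq_sym (negbTE ji) mul0r mulr0.
suff c1 : c = 1 by rewrite trE c1 mulr1.
(* The image of a primitive idempotent has rank one, hence trace one. *)
pose Q := sg (u (0, 0)).
have QQ : Q *m Q = Q by rewrite uM eqxx scale1r.
have QYQ Y : exists la, Q *m Y *m Q = la *: Q.
  have [y <-] := surj' Y; exists (rho y 0 0).
  rewrite !mulmxE -!rmorphM -linearZ; apply: eqv; rewrite !rmorphM linearZ /= uE -!mulmxE.
  apply/matrixP => i j; rewrite -[_ *m delta_mx 0 0]mulmx1 mul_delta_mxE.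
  rewrite -[delta_mx 0 0 *m _]mul1mx mulmxA mul_delta_mxE !mxE -mulnb natrM [0 == j]eq_sym.
  by ring.
have [j [i Qji]] : exists j i, Q j i != 0.
  apply: boolp.contrapT => nQ; have Q0 : Q = 0.
    by apply/matrixP => j i; rewrite [RHS]mxE; apply/eqP/negPn/negP => Qji; apply: nQ; exists j, i.
  have := congr1 rho (ker' _ Q0); rewrite rmorphM rmorph0 /= re mul1r uE => /matrixP/(_ 0 0)/eqP.
  by rewrite !mxE eqxx oner_eq0.
have [la laE] := QYQ (delta_mx i j).
have laQ : la = Q j i.
  apply: (mulIf Qji); move/matrixP: laE => /(_ j i).
  by rewrite mul_delta_mxE mxE => ->.
apply: (mulfI Qji); rewrite mulr1 -{1}laQ -mxtraceZ -laE.
by rewrite -mulmxA mxtrace_mulC -mulmxA QQ mxtrace_mulC mxtrace_delta.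
Qed.

(** Otherwise both idempotents would be equal to their product, and
    [splits_trace] would identify the characters. *)
Lemma splits_orthogonal n (rho : {lrmorphism E -> 'M[L]_n.+1}) m
    (sg : {lrmorphism E -> 'M[L]_m.+1}) e f (chi psi : charT) :
  splits rho e -> splits sg f -> affords rho chi -> affords sg psi -> chi != psi -> e * f = 0.
Proof.
move=> rho_e sg_f rho_chi sg_psi; apply: contra_neq_eq => ef0.
have [ce ee _ e_prim] := splits_primitive rho_e.
have [cf ff _ f_prim] := splits_primitive sg_f.
have cef : central (e * f) by move=> h; rewrite -mulrA cf !mulrA ce.
have efef : (e * f) * (e * f) = e * f.
  by rewrite -mulrA [f * _]mulrA (cf e) !mulrA ee -mulrA ff.
have e_ef : e * (e * f) = e * f by rewrite mulrA ee.
have f_ef : f * (e * f) = e * f by rewrite mulrA (cf e) -mulrA ff.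
have [/eqP|efE] := e_prim _ cef efef e_ef; first by rewrite (negbTE ef0).
have [/eqP|efF] := f_prim _ cef efef f_ef; first by rewrite (negbTE ef0).
have fE : f = e by rewrite -efF.
rewrite fE in sg_f; apply/lfunP => x; rewrite rho_chi sg_psi.
exact: splits_trace rho_e sg_f x.
Qed.

End SplitBlocks.

(** * Schur relations for symmetrizing forms *)

(** A basis and its dual basis with respect to a symmetrizing form. *)
Definition symmetric_basis (A : comNzRingType) (H : falgType A) (tau : {scalar H})
    N (b h : 'I_N -> H) : Prop :=
  [/\ forall x y, tau (x * y) = tau (y * x),
      forall x, x = \sum_i tau (h i * x) *: b i &
      forall x, x = \sum_i tau (x * b i) *: h i].

Section SymmetrizingBasis.
Variables (A : comNzRingType) (H : falgType A).

Definition coordinate (i : 'I_(dim H)) (x : H) : A := v2r x 0 i.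

Fact coordinate_is_scalar i : linear_for *%R (coordinate i).
Proof. by move=> a x y; rewrite /coordinate linearP !mxE. Qed.
HB.instance Definition _ i :=
  GRing.isLinear.Build A H A *%R (coordinate i) (coordinate_is_scalar i).

(** The form represents the coordinate functions by elements [h i]; that [h] also
    expands every element follows from the nondegeneracy of [t]. *)
Lemma symmetrizing_basis (t : {scalar H}) : symmetrizing t ->
  exists h, symmetric_basis t (@scalext_basis A H) h.
Proof.
move=> [tC t_perf].
have /boolp.choice[h hE] i : exists h, forall x, v2r x 0 i = t (h * x).
  by have [h [hE _]] := t_perf (coordinate i); exists h.
have bE x : x = \sum_i t (h i * x) *: scalext_basis i.
  by rewrite {1}(scalext_basisE x); apply: eq_bigr => i _; rewrite hE.
exists h; split=> // x; set y := \sum_i _.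
have nondeg z : t (z * x) = t (z * y).
  rewrite /y mulr_sumr linear_sum {1}(bE z) mulr_suml linear_sum; apply: eq_bigr => i _.
  by rewrite -scalerAl -scalerAr !linearZ /= [t (z * _)]tC [t (_ * x)]tC mulrC.
by rewrite (bE x) [RHS](bE y); apply: eq_bigr => i _; rewrite nondeg.
Qed.

End SymmetrizingBasis.

Section ExtendedForm.
Variables (A B : comNzRingType) (f : {rmorphism A -> B}) (H : falgType A) (t : {scalar H}).

Fact scalext_form_is_scalar : linear_for *%R (scalext_form f t).
Proof.
move=> a u v; rewrite /scalext_form mulr_sumr -big_split; apply: eq_bigr => i _ /=.
by rewrite !mxE mulrDl mulrA.
Qed.
HB.instance Definition _ :=
  GRing.isLinear.Build B (scalext f H) B *%R (scalext_form f t) scalext_form_is_scalar.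

Lemma scalext_form_in x : scalext_form f t (scalext_in f x) = f (t x).
Proof.
rewrite [in RHS](scalext_basisE x) linear_sum rmorph_sum; apply: eq_bigr => i _.
by rewrite linearZ rmorphM !mxE.
Qed.

Lemma scalext_inMr (x y : H) : scalext_in f (x * y) = scalext_in f x * scalext_in f y.
Proof. exact: scalext_inM. Qed.

Fact scalext_in_is_zmod_morphism : zmod_morphism (@scalext_in A B f H).
Proof. by move=> x y; rewrite /scalext_in linearB map_mxB. Qed.
Fact scalext_in_is_monoid_morphism : monoid_morphism (@scalext_in A B f H).
Proof. by split=> // x y; exact: scalext_inM. Qed.
HB.instance Definition _ :=
  GRing.isZmodMorphism.Build H (scalext f H) (@scalext_in A B f H) scalext_in_is_zmod_morphism.
HB.instance Definition _ :=
  GRing.isMonoidMorphism.Build H (scalext f H) (@scalext_in A B f H) scalext_in_is_monoid_morphism.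

Lemma symmetric_basis_ext N (b h : 'I_N -> H) : symmetric_basis t b h ->
  symmetric_basis (scalext_form f t) (fun i => scalext_in f (b i)) (fun i => scalext_in f (h i)).
Proof.
move=> [tC bE hE]; split.
- elim/scalext_ind=> [x|u v IHu IHv|a u IHu] w; last 2 first.
  + by rewrite mulrDl mulrDr !linearD IHu IHv.
  + by rewrite -scalerAl -scalerAr !linearZ /= IHu.
  elim/scalext_ind: w => [y|u v IHu IHv|a u IHu]; last 2 first.
  + by rewrite mulrDl mulrDr !linearD IHu IHv.
  + by rewrite -scalerAl -scalerAr !linearZ /= IHu.
  by rewrite -!scalext_inMr /= !scalext_form_in tC.
- elim/scalext_ind=> [x|u v IHu IHv|a u IHu].
  + rewrite {1}(bE x) scalext_in_sum; apply: eq_bigr => i _.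
    by rewrite scalext_inZ -scalext_inMr /= scalext_form_in.
  + rewrite {1}IHu {1}IHv -big_split; apply: eq_bigr => i _ /=.
    by rewrite mulrDr linearD scalerDl.
  + rewrite {1}IHu scaler_sumr; apply: eq_bigr => i _.
    by rewrite scalerA -scalerAr [X in _ = X *: _]linearZ /=.
- elim/scalext_ind=> [x|u v IHu IHv|a u IHu].
  + rewrite {1}(hE x) scalext_in_sum; apply: eq_bigr => i _.
    by rewrite scalext_inZ -scalext_inMr /= scalext_form_in.
  + rewrite {1}IHu {1}IHv -big_split; apply: eq_bigr => i _ /=.
    by rewrite mulrDl linearD scalerDl.
  + rewrite {1}IHu scaler_sumr; apply: eq_bigr => i _.
    by rewrite scalerA -scalerAl [X in _ = X *: _]linearZ /=.
Qed.

End ExtendedForm.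

(** The averaging operator [casimir] produces endomorphisms of a representation;
    Schur's relations express that it is proportional to the trace. *)
Section Casimir.
Variables (L : fieldType) (E : falgType L) (tau : {scalar E}) (N : nat) (b h : 'I_N -> E).
Hypothesis bh : symmetric_basis tau b h.
Variables (n : nat) (rho : {lrmorphism E -> 'M[L]_n.+1}).

Definition casimir (X : 'M[L]_n.+1) : 'M[L]_n.+1 := \sum_i rho (b i) *m X *m rho (h i).

(** For [X = 1] this is the element [chi^] with [tau (chi^ * x) = chi x]. *)
Definition dual_element (X : 'M[L]_n.+1) : E := \sum_i \tr (rho (b i) *m X) *: h i.

Lemma dual_expand_mulr x j : h j * x = \sum_i tau (h j * x * b i) *: h i.
Proof. by case: bh => _ _ hE; exact: hE. Qed.

(** The invariance of [tau] makes [dual_element] a map of bimodules. *)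
Lemma dual_elementMr X x : dual_element X * x = dual_element (X *m rho x).
Proof.
have [tC bE hE] := bh; rewrite /dual_element mulr_suml.
transitivity (\sum_j \sum_i (\tr (rho (b j) *m X) * tau (h j * x * b i)) *: h i).
  apply: eq_bigr => j _; rewrite -scalerAl [in LHS]dual_expand_mulr scaler_sumr.
  by apply: eq_bigr => i _; rewrite scalerA.
rewrite exchange_big; apply: eq_bigr => i _ /=; rewrite -scaler_suml; congr (_ *: _).
rewrite mulmxA mxtrace_mulC mulmxA mulmxE -rmorphM /= (bE (x * b i)) linear_sum.
rewrite mulr_suml linear_sum; apply: eq_bigr => j _.
by rewrite linearZ /= -scalerAl linearZ /= mulrA mulrC.
Qed.

Lemma dual_elementMl X x : x * dual_element X = dual_element (rho x *m X).
Proof.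
have [tC bE hE] := bh; rewrite /dual_element mulr_sumr.
transitivity (\sum_j \sum_i (\tr (rho (b j) *m X) * tau (x * h j * b i)) *: h i).
  apply: eq_bigr => j _; rewrite -scalerAr [in LHS](hE (x * h j)) scaler_sumr.
  by apply: eq_bigr => i _; rewrite scalerA.
rewrite exchange_big; apply: eq_bigr => i _ /=; rewrite -scaler_suml; congr (_ *: _).
rewrite mulmxA !mulmxE -[rho (b i) * rho x]rmorphM /= (bE (b i * x)) linear_sum.
rewrite mulr_suml linear_sum; apply: eq_bigr => j _.
by rewrite linearZ /= -scalerAl linearZ /= -[x * h j * b i]mulrA tC -[h j * b i * x]mulrA mulrC.
Qed.

Lemma casimir_commutes X x : casimir X *m rho x = rho x *m casimir X.
Proof.
have [tC bE hE] := bh; rewrite /casimir mulmx_suml mulmx_sumr.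
transitivity (\sum_j \sum_i tau (h j * x * b i) *: (rho (b j) *m X *m rho (h i))).
  apply: eq_bigr => j _; rewrite -mulmxA -[rho (h j) *m _]/(rho (h j) * rho x) -rmorphM /=.
  rewrite [in LHS]dual_expand_mulr linear_sum.
  by rewrite mulmx_sumr; apply: eq_bigr => i _; rewrite linearZ /= scalemxAr.
rewrite exchange_big; apply: eq_bigr => i _ /=.
rewrite !mulmxA -[rho x *m _]/(rho x * rho (b i)) -rmorphM /=.
rewrite (bE (x * b i)) linear_sum !mulmx_suml; apply: eq_bigr => j _.
by rewrite linearZ /= -!scalemxAl mulrA.
Qed.

Lemma casimir_swap X : casimir X = \sum_i rho (h i) *m X *m rho (b i).
Proof.
have [tC bE hE] := bh.
transitivity (\sum_j \sum_i tau (h i * h j) *: (rho (b j) *m X *m rho (b i))).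
  apply: eq_bigr => j _; rewrite [in LHS](bE (h j)) linear_sum mulmx_sumr.
  by apply: eq_bigr => i _; rewrite linearZ /= scalemxAr.
rewrite exchange_big; apply: eq_bigr => i _ /=.
rewrite [in RHS](bE (h i)) linear_sum !mulmx_suml; apply: eq_bigr => j _.
by rewrite linearZ /= -!scalemxAl tC.
Qed.

(** Schur's relations.  By [casimir_swap], the entry [(k, l)] at [delta_mx i j] equals
    the entry [(j, i)] at [delta_mx l k]; both vanish off the diagonal, which leaves
    only the multiples of the trace. *)
Lemma casimir_schur : (forall X, is_scalar_mx (casimir X)) ->
  exists s, forall X, casimir X = (s * \tr X)%:M.
Proof.
move=> sc; have scE X : casimir X = (casimir X 0 0)%:M.
  have /is_scalar_mxP[c cE] := sc X; rewrite cE; congr (_%:M).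
  by rewrite mxE eqxx mulr1n.
have deltaE i j k l : casimir (delta_mx i j) k l = \sum_a rho (b a) k i * rho (h a) j l.
  by rewrite summxE; apply: eq_bigr => a _; rewrite mul_delta_mxE.
have swapE i j k l : casimir (delta_mx i j) k l = casimir (delta_mx l k) j i.
  rewrite deltaE casimir_swap summxE; apply: eq_bigr => a _.
  by rewrite mul_delta_mxE mulrC.
exists (casimir (delta_mx 0 0) 0 0) => X.
have dE i j : casimir (delta_mx i j) 0 0 = casimir (delta_mx 0 0) 0 0 * (i == j)%:R.
  by rewrite swapE {1}scE mxE eq_sym mulr_natr.
rewrite scE; congr (_%:M).
transitivity (\sum_i \sum_j X i j * casimir (delta_mx i j) 0 0).
  rewrite {1}/casimir {1}[X]matrix_sum_delta summxE.
  transitivity (\sum_a \sum_i \sum_j X i j * (rho (b a) *m delta_mx i j *m rho (h a)) 0 0).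
    apply: eq_bigr => a _; rewrite mulmx_sumr mulmx_suml summxE; apply: eq_bigr => i _.
    rewrite mulmx_sumr mulmx_suml summxE; apply: eq_bigr => j _.
    by rewrite -scalemxAr -scalemxAl mxE.
  rewrite exchange_big; apply: eq_bigr => i _; rewrite exchange_big; apply: eq_bigr => j _ /=.
  by rewrite summxE mulr_sumr.
rewrite /mxtrace mulr_sumr; apply: eq_bigr => i _.
rewrite (bigD1 i) //= dE eqxx mulr1 big1 ?addr0 => [|j ji]; first by rewrite mulrC.
by rewrite dE eq_sym (negbTE ji) mulr0 mulr0.
Qed.

Lemma casimir_deltaE s : (forall X, casimir X = (s * \tr X)%:M) -> forall i j k l,
  \sum_a rho (b a) k i * rho (h a) j l = s * (i == j)%:R * (k == l)%:R.
Proof.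
move=> cas i j k l; transitivity (casimir (delta_mx i j) k l).
  by rewrite summxE; apply: eq_bigr => a _; rewrite mul_delta_mxE.
rewrite cas mxE -[delta_mx i j]mul1mx mxtrace_delta mxE eq_sym mulr_natr.
by rewrite -mulr_natr.
Qed.

Lemma dual_element_image s : (forall X, casimir X = (s * \tr X)%:M) ->
  forall X, rho (dual_element X) = s *: X.
Proof.
move=> cas X; rewrite linear_sum; apply/matrixP => j l; rewrite summxE mxE.
transitivity (\sum_a \sum_k \sum_i X i k * (rho (b a) k i * rho (h a) j l)).
  apply: eq_bigr => a _; rewrite linearZ /= mxE /mxtrace mulr_suml.
  apply: eq_bigr => k _; rewrite mxE mulr_suml; apply: eq_bigr => i _.
  by rewrite mulrCA mulrA.
rewrite exchange_big (bigD1 l) //= [X in _ + X]big1 ?addr0 => [|k kl].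
  rewrite exchange_big (bigD1 j) //= [X in _ + X]big1 ?addr0 => [|i ij].
    by rewrite -mulr_sumr (casimir_deltaE cas) !eqxx !mulr1 mulrC.
  by rewrite -mulr_sumr (casimir_deltaE cas) (negbTE ij) mulr0 mul0r mulr0.
rewrite exchange_big big1 // => i _.
by rewrite -mulr_sumr (casimir_deltaE cas) (negbTE kl) !mulr0.
Qed.

(** Where the constant [s] of Schur's relations does not vanish, [rho] splits:
    [dual_element] is up to [s] an inverse of [rho]. *)
Lemma casimir_splits s : (forall X, casimir X = (s * \tr X)%:M) -> s != 0 ->
  splits rho (s^-1 *: dual_element 1%:M).
Proof.
move=> cas s0; have im := dual_element_image cas; split.
- move=> x; rewrite -scalerAl dual_elementMr -scalerAr dual_elementMl.
  by rewrite mul1mx mulmx1.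
- by rewrite linearZ /= im scalerA mulVf // scale1r.
- move=> x rx; rewrite -scalerAl dual_elementMr rx mulmx0 /dual_element big1 ?scaler0 // => i _.
  by rewrite mulmx0 mxtrace0 scale0r.
- by move=> X; exists (s^-1 *: dual_element X); rewrite linearZ /= im scalerA mulVf // scale1r.
Qed.

End Casimir.

(** * Split semisimple algebras *)

Section MakeRepresentation.
Variables (L : fieldType) (E : falgType L) (n : nat) (r : E -> 'M[L]_n.+1).

(** A name for [r] that carries the proofs in its type, to attach structures to. *)
Definition multiplicative_map of linear r & monoid_morphism r := r.
Variables (r_lin : linear r) (r_mon : monoid_morphism r).
HB.instance Definition _ :=
  GRing.isLinear.Build L E 'M[L]_n.+1 *:%R (multiplicative_map r_lin r_mon) r_lin.
HB.instance Definition _ :=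
  GRing.isMonoidMorphism.Build E 'M[L]_n.+1 (multiplicative_map r_lin r_mon) r_mon.

Lemma make_representation : exists rho : {lrmorphism E -> 'M[L]_n.+1}, forall x, rho x = r x.
Proof. by exists (multiplicative_map r_lin r_mon). Qed.

End MakeRepresentation.

Section Representations.
Variables (L : fieldType) (E : falgType L).
Local Notation charT := 'Hom(E, L^o).

Lemma exists_character n (rho : {lrmorphism E -> 'M[L]_n.+1}) : exists chi : charT, affords rho chi.
Proof. by exists (linfun ((@mxtrace L n.+1 : 'M[L]_n.+1 -> L^o) \o rho)) => x; rewrite lfunE. Qed.

Lemma regular_representation : exists n (rho : {lrmorphism E -> 'M[L]_n.+1})
    (c : {linear E -> 'rV[L]_n.+1}), bijective c /\ forall x y, c x *m rho y = c (x * y).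
Proof.
have [n dE] : exists n, dim E = n.+1.
  case d0 : (dim E) => [|n]; last by exists n.
  have /eqP[] := oner_neq0 E; apply: (can_inj (@v2rK _ _)); apply/rowP => i.
  by have := ltn_ord i; rewrite {2}d0.
pose c0 (x : E) : 'rV[L]_n.+1 := \row_j v2r x 0 (cast_ord (esym dE) j).
pose c' (u : 'rV[L]_n.+1) : E := r2v (\row_j u 0 (cast_ord dE j)).
have c0_lin : linear c0 by move=> a x y; apply/rowP => j; rewrite !mxE linearP !mxE.
have [c [cK c'K]] : exists c : {linear E -> 'rV[L]_n.+1}, cancel c c' /\ cancel c' c.
  exists (HB.pack_for {linear E -> 'rV[L]_n.+1} c0 (GRing.isLinear.Build _ _ _ _ c0 c0_lin)); split=> [x|u].
    apply: (can_inj (@v2rK _ _)); rewrite r2vK; apply/rowP => j.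
    by rewrite !mxE; congr (v2r x 0 _); apply: val_inj.
  apply/rowP => j; rewrite !mxE r2vK mxE; congr (u 0 _); exact: val_inj.
pose reg x : 'M[L]_n.+1 := \matrix_i c (c' (delta_mx 0 i) * x).
have regE x y : c x *m reg y = c (x * y).
  have xE : x = \sum_i c x 0 i *: c' (delta_mx 0 i).
    apply: (can_inj cK); rewrite linear_sum {1}[c x]row_sum_delta; apply: eq_bigr => i _.
    by rewrite linearZ /= c'K.
  rewrite mulmx_sum_row [in RHS]xE mulr_suml linear_sum; apply: eq_bigr => i _.
  by rewrite rowK -scalerAl linearZ.
have reg_row x i : row i (reg x) = c (c' (delta_mx 0 i) * x) by rewrite rowK.
have reg_lin : linear reg.
  move=> a x y; apply/row_matrixP => i; rewrite linearP /= !reg_row.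
  by rewrite mulrDr -scalerAr linearP.
have reg_mon : monoid_morphism reg.
  split=> [|x y]; apply/row_matrixP => i; first by rewrite reg_row mulr1 c'K rowE mulmx1.
  by rewrite -mulmxE row_mul !reg_row regE mulrA.
have [rho rhoE] := make_representation reg_lin reg_mon.
exists n, rho, c; split=> [|x y]; last by rewrite rhoE regE.
by exists c'.
Qed.

(** The restriction of a representation to a minimal submodule of [U]. *)
Lemma irreducible_subrepresentation n (rho0 : {lrmorphism E -> 'M[L]_n.+1}) U :
  submodule rho0 U -> U != 0 ->
  exists r (rho : {lrmorphism E -> 'M[L]_r.+1}) (B : 'M[L]_(r.+1, n.+1)),
    [/\ irreducible_rep rho, row_free B, (B <= U)%MS & forall x, B *m rho0 x = rho x *m B].
Proof.
move=> subU U0.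
pose P k := boolp.asbool (exists V : 'M[L]_n.+1,
  [/\ submodule rho0 V, V != 0, (V <= U)%MS & \rank V = k]).
have exP : exists k, P k by exists (\rank U); apply/boolp.asboolP; exists U.
case: (ex_minnP exP) => k /boolp.asboolP[V [subV V0 VU rV]] min_k.
have [r rE] : exists r, \rank V = r.+1.
  by case rk : (\rank V) => [|r]; [case/eqP: V0; apply/eqP; rewrite -mxrank_eq0 rk | exists r].
pose B := castmx (rE, erefl n.+1) (row_base V).
have BV : (B :=: V)%MS by apply: eqmx_trans (eqmx_cast _ _) (eq_row_base V).
have B_free : row_free B by rewrite -row_leq_rank BV rE.
have Bstab x : (B *m rho0 x <= B)%MS by rewrite (eqmxMr _ BV) BV; apply: subV.
pose s x := B *m rho0 x *m pinvmx B.
have sB x : s x *m B = B *m rho0 x by apply: mulmxKpV.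
have s_lin : linear s.
  by move=> a x y; rewrite /s linearP mulmxDr mulmxDl -scalemxAr -scalemxAl.
have s_mon : monoid_morphism s.
  split=> [|x y]; first by rewrite /s rmorph1 mulmx1 mulmxVp.
  rewrite -[RHS]/(s x *m s y) {3}/s !mulmxA sB /s rmorphM.
  by rewrite -[rho0 x * rho0 y]/(rho0 x *m rho0 y) !mulmxA.
have [rho rhoE] := make_representation s_lin s_mon.
exists r, rho, B; split=> //; [|by rewrite BV|by move=> x; rewrite rhoE sB].
move=> T subT; have [->|T0] := eqVneq T 0; [by left | right].
pose W := <<T *m B>>%MS.
have rW : \rank W = \rank T by rewrite /W genmxE mxrankMfree.
rewrite -col_leq_rank; suff: (\rank V <= \rank T)%N by rewrite rE.
rewrite rV -rW; apply: min_k; apply/boolp.asboolP; exists W; split=> //.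
- move=> x; rewrite (eqmxMr _ (genmxE _)) genmxE -mulmxA -sB mulmxA -rhoE.
  exact/submxMr/subT.
- by rewrite -mxrank_eq0 rW mxrank_eq0.
- by rewrite genmxE (submx_trans (submxMl _ _)) // BV.
Qed.

End Representations.

Section SemisimpleBlocks.
Variables (L : fieldType) (E : falgType L) (tau : {scalar E}) (N : nat) (b h : 'I_N -> E).
Local Notation charT := 'Hom(E, L^o).
Hypothesis bh : symmetric_basis tau b h.
Hypothesis E_split : split_semisimple E.

Section SchurConstant.
Variables (n : nat) (rho : {lrmorphism E -> 'M[L]_n.+1}).

Fact dual_element_is_linear : linear (dual_element b h rho).
Proof.
move=> a X Y; rewrite /dual_element scaler_sumr -big_split; apply: eq_bigr => i _ /=.
by rewrite mulmxDr -scalemxAr mxtraceD mxtraceZ scalerDl scalerA.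
Qed.
HB.instance Definition _ :=
  GRing.isLinear.Build L 'M[L]_n.+1 E *:%R (dual_element b h rho) dual_element_is_linear.

(** If [s] vanished, the right ideal of the elements [dual_element X] would have
    square zero; having a complement, it would be zero, which is absurd. *)
Lemma schur_constant_neq0 s :
  (forall X, casimir b h rho X = (s * \tr X)%:M) -> s != 0.
Proof.
move=> cas; apply/eqP => s0; have im := dual_element_image cas.
have [m [reg [c [c_bij cE]]]] := regular_representation E; have [c' cK c'K] := c_bij.
pose du := dual_element b h rho.
pose G := lin1_mx (c \o du \o vec_mx).
have GE u : u *m G = c (du (vec_mx u)) by rewrite mul_rV_lin1.
have memG v : reflect (exists X, v = c (du X)) (v <= G)%MS.
  apply: (iffP submxP) => [[w ->]|[X ->]]; first by exists (vec_mx w); rewrite GE.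
  by exists (mxvec X); rewrite GE mxvecK.
pose U := <<G>>%MS.
have subU : submodule reg U.
  move=> x; rewrite (eqmxMr _ (genmxE _)) genmxE; apply/row_subP => i; rewrite row_mul.
  have /memG[X ->] : (row i G <= G)%MS by apply: row_sub.
  by rewrite cE (dual_elementMr bh); apply/memG; exists (X *m rho x).
have [W [subW UW0 fullUW]] := E_split.2 _ _ _ subU.
have /sub_addsmxP[[u w] /= oneE] : (c 1 <= U + W)%MS by apply: submx_full.
have /memG[Y uE] : (u *m U <= G)%MS by rewrite -(genmxE G) submxMl.
have oneYw : 1 = du Y + c' (w *m W).
  by apply: (can_inj cK); rewrite linearD c'K -uE.
have du0 X : du X = 0.
  have wX : c' (w *m W) * du X = 0.
    apply: (can_inj cK); rewrite linear0; apply/eqP; rewrite -submx0 -UW0 sub_capmx.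
    apply/andP; split.
      have -> : c' (w *m W) * du X = du X - du Y * du X.
        by apply/eqP; rewrite eq_sym subr_eq addrC -mulrDl -oneYw mul1r.
      rewrite genmxE; apply/memG; rewrite (dual_elementMr bh) -linearB.
      by exists (X - Y *m rho (du X)).
    by rewrite -cE c'K; apply: submx_trans (subW _); apply/submxMr/submxMl.
  rewrite -[du X]mul1r oneYw mulrDl wX addr0 /du (dual_elementMr bh) im s0 scale0r mulmx0.
  exact: linear0.
have : \tr (rho 1 *m (delta_mx 0 0 : 'M[L]_n.+1)) = 0.
  have [_ bE _] := bh; rewrite {1}(bE 1) linear_sum mulmx_suml linear_sum /=.
  transitivity (tau (du (delta_mx 0 0))); last by rewrite du0 linear0.
  rewrite [RHS]linear_sum; apply: eq_bigr => i _.
  by rewrite mulr1 !linearZ /= -scalemxAl linearZ /= mulrC.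
rewrite rmorph1 mxtrace_delta mxE eqxx => /eqP.
by rewrite oner_eq0.
Qed.

Lemma irreducible_casimir : irreducible_rep rho ->
  exists2 s, s != 0 & forall X, casimir b h rho X = (s * \tr X)%:M.
Proof.
move=> irr; have [|s cas] := casimir_schur bh (rho := rho).
  by move=> X; apply: E_split.1 irr _ _ => x; apply: (casimir_commutes bh).
by exists s => //; apply: schur_constant_neq0.
Qed.

End SchurConstant.

(** Found inside the submodule of the regular representation generated by [g]. *)
Lemma central_idempotent_representation g : central g -> g * g = g -> g != 0 ->
  exists n (rho : {lrmorphism E -> 'M[L]_n.+1}), irreducible_rep rho /\ rho g = 1.
Proof.
move=> cg gg g0; have [m [reg [c [c_bij cE]]]] := regular_representation E.
have [||r [rho [B [irr B_free BU Brho]]]] := @irreducible_subrepresentation _ _ _ reg (reg g).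
- move=> x; rewrite -[reg g *m reg x]/(reg g * reg x) -rmorphM cg rmorphM.
  exact: submxMl.
- apply: contra_neq g0 => rg0; apply: (bij_inj c_bij).
  by rewrite linear0 -[g]mul1r -cE rg0 mulmx0.
exists r, rho; split=> //.
have [D BE] := submxP BU.
have Bg : B *m reg g = B.
  by rewrite {1}BE -mulmxA -[reg g *m reg g]/(reg g * reg g) -rmorphM gg -BE.
by move: (Brho g); rewrite Bg -{1}[B]mul1mx => /(row_free_inj B_free) <-.
Qed.

(** Splitting off the block of an irreducible representation on which the central
    idempotent [g] acts as the identity lowers the rank of [g].  So [1] is a finite
    sum of such idempotents, and a character outside the resulting list would have
    its idempotent orthogonal to [1]. *)
Theorem split_semisimple_idempotents :
  exists (S : {fset charT}) (e : charT -> E),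
  [/\ forall chi, chi \in S <-> is_irr chi,
      forall chi, is_irr chi -> block_idempotent chi (e chi) &
      \sum_(chi <- S) e chi = 1].
Proof.
have block n (rho : {lrmorphism E -> 'M[L]_n.+1}) : irreducible_rep rho -> exists e, splits rho e.
  move=> /irreducible_casimir[s s0 cas]; exists (s^-1 *: dual_element b h rho 1%:M).
  exact: (casimir_splits bh cas s0).
have /boolp.choice[e eP] (chi : charT) : exists e, is_irr chi ->
    block_idempotent chi e.
  have [[n [rho [irr aff]]]|nirr] := boolp.pselect (is_irr chi); last by exists 0.
  by have [e rho_e] := block _ _ irr; exists e => _; exists n, rho.
have eE chi n (rho : {lrmorphism E -> 'M[L]_n.+1}) :
    irreducible_rep rho -> affords rho chi -> splits rho (e chi).
  move=> irr aff; have [f rho_f] := block _ _ irr.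
  have [|m [sg [sg_e sg_chi]]] := eP chi; first by exists n, rho.
  by rewrite -(attached_unique sg_e sg_chi (splits_attached rho_f aff)).
have orth chi psi : is_irr chi -> is_irr psi -> chi != psi -> e chi * e psi = 0.
  move=> /eP[n [rho [rho_e rho_chi]]] /eP[m [sg [sg_e sg_psi]]].
  exact: splits_orthogonal rho_e sg_e rho_chi sg_psi.
have [m [reg [c [c_bij cE]]]] := regular_representation E.
suff decompose k g : central g -> g * g = g -> (\rank (reg g) <= k)%N ->
    exists s : seq charT, [/\ uniq s, forall chi, chi \in s -> is_irr chi,
      forall chi, chi \in s -> g * e chi = e chi & g = \sum_(chi <- s) e chi].
  have [|||s [s_uniq s_irr _ one_s]] := decompose m.+1 1.
  - by move=> x; rewrite mul1r mulr1.
  - by rewrite mulr1.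
  - exact: rank_leq_row.
  exists [fset chi | chi in s]%fset, e; split=> //; last first.
    by rewrite one_s; apply: perm_big; apply: uniq_perm => // x; rewrite !inE.
  move=> chi; rewrite !inE; split=> [/s_irr//|chi_irr]; apply/negPn/negP => chi_s.
  have [n [rho [rho_e _]]] := eP _ chi_irr; have /eqP[] := splits_neq0 rho_e.
  rewrite -[e chi]mul1r one_s mulr_suml big_seq big1 // => psi psi_s.
  apply: orth => //; first exact: s_irr.
  by apply: contraNneq chi_s => <-.
elim: k g => [|k IHk] g cg gg rg.
  exists [::]; split=> //; rewrite big_nil; apply: (bij_inj c_bij).
  rewrite linear0 -[g]mul1r -cE; move: rg; rewrite leqn0 mxrank_eq0 => /eqP->.
  by rewrite mulmx0.
have [->|g0] := eqVneq g 0; first by exists [::]; split=> //; rewrite big_nil.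
have [n [rho [irr rho_g]]] := central_idempotent_representation cg gg g0.
have [chi rho_chi] := exists_character rho; have rho_e := eE _ _ _ irr rho_chi.
have [ce re _ _] := rho_e; have ee := splits_idem rho_e.
have eg : e chi * g = e chi.
  by rewrite -[RHS]mulr1; apply: (splits_eq rho_e); rewrite rho_g rmorph1.
have ge : g * e chi = e chi by rewrite cg eg.
have cg' : central (g - e chi) by move=> x; rewrite mulrBl mulrBr cg ce.
have gg' : (g - e chi) * (g - e chi) = g - e chi.
  by rewrite mulrBl !mulrBr gg ge eg ee subrr subr0.
have e'e : (g - e chi) * e chi = 0 by rewrite mulrBl ge ee subrr.
have [|s [s_uniq s_irr gs gE]] := IHk (g - e chi) cg' gg'.
  have regM x y : reg x *m reg y = reg (x * y) by rewrite rmorphM.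
  have le_reg : (reg (g - e chi) <= reg g)%MS.
    suff -> : reg (g - e chi) = reg (g - e chi) *m reg g by apply: submxMl.
    by rewrite regM mulrBl gg eg.
  rewrite -ltnS; apply: leq_trans rg; rewrite (ltn_leqif (mxrank_leqif_sup le_reg)).
  apply: contra (splits_neq0 rho_e) => le_reg'.
  have /submxP[D eD] : (reg (e chi) <= reg (g - e chi))%MS.
    by apply: submx_trans le_reg'; rewrite -eg -regM submxMl.
  apply/eqP; apply: (bij_inj c_bij).
  by rewrite linear0 -[e chi]mul1r -cE -ee -regM {1}eD -mulmxA regM e'e linear0 !mulmx0.
have chi_irr : is_irr chi by exists n, rho.
exists (chi :: s); split=> /=.
- rewrite s_uniq andbT; apply/negP => /gs; rewrite e'e => /esym/eqP.
  by apply/negP; exact: splits_neq0 rho_e.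
- by move=> psi; rewrite inE => /orP[/eqP->|/s_irr].
- move=> psi; rewrite inE => /orP[/eqP->//|/gs <-].
  by rewrite mulrA mulrBr gg ge.
- by rewrite big_cons -gE addrC subrK.
Qed.

End SemisimpleBlocks.

(** * Integrality of characters *)

Section IntegralCharacters.
Variables (A : idomainType) (H : falgType A).
Hypothesis A_closed : completely_closed (1 : A).
Variables (n : nat) (rho : {lrmorphism fracalg H -> 'M[{fraction A}]_n.+1}).
Local Notation io := (map_poly (@tofrac A)).
Local Notation inj := (@scalext_in A {fraction A} (@tofrac A) H).

Lemma representation_denominator : exists2 c : A, c != 0 &
  forall h i j, exists a, c%:F * rho (inj h) i j = a%:F.
Proof.
have [c c0 [a aE]] := common_denominator
  (fun kij : 'I_(dim H) * ('I_n.+1 * 'I_n.+1) => rho (inj (scalext_basis kij.1)) kij.2.1 kij.2.2).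
exists c => // h i j; exists (\sum_k v2r h 0 k * a (k, (i, j))).
rewrite [in LHS](scalext_basisE h) scalext_in_sum linear_sum summxE mulr_sumr rmorph_sum.
apply: eq_bigr => k _; rewrite scalext_inZ linearZ /= mxE mulrCA.
by have /= -> := aE (k, (i, j)); rewrite tofracM.
Qed.

Lemma poly_lift (Y : {poly {fraction A}}) : (forall l, exists a : A, Y`_l = a%:F) ->
  exists p, io p = Y.
Proof.
move=> /boolp.choice[a aE]; exists (\poly_(l < size Y) a l); apply/polyP => l.
rewrite coef_map coef_poly; case: ltnP => [_|le]; first by rewrite aE.
by rewrite nth_default ?rmorph0.
Qed.

(** The powers of the characteristic matrix of [rho h] have a common
    denominator, because they are the images of the powers of ['X - h]. *)
Lemma char_poly_mx_denominator (h : H) : exists2 c : A, c != 0 & forall k,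
  exists Z : 'M[{poly A}]_n.+1, map_mx io Z = (c%:F)%:P *: (char_poly_mx (rho (inj h)) ^+ k).
Proof.
have [c c0 cP] := representation_denominator; exists c => // k.
have [phi [phi_bij phiX phiC phiE]] := mx_poly_ring_isom {fraction A} n.
have lift i j : exists p, io p = (c%:F)%:P * (char_poly_mx (rho (inj h)) ^+ k) i j.
  apply: poly_lift => l; rewrite coefCM -phiE rmorphXn /char_poly_mx rmorphB phiX phiC map_polyX /=.
  have -> : 'X - (rho (inj h))%:P = map_poly (rho \o inj) ('X - h%:P).
    by rewrite rmorphB /= map_polyX map_polyC.
  by rewrite -rmorphXn coef_map /=; apply: cP.
have /boolp.choice[p pE] (ij : 'I_n.+1 * 'I_n.+1) := lift ij.1 ij.2.
exists (\matrix_(i, j) p (i, j)); apply/matrixP => i j.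
by rewrite !mxE pE.
Qed.

(** All the powers of the characteristic polynomial have a common denominator, so
    its coefficients lie in [A] by complete integral closedness. *)
Lemma char_poly_integral (h : H) : exists G : {poly A}, io G = char_poly (rho (inj h)).
Proof.
have [c c0 powP] := char_poly_mx_denominator h.
set P := char_poly _.
have [mu mu0 [g' g'E]] := common_denominator (fun i : 'I_(size P) => P`_i).
have [g gE] : exists g, io g = mu%:F *: P.
  apply: poly_lift => l; rewrite coefZ; have [lP|Pl] := ltnP l (size P).
    by exists (g' (Ordinal lP)); rewrite -g'E.
  by exists 0; rewrite nth_default // mulr0 rmorph0.
have io_inj : injective io by apply/map_inj_poly/rmorph0 => y z /eqP; rewrite tofrac_eq => /eqP.
have detX (Y : 'M[{poly {fraction A}}]_n.+1) k : \det (Y ^+ k) = \det Y ^+ k.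
  elim: k => [|k IHk]; first exact: det1.
  by rewrite !exprS -[Y * _]/(Y *m (Y ^+ k)) det_mulmx IHk.
have [|k|j [q qE]] := completely_closed_const A_closed (mu := mu) (c := (c ^+ n.+1)%:P) (g := g) mu0.
- by rewrite polyC_eq0 expf_neq0.
- have [Z ZE] := powP k; exists 0%N, (\det Z).
  rewrite scale1r; apply: io_inj; rewrite map_polyZ rmorphM rmorphXn /= gE map_polyC /=.
  have -> : io (\det Z) = (c%:F)%:P ^+ n.+1 * P ^+ k by rewrite -det_map_mx ZE detZ detX.
  by rewrite exprZn !tofracXn -!mul_polyC !polyC_exp; ring.
exists q; apply: (scalerI (_ : mu%:F != 0)); first by rewrite tofrac_eq0.
by rewrite -gE -map_polyZ -qE expr1n scale1r.
Qed.

Lemma character_integral (h : H) : exists a : A, \tr (rho (inj h)) = a%:F.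
Proof.
have [G GE] := char_poly_integral h.
have := char_poly_trace (rho (inj h)) (ltn0Sn n); rewrite -GE coef_map => /esym trE.
by exists (- G`_n); rewrite rmorphN /= -trE opprK.
Qed.

End IntegralCharacters.

(** * Reduction of representations along a place *)

Section PlaceRing.
Variables (L K : fieldType) (V : L -> Prop) (res : L -> K).
Hypothesis V_place : place V res.

Definition place_pred : pred L := fun x => boolp.asbool (V x).

Lemma place_predP x : reflect (V x) (place_pred x). Proof. exact: boolp.asboolP. Qed.

Fact place_subring : subring_closed place_pred.
Proof.
have [[V1 _] VB VM _] := V_place.
split=> [|x y /place_predP Vx /place_predP Vy|x y /place_predP Vx /place_predP Vy].
- exact/place_predP.
- by apply/place_predP; case: (VB _ _ Vx Vy).
- by apply/place_predP; case: (VM _ _ Vx Vy).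
Qed.

End PlaceRing.

(** The valuation ring of a place as a type, so that matrices over it can be mapped
    to the residue field. *)
Record place_ring (L K : fieldType) (V : L -> Prop) (res : L -> K) (V_place : place V res) : predArgType :=
  PlaceRing { place_val : L; place_valP : place_pred V place_val }.

Section PlaceRingTheory.
Variables (L K : fieldType) (V : L -> Prop) (res : L -> K) (V_place : place V res).
Local Notation W := (place_ring V_place).

HB.instance Definition _ := [isSub for @place_val L K V res V_place].
HB.instance Definition _ := [Choice of W by <:].
HB.instance Definition _ :=
  GRing.SubChoice_isSubComNzRing.Build L (place_pred V) W (place_subring V_place).

Definition residue (x : W) : K := res (val x).

Lemma place_ringV (x : W) : V (val x).
Proof. exact/place_predP/valP. Qed.

Fact residue_is_zmod_morphism : zmod_morphism residue.
Proof.
move=> x y; rewrite /residue rmorphB /=; have [_ VB _ _] := V_place.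
by case: (VB _ _ (place_ringV x) (place_ringV y)).
Qed.
Fact residue_is_monoid_morphism : monoid_morphism residue.
Proof.
have [[_ r1] _ VM _] := V_place; split=> [|x y]; first by rewrite /residue rmorph1.
rewrite /residue rmorphM /=.
by case: (VM _ _ (place_ringV x) (place_ringV y)).
Qed.
HB.instance Definition _ := GRing.isZmodMorphism.Build W K residue residue_is_zmod_morphism.
HB.instance Definition _ := GRing.isMonoidMorphism.Build W K residue residue_is_monoid_morphism.

Lemma place_lift x : V x -> exists w : W, val w = x.
Proof. by move=> /place_predP Vx; exists (PlaceRing V_place Vx). Qed.

Lemma place_total x y : y != 0 -> V (x / y) \/ V (y / x).
Proof.
have [_ _ _ VV] := V_place; move=> y0; have [|[]] := VV (x / y); first by left.
by rewrite invf_div; right.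
Qed.

(** Divisibility is total in a valuation ring, so one of the finitely many maximal
    minors divides all the others. *)
Lemma minimal_minor m n (B : 'M[L]_(m, n)) : row_full B ->
  exists2 f : {ffun 'I_n -> 'I_m}, \det (rowsub f B) != 0 &
    forall g : {ffun 'I_n -> 'I_m}, V (\det (rowsub g B) / \det (rowsub f B)).
Proof.
have [[V1 _] VB VM _] := V_place; have V0 : V 0 by rewrite -(subrr 1); case: (VB _ _ V1 V1).
move=> fullB; have [f0 f0_det] : exists f : {ffun 'I_n -> 'I_m}, \det (rowsub f B) != 0.
  by exists (fullrankfun fullB); rewrite -unitfE -unitmxE fullrowsub_unit.
suff [f f_det fP] : exists2 f : {ffun 'I_n -> 'I_m}, \det (rowsub f B) != 0 &
    forall g, g \in enum {ffun 'I_n -> 'I_m} -> V (\det (rowsub g B) / \det (rowsub f B)).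
  by exists f => // g; apply: fP; rewrite mem_enum.
elim: (enum _) => [|g s [f f_det fP]]; first by exists f0.
have [Vgf|Vfg] := place_total (\det (rowsub g B)) f_det.
  by exists f => // h; rewrite inE => /orP[/eqP->|/fP].
have [g0|g_det] := eqVneq (\det (rowsub g B)) 0.
  by exists f => // h; rewrite inE => /orP[/eqP->|/fP//]; rewrite g0 mul0r.
exists g => // h; rewrite inE => /orP[/eqP->|/fP Vh]; first by rewrite divff.
by case: (VM _ _ Vh Vfg); rewrite mulrA divfK.
Qed.

(** Cramer's rule. *)
Lemma minor_coordinates m n (B : 'M[L]_(m, n)) (f : {ffun 'I_n -> 'I_m}) :
  \det (rowsub f B) != 0 -> (forall g : {ffun 'I_n -> 'I_m}, V (\det (rowsub g B) / \det (rowsub f B))) ->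
  forall i j, V ((B *m invmx (rowsub f B)) i j).
Proof.
move=> f_det fP i j; set C := rowsub f B in f_det fP *.
have C_unit : C \in unitmx by rewrite unitmxE unitfE.
pose g := finfun (fun l => if l == j then i else f l).
suff -> : (B *m invmx C) i j = \det (rowsub g B) / \det C by apply: fP.
rewrite /invmx C_unit -scalemxAr mxE mulrC; congr (_ / _).
rewrite (expand_det_row _ j) mxE; apply: eq_bigr => l _; rewrite !mxE ffunE eqxx; congr (_ * _).
rewrite /cofactor; congr (_ * \det _); apply/matrixP => a b; rewrite !mxE ffunE.
by rewrite eq_sym (negbTE (neq_lift j a)).
Qed.

End PlaceRingTheory.

Section SemilinearRepresentations.
Variables (A : comNzRingType) (H : falgType A).

(** A representation over [K] of the extension of [H] along [g], restricted to [H].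
    In this form the scalars may be changed along [g] without changing [H]. *)
Definition semirep (K : fieldType) (g : A -> K) n (r : H -> 'M[K]_n.+1) : Prop :=
  [/\ forall x y, r (x + y) = r x + r y, forall a x, r (a *: x) = g a *: r x,
      r 1 = 1%:M & forall x y, r (x * y) = r x *m r y].

End SemilinearRepresentations.

Lemma semirep_ext (A B : comNzRingType) (f : {rmorphism A -> B}) (H : falgType A)
    (K : fieldType) (g : {rmorphism B -> K}) n (r : H -> 'M[K]_n.+1) :
  semirep (g \o f) r -> exists r1 : scalext f H -> 'M[K]_n.+1,
    semirep g r1 /\ forall x, r1 (scalext_in f x) = r x.
Proof.
move=> [rD rZ r1 rM].
have r_sum I (s : seq I) (F : I -> H) : r (\sum_(i <- s) F i) = \sum_(i <- s) r (F i).
  apply: (big_morph r rD).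
  by rewrite -(scale0r (0 : H)) rZ /= !rmorph0 scale0r.
pose q (u : scalext f H) := \sum_i g ((u : 'rV_(dim H)) 0 i) *: r (scalext_basis i).
have q_in x : q (scalext_in f x) = r x.
  rewrite {2}(scalext_basisE x) r_sum; apply: eq_bigr => i _.
  by rewrite rZ mxE.
have qD u v : q (u + v) = q u + q v.
  by rewrite -big_split; apply: eq_bigr => i _; rewrite mxE rmorphD scalerDl.
have qZ a u : q (a *: u) = g a *: q u.
  by rewrite scaler_sumr; apply: eq_bigr => i _; rewrite mxE rmorphM scalerA.
exists q; split=> //; split=> //; first by rewrite -[1]/(scalext_in f 1) q_in r1.
elim/scalext_ind=> [x|u v IHu IHv|a u IHu] w; last 2 first.
- by rewrite mulrDl !qD IHu IHv mulmxDl.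
- by rewrite -scalerAl !qZ IHu scalemxAl.
elim/scalext_ind: w => [y|u v IHu IHv|a u IHu]; last 2 first.
- by rewrite mulrDr !qD IHu IHv mulmxDr.
- by rewrite -scalerAr !qZ IHu scalemxAr.
by rewrite -scalext_inMr !q_in rM.
Qed.

Lemma semirep_fraction (A : idomainType) (H : falgType A) n (r : H -> 'M[{fraction A}]_n.+1) :
  semirep (@tofrac A) r ->
  exists rho : {lrmorphism fracalg H -> 'M[{fraction A}]_n.+1}, forall x, rho (scalext_in (@tofrac A) x) = r x.
Proof.
move=> r_rep; have [q [[qD qZ q1 qM] qE]] := semirep_ext (f := @tofrac A) (g := idfun) r_rep.
have q_lin : linear q by move=> a x y; rewrite qD qZ.
have q_mon : monoid_morphism q by split.
by have [rho rhoE] := make_representation q_lin q_mon; exists rho => x; rewrite rhoE qE.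
Qed.

Lemma semirep_restrict (A : idomainType) (H : falgType A) n
    (rho : {lrmorphism fracalg H -> 'M[{fraction A}]_n.+1}) :
  semirep (@tofrac A) (fun x => rho (scalext_in (@tofrac A) x)).
Proof.
split=> [x y|a x||x y].
- by rewrite scalext_inD linearD.
- by rewrite scalext_inZ linearZ.
- exact: rmorph1.
- by rewrite scalext_inMr rmorphM.
Qed.

Lemma char_poly_conjugate (K : fieldType) n (C X : 'M[K]_n) : C \in unitmx ->
  char_poly (C *m X *m invmx C) = char_poly X.
Proof.
move=> C_unit; pose io (Y : 'M[K]_n) := map_mx (@polyC K) Y.
have CV : io C *m io (invmx C) = 1%:M by rewrite /io -map_mxM mulmxV // map_mx1.
rewrite /char_poly.
have -> : char_poly_mx (C *m X *m invmx C) = io C *m char_poly_mx X *m io (invmx C).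
  rewrite /char_poly_mx mulmxBr mulmxBl scalar_mxC -['X%:M *m _ *m _]mulmxA CV mulmx1.
  by rewrite /io !map_mxM.
by rewrite !det_mulmx mulrAC -det_mulmx CV det1 mul1r.
Qed.

Section Reduction.
Variables (A B : idomainType) (f : {rmorphism A -> B}) (H : falgType A).
Variables (V : {fraction A} -> Prop) (res : {fraction A} -> {fraction B}).
Hypothesis fV : extends_to_place f V res.
Local Notation K := {fraction B}.
Local Notation inj := (@scalext_in A {fraction A} (@tofrac A) H).
Variables (n : nat) (rho : {lrmorphism fracalg H -> 'M[{fraction A}]_n.+1}).
Hypothesis rho_irr : irreducible_rep rho.

(** The orbit of a vector under [H] generates a lattice; the vectors of a minimal
    maximal minor form a basis of it over the valuation ring. *)
Lemma integral_conjugate : exists2 C : 'M[{fraction A}]_n.+1, C \in unitmx &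
  forall h i j, V ((C *m rho (inj h) *m invmx C) i j).
Proof.
have [V_place VA] := fV; have [[V1 _] VB VM _] := V_place.
have V0 : V 0 by rewrite -(subrr 1); case: (VB _ _ V1 V1).
have VD x y : V x -> V y -> V (x + y).
  move=> Vx Vy; rewrite -[y]opprK -[- y]sub0r.
  by case: (VB _ _ V0 Vy) => VNy _; case: (VB _ _ Vx VNy).
pose Bm : 'M[{fraction A}]_(dim H, n.+1) := \matrix_i row 0 (rho (inj (scalext_basis i))).
have rowB x : row 0 (rho (inj x)) = (map_mx (@tofrac A) (v2r x)) *m Bm.
  rewrite mulmx_sum_row {1}(scalext_basisE x) scalext_in_sum linear_sum linear_sum.
  by apply: eq_bigr => i _; rewrite scalext_inZ linearZ linearZ rowK mxE.
have stabB x : Bm *m rho (inj x) =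
    (\matrix_i map_mx (@tofrac A) (v2r (scalext_basis i * x))) *m Bm.
  by apply/row_matrixP => i; rewrite !row_mul !rowK -rowB -row_mul scalext_inMr rmorphM.
have Bfull : row_full Bm.
  have [|B0|] := rho_irr (U := <<Bm>>%MS).
  - elim/scalext_ind=> [x|u v IHu IHv|a u IHu].
    + by rewrite (eqmxMr _ (genmxE _)) genmxE stabB submxMl.
    + by rewrite linearD mulmxDr addmx_sub.
    + by rewrite linearZ -scalemxAr scalemx_sub.
  - have : (row 0 (1%:M : 'M[{fraction A}]_n.+1) <= <<Bm>>)%MS.
      by rewrite genmxE -[1%:M](rmorph1 rho) -(rmorph1 inj) rowB submxMl.
    rewrite B0 submx0 => /eqP/matrixP/(_ 0 0)/eqP.
    by rewrite !mxE eqxx oner_eq0.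
  - by rewrite /row_full genmxE.
have [g g_det gP] := minimal_minor V_place Bfull.
have C_unit : rowsub g Bm \in unitmx by rewrite unitmxE unitfE.
exists (rowsub g Bm) => // x i j.
have -> : rowsub g Bm *m rho (inj x) *m invmx (rowsub g Bm) =
    rowsub g (\matrix_i map_mx (@tofrac A) (v2r (scalext_basis i * x))) *m (Bm *m invmx (rowsub g Bm)).
  by rewrite mulmxA !mul_rowsub_mx stabB.
rewrite mxE; elim/big_ind: _ => // k _.
set a := rowsub _ _ _ _.
have -> : a = (v2r (scalext_basis (g i) * x) 0 k)%:F by rewrite /a !mxE.
have Va : V ((v2r (scalext_basis (g i) * x) 0 k)%:F) by case: (VA (v2r (scalext_basis (g i) * x) 0 k)).
have Vk := minor_coordinates g_det gP k j.
by case: (VM _ _ Va Vk).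
Qed.

(** Conjugated by [integral_conjugate], the representation has entries in the
    valuation ring; its residue keeps all that is expressed by polynomial
    identities in these entries. *)
Lemma reduction : exists r : H -> 'M[K]_n.+1,
  [/\ semirep (@tofrac B \o f) r,
      forall h a, \tr (rho (inj h)) = a%:F -> \tr (r h) = (f a)%:F,
      forall h G, map_poly (@tofrac A) G = char_poly (rho (inj h)) ->
        map_poly (@tofrac B) (map_poly f G) = char_poly (r h) &
      forall N (b b' : 'I_N -> H) s,
        (forall X, casimir (inj \o b) (inj \o b') rho X = (s%:F * \tr X)%:M) ->
        forall X, \sum_i r (b i) *m X *m r (b' i) = ((f s)%:F * \tr X)%:M].
Proof.
have [V_place VA] := fV; have [C C_unit CV] := integral_conjugate.
pose W := place_ring V_place; pose io (Y : 'M[W]_n.+1) := map_mx (val : W -> {fraction A}) Y.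
have io_inj : injective io.
  by move=> X Y /matrixP XY; apply/matrixP => i j; apply: val_inj; move: (XY i j); rewrite !mxE.
have /boolp.choice[Z ZE] h : exists Z : 'M[W]_n.+1, io Z = C *m rho (inj h) *m invmx C.
  have /boolp.choice[z zE] (ij : 'I_n.+1 * 'I_n.+1) :
    exists w : W, val w = (C *m rho (inj h) *m invmx C) ij.1 ij.2 by apply/place_lift/CV.
  by exists (\matrix_(i, j) z (i, j)); apply/matrixP => i j; rewrite [LHS]mxE [in LHS]mxE zE.
have [rD rZ r1 rM] := semirep_restrict rho.
have lift_A a : exists2 w : W, val w = a%:F & residue w = (f a)%:F.
  by have [Va ra] := VA a; have [w wE] := place_lift V_place Va; exists w; rewrite // /residue wE.
pose rsd : {rmorphism W -> K} := @residue _ _ _ _ V_place.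
exists (fun h : H => map_mx rsd (Z h)); split.
- split=> [x y|a x||x y].
  + rewrite -map_mxD; congr map_mx; apply: io_inj; rewrite /io map_mxD -!/(io _) !ZE.
    by rewrite rD mulmxDr mulmxDl.
  + have [w wE /= <-] := lift_A a; rewrite -map_mxZ; congr map_mx.
    apply: io_inj; rewrite /io map_mxZ -!/(io _) !ZE rZ -scalemxAr -scalemxAl.
    by rewrite -wE.
  + rewrite -(map_mx1 rsd); congr map_mx; apply: io_inj; rewrite /io map_mx1 -/(io _) ZE r1.
    by rewrite mulmx1 mulmxV.
  + rewrite -map_mxM; congr map_mx; apply: io_inj; rewrite /io map_mxM -!/(io _) !ZE rM.
    by rewrite !mulmxA mulmxKV.
- move=> h a tr_h; have [w wE <-] := lift_A a; rewrite trace_map_mx; congr residue.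
  apply: val_inj; rewrite wE -tr_h -(trace_map_mx val) -/(io _) ZE mxtrace_mulC mulmxA mulVmx // mul1mx.
  by [].
- move=> h G GE; rewrite -map_char_poly; apply/polyP => k.
  rewrite !coef_map /=; have [w wE <-] := lift_A G`_k; congr residue; apply: val_inj.
  rewrite wE; move: (congr1 (fun p : {poly _} => p`_k) GE); rewrite coef_map /= => ->.
  by rewrite -(char_poly_conjugate _ C_unit) -ZE -map_char_poly coef_map.
move=> N b b' s cas X; have [w wE <-] := lift_A s.
have casZ Y : \sum_i Z (b i) *m Y *m Z (b' i) = (w * \tr Y)%:M.
  have io_sum : io (\sum_i Z (b i) *m Y *m Z (b' i)) = \sum_i io (Z (b i) *m Y *m Z (b' i)).
    by rewrite /io map_mx_sum.
  have io_tr : \tr (io Y) = val (\tr Y) by rewrite /io trace_map_mx.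
  apply: io_inj; rewrite io_sum {2}/io map_scalar_mx rmorphM /= wE -io_tr.
  transitivity (C *m casimir (inj \o b) (inj \o b') rho (invmx C *m io Y *m C) *m invmx C).
    rewrite mulmx_sumr mulmx_suml; apply: eq_bigr => i _.
    by rewrite /io !map_mxM -!/(io _) !ZE /= !mulmxA.
  by rewrite cas scalar_mxC mulmxK // mxtrace_mulC mulmxA mulmxV // mul1mx.
pose T (X : 'M[K]_n.+1) := \sum_i map_mx rsd (Z (b i)) *m X *m map_mx rsd (Z (b' i)).
have T_delta (i j : 'I_n.+1) : T (delta_mx i j) = (rsd w * \tr (delta_mx i j : 'M[K]_n.+1))%:M.
  rewrite -(map_delta_mx rsd) trace_map_mx -rmorphM -map_scalar_mx -casZ map_mx_sum.
  by apply: eq_bigr => k _; rewrite !map_mxM.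
have TD (I : Type) (s0 : seq I) (F : I -> 'M[K]_n.+1) : T (\sum_(i <- s0) F i) = \sum_(i <- s0) T (F i).
  rewrite exchange_big; apply: eq_bigr => k _ /=.
  by rewrite mulmx_sumr mulmx_suml.
have TZ (a : K) (Y : 'M[K]_n.+1) : T (a *: Y) = a *: T Y.
  by rewrite scaler_sumr; apply: eq_bigr => k _; rewrite -scalemxAr -scalemxAl.
rewrite -[LHS]/(T X) {1}[X]matrix_sum_delta TD.
transitivity (\sum_(i < n.+1) \sum_(j < n.+1) (rsd w * (X i j * \tr (delta_mx i j : 'M[K]_n.+1)))%:M : 'M[K]_n.+1).
  apply: eq_bigr => i _; rewrite TD; apply: eq_bigr => j _.
  by rewrite TZ T_delta scale_scalar_mx mulrCA.
rewrite {2}[X]matrix_sum_delta linear_sum mulr_sumr raddf_sum.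
apply: eq_bigr => i _; rewrite linear_sum mulr_sumr raddf_sum; apply: eq_bigr => j _.
by rewrite linearZ.
Qed.

End Reduction.

(** * Schur elements and specialization *)

Lemma char_poly_scalar (K : fieldType) n (c : K) :
  char_poly (c%:M : 'M_n) = ('X - c%:P) ^+ n.
Proof. by rewrite /char_poly /char_poly_mx map_scalar_mx -raddfB det_scalar. Qed.

Section PolynomialInAlgebra.
Variables (A : idomainType) (H : falgType A).
Local Notation inj := (@scalext_in A {fraction A} (@tofrac A) H).

Lemma representation_horner n (rho : {lrmorphism fracalg H -> 'M[{fraction A}]_n.+1}) (h : H) G :
  rho (inj (horner_alg h G)) = horner_mx (rho (inj h)) (map_poly (@tofrac A) G).
Proof.
elim/poly_ind: G => [|G c IHG]; first by rewrite !rmorph0.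
rewrite !rmorphD !rmorphM /= IHG !horner_algX !horner_algC map_polyX map_polyC /=.
rewrite horner_mx_X horner_mx_C scalext_inZ linearZ /= !rmorph1.
by rewrite -mul_mx_scalar mul1mx.
Qed.

End PolynomialInAlgebra.

Lemma scalext_in_horner (A B : idomainType) (f : {rmorphism A -> B}) (H : falgType A) (h : H) (G : {poly A}) :
  scalext_in f (horner_alg h G) = horner_alg (scalext_in f h : scalext f H) (map_poly f G).
Proof.
elim/poly_ind: G => [|G c IHG]; first by rewrite !rmorph0.
rewrite !rmorphD !rmorphM /= IHG !horner_algX map_polyX map_polyC horner_algX !horner_algC /=.
by rewrite scalext_inZ rmorph1.
Qed.

Lemma tofrac_scalext_inj (A : idomainType) (H : falgType A) :
  injective (@scalext_in A {fraction A} (@tofrac A) H).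
Proof.
move=> x y /matrixP xy; apply: (can_inj (@v2rK _ _)); apply/rowP => i.
by apply/eqP; rewrite -tofrac_eq; move: (xy 0 i); rewrite !mxE => ->.
Qed.

(** The values on the image of [H] determine a linear form. *)
Lemma specializes_unique (A B : idomainType) (f : {rmorphism A -> B}) (H : falgType A)
    (chi : 'Hom(fracalg H, {fraction A}^o)) (c c' : 'Hom(fracalg (scalext f H), {fraction B}^o)) :
  specializes chi c -> specializes chi c' -> c = c'.
Proof.
move=> sp sp'; apply/lfunP; elim/scalext_ind=> [x|u v IHu IHv|a u IHu]; last 2 first.
- by rewrite !linearD /= IHu IHv.
- by rewrite !linearZ /= IHu.
elim/scalext_ind: x => [h|u v IHu IHv|a u IHu]; last 2 first.
- by rewrite scalext_inD !linearD /= IHu IHv.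
- by rewrite scalext_inZ !linearZ /= IHu.
have [a [aE ->]] := sp h; have [b [bE ->]] := sp' h.
by congr (f _)%:F; apply/eqP; rewrite -tofrac_eq -aE -bE.
Qed.

Section CharacterData.
Variables (A B : idomainType) (f : {rmorphism A -> B}) (H : falgType A) (t : {scalar H}).
Hypotheses (A_closed : completely_closed (1 : A)) (t_symm : symmetrizing t).
Hypothesis H_split : split_semisimple (fracalg H).
Variables (V : {fraction A} -> Prop) (res : {fraction A} -> {fraction B}).
Hypothesis fV : extends_to_place f V res.
Local Notation inj := (@scalext_in A {fraction A} (@tofrac A) H).
Local Notation inj' := (@scalext_in B {fraction B} (@tofrac B) (scalext f H)).
Local Notation inf := (@scalext_in A B f H).
Local Notation charT := 'Hom(fracalg H, {fraction A}^o).
Local Notation charT' := 'Hom(fracalg (scalext f H), {fraction B}^o).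

(** The idempotent is the dual element of the character divided by the Schur
    element, over both rings: Schur's relations survive the reduction, with the
    image of the Schur element as constant.  The polynomial [G] is the
    characteristic polynomial of [h] in [rho]: Cayley-Hamilton makes it vanish in
    the block, while its reduction is known once [h] acts as a scalar. *)
Lemma schur_denominator (chi : charT) s : is_schur_element t chi s ->
  exists (d : H) (chi' : charT') n (rho : {lrmorphism fracalg H -> 'M[{fraction A}]_n.+1}),
  [/\ affords rho chi,
      s != 0 /\ splits rho ((s%:F)^-1 *: inj d),
      specializes chi chi',
      f s != 0 -> exists rho' : {lrmorphism fracalg (scalext f H) -> 'M[{fraction B}]_n.+1},
        splits rho' ((f s)%:F^-1 *: inj' (inf d)) /\ affords rho' chi' &
      f s != 0 -> forall (h : H) (v : B),
        inj' (inf h) * ((f s)%:F^-1 *: inj' (inf d)) = v%:F *: ((f s)%:F^-1 *: inj' (inf d)) ->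
        exists G : {poly A}, ((s%:F)^-1 *: inj d) * inj (horner_alg h G) = 0 /\
          exists k, map_poly f G = ('X - v%:P) ^+ k].
Proof.
move=> [chiv [_ chivE [n [rho [rho_irr rho_chi rho_chiv]]]]].
have [h bh] := symmetrizing_basis t_symm.
set b := @scalext_basis A H in bh.
have bhE := symmetric_basis_ext (@tofrac A) bh.
have bhE' := symmetric_basis_ext (@tofrac B) (symmetric_basis_ext f bh).
have [s0 s0_neq0 cas] := irreducible_casimir bhE H_split rho_irr.
have /boolp.choice[a aE] i : exists a, \tr (rho (inj (b i))) = a%:F by apply: character_integral.
pose d := \sum_i a i *: h i.
have dE : dual_element (fun i => inj (b i)) (fun i => inj (h i)) rho 1%:M = inj d.
  rewrite /dual_element /d scalext_in_sum; apply: eq_bigr => i _.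
  by rewrite mulmx1 aE scalext_inZ.
have chivd : chiv = inj d.
  have [tauC bE hE] := bhE; rewrite (hE chiv) -dE; apply: eq_bigr => i _.
  by rewrite mulmx1 /= chivE rho_chi.
have s0E : s0 = s%:F.
  have := dual_element_image cas 1%:M; rewrite dE -chivd rho_chiv => /matrixP/(_ 0 0).
  by rewrite !mxE eqxx mulr1 mulr1n.
have rho_e := casimir_splits bhE cas s0_neq0; rewrite dE s0E in rho_e.
have [r [r_rep r_tr r_char r_cas]] := reduction fV rho_irr.
have [r1 [r1_rep r1E]] := semirep_ext (f := f) (g := @tofrac B) r_rep.
have [rho' rho'E] := semirep_fraction r1_rep.
have {}rho'E x : rho' (inj' (inf x)) = r x by rewrite rho'E r1E.
have [chi' rho'_chi'] := exists_character rho'.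
have rho'_e : f s != 0 -> splits rho' ((f s)%:F^-1 *: inj' (inf d)).
  move=> fs0; have cas' X : casimir (fun i => inj' (inf (b i))) (fun i => inj' (inf (h i))) rho' X
      = ((f s)%:F * \tr X)%:M.
    rewrite -(r_cas _ b h s); last by move=> Y; rewrite -s0E -cas.
    by apply: eq_bigr => i _; rewrite !rho'E.
  have := casimir_splits bhE' cas' (_ : (f s)%:F != 0); rewrite tofrac_eq0 => /(_ fs0).
  suff -> : dual_element (fun i => inj' (inf (b i))) (fun i => inj' (inf (h i))) rho' 1%:M = inj' (inf d) by [].
  rewrite /d !scalext_in_sum; apply: eq_bigr => i _.
  by rewrite mulmx1 rho'E (r_tr _ _ (aE i)) !scalext_inZ.
exists d, chi', n, rho; split=> //.
- by split; [rewrite -tofrac_eq0 -s0E | exact: rho_e].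
- move=> x; have [c cE] := character_integral A_closed rho x; exists c.
  by rewrite rho_chi cE rho'_chi' rho'E (r_tr _ _ cE).
- by move=> fs0; exists rho'; split=> //; apply: rho'_e.
move=> fs0 x v xv; have [G GE] := char_poly_integral A_closed rho x.
exists G; have [_ re' _ _] := rho'_e fs0; have [_ _ ker _] := rho_e; split.
  by apply: ker; rewrite representation_horner GE Cayley_Hamilton.
have rx : r x = (v%:F)%:M.
  move: (_ *: _) xv re' => e' xv re'.
  move: (congr1 rho' xv); rewrite rmorphM linearZ /= re' mulr1 rho'E => ->.
  by rewrite scalemx1.
exists n.+1; apply: (map_inj_poly (f := @tofrac B)) => [y z /eqP||]; rewrite ?rmorph0 //.
  by rewrite tofrac_eq => /eqP.
by rewrite (r_char _ _ GE) rx char_poly_scalar rmorphXn rmorphB /= map_polyX map_polyC.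
Qed.

End CharacterData.

(** * Blocks as integral sets of idempotents *)

Section Localization.
Variables (A : idomainType) (H : falgType A) (q : A -> Prop).
Hypothesis q_prime : is_prime_ideal q.
Local Notation inj := (@scalext_in A {fraction A} (@tofrac A) H).
Local Notation loc := (@in_localization A H q).

Lemma notin_primeM x y : ~ q x -> ~ q y -> ~ q (x * y).
Proof. by have [_ _ qM] := q_prime; move=> qx qy /qM[]. Qed.

Lemma notin_prime_neq0 x : ~ q x -> x%:F != 0.
Proof. by have [[q0 _ _] _ _] := q_prime; move=> qx; rewrite tofrac_eq0; apply/eqP => x0; apply: qx; rewrite x0. Qed.

Lemma notin_prime1 : ~ q 1. Proof. by case: q_prime. Qed.

Lemma localization_in h : loc (inj h).
Proof. by exists h, 1; split; [exact: notin_prime1 | rewrite rmorph1 invr1 scale1r]. Qed.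

Lemma localizationD u v : loc u -> loc v -> loc (u + v).
Proof.
move=> [h [s [qs ->]]] [k [r [qr ->]]]; exists (r *: h + s *: k), (s * r).
split; first exact: notin_primeM.
have s0 := notin_prime_neq0 qs; have r0 := notin_prime_neq0 qr.
rewrite scalext_inD !scalext_inZ scalerDr !scalerA tofracM invfM.
by congr (_ *: _ + _ *: _); [rewrite mulfVK | rewrite mulrAC mulVf // mul1r].
Qed.

Lemma localizationN u : loc u -> loc (- u).
Proof.
move=> [h [s [qs ->]]]; exists (- h), s; split=> //.
by rewrite rmorphN scalerN.
Qed.

Lemma localizationM u v : loc u -> loc v -> loc (u * v).
Proof.
move=> [h [s [qs ->]]] [k [r [qr ->]]]; exists (h * k), (s * r).
split; first exact: notin_primeM.
by rewrite -scalerAl -scalerAr scalerA scalext_inMr tofracM invfM.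
Qed.

End Localization.

(** Sets of idempotents are indexed by an arbitrary [T]; the same lemmas serve [H]
    and, through specialization, the specialized algebra. *)
Section IdempotentBlocks.
Variables (T : choiceType) (E : nzRingType) (S : {fset T}) (e : T -> E) (loc : E -> Prop).
Hypothesis e_orth : forall x y, x \in S -> y \in S -> e x * e y = if x == y then e x else 0.
Hypothesis e_one : \sum_(x <- S) e x = 1.
Hypothesis loc1 : loc 1.
Hypothesis locD : forall u v, loc u -> loc v -> loc (u + v).
Hypothesis locN : forall u, loc u -> loc (- u).
Hypothesis locM : forall u v, loc u -> loc v -> loc (u * v).

Definition block_sum (C : {fset T}) : E := \sum_(x <- C) e x.

Lemma block_sumE C x : (C `<=` S)%fset -> x \in S ->
  block_sum C * e x = if x \in C then e x else 0.
Proof.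
move=> /fsubsetP CS xS; rewrite /block_sum mulr_suml.
case: ifP => [xC|/negP nxC].
  rewrite (bigD1_seq x) ?fset_uniq //= e_orth // eqxx big_seq_cond big1 ?addr0 //.
  by move=> y /andP[/CS yS /negbTE yx]; rewrite e_orth // yx.
rewrite big_seq big1 // => y yC; rewrite e_orth //; last exact: CS.
by case: eqP => // yx; case: nxC; rewrite -yx.
Qed.

Lemma block_ext u v : (forall x, x \in S -> u * e x = v * e x) -> u = v.
Proof.
move=> uv; rewrite -[u]mulr1 -[v]mulr1 -e_one !mulr_sumr big_seq [RHS]big_seq.
by apply: eq_bigr => x; apply: uv.
Qed.

Lemma block_sumI C D : (C `<=` S)%fset -> (D `<=` S)%fset ->
  block_sum (C `&` D)%fset = block_sum C * block_sum D.
Proof.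
move=> CS DS; apply: block_ext => x xS.
rewrite -mulrA !block_sumE ?(fsubset_trans (fsubsetIl _ _)) // inE.
by case: (x \in D); rewrite ?andbT ?andbF ?mulr0 ?block_sumE.
Qed.

Lemma block_sumD C D : (C `<=` S)%fset -> (D `<=` S)%fset ->
  block_sum (C `\` D)%fset = block_sum C - block_sum C * block_sum D.
Proof.
move=> CS DS; apply: block_ext => x xS.
rewrite -block_sumI // mulrBl !block_sumE ?(fsubset_trans (fsubsetIl _ _)) ?(fsubset_trans (fsubsetDl _ _)) //.
by rewrite !inE; case: (x \in D); case: (x \in C); rewrite ?subrr ?subr0.
Qed.

Lemma block_sumU C D : (C `<=` S)%fset -> (D `<=` S)%fset ->
  block_sum (C `|` D)%fset = block_sum C + block_sum D - block_sum C * block_sum D.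
Proof.
move=> CS DS; apply: block_ext => x xS.
rewrite -block_sumI // mulrBl mulrDl !block_sumE ?(fsubset_trans (fsubsetIl _ _)) ?fsubUset ?CS //.
by rewrite !inE; case: (x \in D); case: (x \in C); rewrite /= ?addrK ?addr0 ?add0r ?subr0.
Qed.

Definition integral_set C := (C `<=` S)%fset /\ loc (block_sum C).

Definition minimal_integral C :=
  [/\ C != fset0, integral_set C &
      forall D, (D `<=` C)%fset -> D != fset0 -> integral_set D -> D = C].

Lemma integral_full : integral_set S.
Proof. by split=> //; rewrite /block_sum e_one. Qed.

Lemma integral_set0 : integral_set fset0.
Proof.
split; first exact: fsub0set.
by rewrite /block_sum big_seq_fset0 -(subrr 1); apply: locD => //; apply: locN.
Qed.

Lemma integral_setD C D : integral_set C -> integral_set D -> integral_set (C `\` D)%fset.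
Proof.
move=> [CS intC] [DS intD]; split; first exact: fsubset_trans (fsubsetDl _ _) CS.
by rewrite block_sumD //; apply/locD/locN/locM.
Qed.

Lemma integral_setU C D : integral_set C -> integral_set D -> integral_set (C `|` D)%fset.
Proof.
move=> [CS intC] [DS intD]; split; first by rewrite fsubUset CS.
by rewrite block_sumU //; apply/locD/locN/locM => //; apply: locD.
Qed.

(** A smallest integral set containing [x]: an integral subset of it that avoids
    [x] could be removed. *)
Lemma exists_block x : x \in S -> exists2 C, minimal_integral C & x \in C.
Proof.
move=> xS; pose P k := boolp.asbool (exists C, [/\ integral_set C, x \in C & #|` C| = k]).
have exP : exists k, P k by exists #|` S|; apply/boolp.asboolP; exists S; split=> //; exact: integral_full.
case: (ex_minnP exP) => k /boolp.asboolP[C [intC xC cardC]] min_k.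
exists C => //; split=> //; first by apply/fset0Pn; exists x.
have minC F : integral_set F -> (F `<=` C)%fset -> x \in F -> F = C.
  move=> intF FC xF; apply/eqP; rewrite eqEfcard FC cardC; apply: min_k.
  by apply/boolp.asboolP; exists F.
move=> D DC D0 intD; have [xD|nxD] := boolP (x \in D); first exact: minC.
have /fset0Pn[y yD] := D0.
have : (C `\` D)%fset = C.
  by apply: minC; [exact: integral_setD | exact: fsubsetDl | rewrite inE xC nxD].
move=> /fsetP/(_ y); rewrite inE yD /= => /esym.
by rewrite (fsubsetP DC _ yD).
Qed.

(** Adjoining the block of an element that was left out would enlarge a maximal
    integral subset of [D]. *)
Lemma closed_integral D : (D `<=` S)%fset ->
  (forall C x, minimal_integral C -> x \in C -> x \in D -> (C `<=` D)%fset) -> integral_set D.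
Proof.
move=> DS D_closed.
pose P k := boolp.asbool (exists2 U, integral_set U & (U `<=` D)%fset && (#|` D `\` U| == k)%fset).
have exP : exists k, P k.
  exists #|` D `\` fset0|%fset; apply/boolp.asboolP; exists fset0; last by rewrite fsub0set eqxx.
  exact: integral_set0.
case: (ex_minnP exP) => k /boolp.asboolP[U intU /andP[UD /eqP cardU]] min_k.
suff <- : U = D by [].
apply/eqP; rewrite eqEfsubset UD; apply/fsubsetP => x xD; apply/negPn/negP => xU.
have [C blockC xC] := exists_block (fsubsetP DS _ xD).
have CD := D_closed _ _ blockC xC xD; have [_ intC _] := blockC.
have : (k <= #|` D `\` (C `|` U)|%fset)%N.
  apply: min_k; apply/boolp.asboolP; exists (C `|` U)%fset; first exact: integral_setU.
  by rewrite fsubUset CD UD eqxx.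
rewrite leqNgt -cardU => /negP[]; apply: fproper_ltn_card.
rewrite fproperE; apply/andP; split.
  by apply/fsubsetP => y; rewrite !inE negb_or -andbA => /and3P[_ -> ->].
by apply/fsubsetPn; exists x; rewrite !inE ?xU ?xD ?xC.
Qed.

End IdempotentBlocks.

(** * Specialization of sums of idempotents *)

Section SpecializedIdempotents.
Variables (A B : idomainType) (f : {rmorphism A -> B}) (H : falgType A).
Local Notation E := (fracalg H).
Local Notation E' := (fracalg (scalext f H)).
Local Notation inj := (@scalext_in A {fraction A} (@tofrac A) H).
Local Notation inj' := (@scalext_in B {fraction B} (@tofrac B) (scalext f H)).
Local Notation inf := (@scalext_in A B f H).
Variables (T : choiceType) (S : {fset T}) (d : T -> H) (s : T -> A).
Hypothesis fs0 : forall x, x \in S -> f (s x) != 0.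
Local Notation e x := ((s x)%:F^-1 *: inj (d x)).
Local Notation e' x := ((f (s x))%:F^-1 *: inj' (inf (d x))).
Hypothesis e_orth : forall x y, x \in S -> y \in S -> e x * e y = if x == y then e x else 0.
Hypothesis e_central : forall x, x \in S -> central (e x).
Hypothesis e_one : \sum_(x <- S) e x = 1.
Hypothesis f_surj : forall b, exists a, f a = b.
Hypothesis lift : forall x, x \in S -> forall h v, inj' (inf h) * e' x = v%:F *: e' x ->
  exists G : {poly A}, e x * inj (horner_alg h G) = 0 /\ exists k, map_poly f G = ('X - v%:P) ^+ k.
Variable p : B -> Prop.
Hypothesis p_prime : is_prime_ideal p.

Lemma s_neq0 x : x \in S -> (s x)%:F != 0.
Proof.
move=> xS; rewrite tofrac_eq0; apply/eqP => s0; have := fs0 xS.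
by rewrite s0 rmorph0 eqxx.
Qed.

Lemma d_orth x y : x \in S -> y \in S -> x != y -> d x * d y = 0.
Proof.
move=> xS yS xy; have := e_orth xS yS; rewrite (negbTE xy) -scalerAl -scalerAr scalerA.
move/eqP; rewrite scaler_eq0 -invfM invr_eq0 mulf_eq0 !(negbTE (s_neq0 _)) //= => /eqP E0.
by apply: (@tofrac_scalext_inj A H); rewrite scalext_inMr E0 rmorph0.
Qed.

Lemma d_idem x : x \in S -> d x * d x = s x *: d x.
Proof.
move=> xS; have := e_orth xS xS; rewrite eqxx -scalerAl -scalerAr => /(scalerI _) E0.
apply: (@tofrac_scalext_inj A H); rewrite scalext_inMr scalext_inZ.
have s0 := s_neq0 xS; apply: (scalerI (invr_neq0 s0)).
by rewrite E0 ?invr_neq0 // scalerA mulVf // scale1r.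
Qed.

Lemma e'_orth x y : x \in S -> y \in S -> e' x * e' y = if x == y then e' x else 0.
Proof.
move=> xS yS; rewrite -scalerAl -scalerAr -!scalext_inMr; have [<-|xy] := eqVneq x y.
  rewrite d_idem // !scalext_inZ !scalerA mulfVK // tofrac_eq0; exact: fs0 xS.
by rewrite d_orth // !rmorph0 !scaler0.
Qed.

Lemma e'_sum_mul D x : (D `<=` S)%fset -> x \in S ->
  (\sum_(y <- D) e' y) * e' x = if x \in D then e' x else 0.
Proof. exact: (@block_sumE _ _ S (fun x => e' x) e'_orth D x). Qed.

(** Multiplied by the product of the Schur elements, which [f] does not kill, the
    condition becomes an equation in [H], to which [f] can be applied. *)
Lemma specialize_integral D : (D `<=` S)%fset ->
  in_localization (fun a => p (f a)) (\sum_(x <- D) e x) ->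
  in_localization p (\sum_(x <- D) e' x).
Proof.
move=> DS [h [c [pc eD]]].
pose P x := \prod_(y <- D | y != x) s y; pose PD := \prod_(y <- D) s y.
have PDE x : x \in D -> PD = s x * P x by move=> xD; rewrite /PD (bigD1_seq x) ?fset_uniq.
have c0 : c%:F != 0.
  rewrite tofrac_eq0; apply/eqP => c0; apply: pc; rewrite c0 rmorph0.
  by case: p_prime => -[].
have fc0 : (f c)%:F != 0 := notin_prime_neq0 p_prime pc.
have key : c *: (\sum_(x <- D) P x *: d x) = PD *: h.
  apply: (@tofrac_scalext_inj A H); rewrite !scalext_inZ scalext_in_sum.
  have -> : inj h = c%:F *: (\sum_(x <- D) e x) by rewrite eD scalerA divff // scale1r.
  rewrite scalerA mulrC -scalerA; congr (_ *: _); rewrite scaler_sumr.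
  apply: eq_big_seq => x xD; have xS := fsubsetP DS _ xD; rewrite scalext_inZ scalerA; congr (_ *: _).
  by rewrite (PDE _ xD) rmorphM /= mulrAC divff ?mul1r // s_neq0.
have fPD : (f PD)%:F != 0.
  rewrite tofrac_eq0 rmorph_prod big_seq; elim/big_ind: _ => [|x y x0 y0|x xD]; first exact: oner_neq0.
    exact: mulf_neq0 x0 y0.
  exact: fs0 (fsubsetP DS _ xD).
exists (inf h), (f c); split=> //.
apply: (scalerI fc0); rewrite scalerA divff // scale1r; apply: (scalerI fPD).
have := congr1 (fun z => inj' (inf z)) key; rewrite !scalext_inZ => <-.
rewrite scalerA mulrC -scalerA; congr (_ *: _); rewrite !scalext_in_sum scaler_sumr.
apply: eq_big_seq => x xD; have xS := fsubsetP DS _ xD; rewrite !scalext_inZ scalerA; congr (_ *: _).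
rewrite (PDE _ xD) !rmorphM /= mulrAC divff ?mul1r // tofrac_eq0; exact: fs0 xS.
Qed.

Lemma scalext_in_surj g : exists h, inf h = g.
Proof.
have /boolp.choice[a aE] i := f_surj ((g : 'rV_(dim H)) 0 i).
exists (\sum_i a i *: scalext_basis i); rewrite [RHS]scalext_spanE scalext_in_sum.
by apply: eq_bigr => i _; rewrite scalext_inZ aE.
Qed.

(** The given sum of idempotents is, up to a denominator [b], the image of some [h],
    whose characteristic polynomials reduce to powers of ['X - b] at the
    characters in [D] and of ['X] at the others.  The product of the latter,
    evaluated at [h], is supported on [D]; the product [Q] of the characteristic
    polynomials of the result has an invertible constant term, so the equation
    given by [Q] expresses the sum of idempotents.  This takes the place of
    lifting idempotents to a completion. *)
Lemma lift_integral D : (D `<=` S)%fset ->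
  in_localization p (\sum_(x <- D) e' x) ->
  in_localization (fun a => p (f a)) (\sum_(x <- D) e x).
Proof.
move=> DS [g [b [pb e'D]]]; have [h hg] := scalext_in_surj g; have [c cb] := f_surj b.
have b0 := notin_prime_neq0 p_prime pb.
have hE : inj' (inf h) = b%:F *: (\sum_(x <- D) e' x) by rewrite e'D scalerA divff // scale1r hg.
have hx x : x \in S -> inj' (inf h) * e' x = (if x \in D then b else 0)%:F *: e' x.
  move=> xS; rewrite hE -scalerAl e'_sum_mul //.
  by case: ifP; rewrite ?rmorph0 ?scaler0 ?scale0r.
have /boolp.choice[G GP] x : exists G : {poly A}, x \in S ->
    e x * inj (horner_alg h G) = 0 /\ exists k, map_poly f G = ('X - (if x \in D then b else 0)%:P) ^+ k.
  have [xS|] := boolP (x \in S); last by exists 0.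
  by have [G GP] := lift xS (hx _ xS); exists G.
(* [y] vanishes on the characters outside [D] and lifts a power of [h] on [D]. *)
pose P := \prod_(x <- (S `\` D)%fset) G x; pose y := horner_alg h P.
have y_out x : x \in S -> x \notin D -> e x * inj y = 0.
  move=> xS nxD; have xSD : x \in (S `\` D)%fset by rewrite inE nxD.
  rewrite /y /P (bigD1_seq x) ?fset_uniq //= rmorphM scalext_inMr mulrA.
  by have [-> _] := GP x xS; rewrite mul0r.
have [a fP] : exists a, map_poly f P = 'X^a.
  rewrite /P rmorph_prod big_seq; elim/big_ind: _ => [|u v [k ->] [l ->]|x]; first by exists 0%N.
    by exists (k + l)%N; rewrite exprD.
  rewrite inE => /andP[nxD xS]; have [_ [k Gk]] := GP x xS; exists k.
  by rewrite /= Gk (negbTE nxD) polyC0 subr0.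
have y_in x : x \in D -> inj' (inf y) * e' x = (b ^+ a)%:F *: e' x.
  move=> xD; have xS := fsubsetP DS _ xD.
  rewrite /y scalext_in_horner fP rmorphXn /= horner_algX rmorphXn.
  elim: a {fP} => [|a IHa]; first by rewrite mul1r scale1r.
  by rewrite exprSr -mulrA (hx _ xS) xD -scalerAr IHa scalerA -tofracM -exprS.
have /boolp.choice[G1 G1P] x : exists G : {poly A}, x \in D ->
    e x * inj (horner_alg y G) = 0 /\ exists k, map_poly f G = ('X - (b ^+ a)%:P) ^+ k.
  have [xD|] := boolP (x \in D); last by exists 0.
  by have [G' G'P] := lift (fsubsetP DS _ xD) (y_in _ xD); exists G'.
pose Q := \prod_(x <- D) G1 x.
have Q_in x : x \in D -> e x * inj (horner_alg y Q) = 0.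
  move=> xD; rewrite /Q (bigD1_seq x) ?fset_uniq //= (rmorphM (horner_alg y)) scalext_inMr mulrA.
  by have [G10 _] := G1P x xD; rewrite [X in X * _]G10 mul0r.
have [k fQ] : exists k, map_poly f Q = ('X - (b ^+ a)%:P) ^+ k.
  rewrite /Q rmorph_prod big_seq; elim/big_ind: _ => [|u v [k ->] [l ->]|x xD]; first by exists 0%N.
    by exists (k + l)%N; rewrite exprD.
  by have [_ [k Gk]] := G1P x xD; exists k; rewrite /= Gk.
have Q0 : ~ p (f Q.[0]).
  have -> : f Q.[0] = (- (b ^+ a)) ^+ k.
    by rewrite -horner_map rmorph0 /= fQ horner_exp !hornerE.
  have pX u l : ~ p u -> ~ p (u ^+ l).
    move=> pu; elim: l => [|l IHl]; rewrite ?expr0 ?exprS; first exact: (notin_prime1 p_prime).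
    by apply: (notin_primeM p_prime).
  apply: (pX); rewrite -mulN1r; apply: (notin_primeM p_prime); last exact: (pX).
  have [[_ _ pM] p1 _] := p_prime.
  by move=> /(pM (-1)); rewrite mulrNN mulr1; apply: p1.
have /factor_theorem[Q1 Q1E] : root (Q - Q.[0]%:P) 0 by rewrite rootE !hornerE subrr.
have Q00 : (Q.[0])%:F != 0.
  rewrite tofrac_eq0; apply/eqP => q0; apply: Q0; rewrite q0 rmorph0.
  by case: p_prime => -[].
have QE : horner_alg y Q = horner_alg y Q1 * y + Q.[0] *: 1.
  rewrite -[Q in LHS](subrK Q.[0]%:P) Q1E subr0 rmorphD rmorphM /= horner_algX.
  by rewrite horner_algC.
exists (- (horner_alg y Q1 * y)), Q.[0]; split=> //.
apply: (block_ext (e := fun x => e x) e_one) => x xS.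
rewrite (block_sumE (e := fun x => e x) e_orth DS xS) -scalerAl -(e_central xS).
rewrite rmorphN /= mulrN scalerN; case: ifPn => [xD|nxD].
  have := Q_in x xD; rewrite QE scalext_inD scalext_inZ mulrDr rmorph1 -scalerAr mulr1.
  move/eqP; rewrite addr_eq0 => /eqP ->.
  by rewrite scalerN opprK scalerA mulVf // scale1r.
rewrite scalext_inMr mulrA (e_central xS) -mulrA.
by rewrite [X in _ * X]y_out // mulr0 scaler0 oppr0.
Qed.

End SpecializedIdempotents.

(** * Cancellation of denominators *)

Section Cancellation.
Variable A : idomainType.

(** The fraction [a / P] lies in the localization at [q]. *)
Definition locally_divides (q : A -> Prop) (P a : A) : Prop :=
  exists u, ~ q u /\ exists b, u * a = P * b.

Section Localizations.
Variables (H : falgType A) (q : A -> Prop).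
Hypothesis q_prime : is_prime_ideal q.

Lemma localization_coordinates P (h : H) : P != 0 ->
  in_localization q (P%:F^-1 *: scalext_in (@tofrac A) h) <->
  forall i, locally_divides q P (v2r h 0 i).
Proof.
move=> P0; have PF0 : P%:F != 0 by rewrite tofrac_eq0.
split=> [[g [c [qc hE]]] i|hP].
  have cF0 := notin_prime_neq0 q_prime qc; exists c; split=> //; exists (v2r g 0 i).
  have -> : P * v2r g 0 i = v2r (P *: g) 0 i by rewrite linearZ mxE.
  suff <- : c *: h = P *: g by rewrite linearZ mxE.
  apply: (@tofrac_scalext_inj A H); rewrite !scalext_inZ.
  have -> : scalext_in (@tofrac A) g = c%:F *: (P%:F^-1 *: scalext_in (@tofrac A) h).
    by rewrite hE scalerA divff // scale1r.
  by rewrite !scalerA mulrAC divff // mul1r.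
have /boolp.choice[u uP] i : exists u, ~ q u /\ exists b, u * v2r h 0 i = P * b by exact: hP.
have /boolp.choice[b bP] i : exists b, u i * v2r h 0 i = P * b by have [] := uP i.
pose c := \prod_i u i.
have qc : ~ q c.
  rewrite /c; elim/big_ind: _ => [|x y|i _]; first exact: notin_prime1.
    exact: notin_primeM.
  by have [] := uP i.
have cF0 := notin_prime_neq0 q_prime qc.
pose g := r2v (\row_i ((\prod_(j | j != i) u j) * b i)) : H.
exists g, c; split=> //.
have cg : c *: h = P *: g.
  apply: (can_inj (@v2rK _ _)); rewrite !linearZ /= r2vK; apply/rowP => i; rewrite !mxE.
  by rewrite /c (bigD1 i) //= mulrAC bP -mulrA [b i * _]mulrC.
apply: (scalerI cF0); rewrite [RHS]scalerA divff // scale1r.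
apply: (scalerI PF0); rewrite -scalext_inZ -cg scalext_inZ !scalerA.
by rewrite mulrAC divff // mul1r.
Qed.

End Localizations.

(** [qs] is a family of ideals, and [q] a prime ideal.  The aim is to bound the
    denominators at [q] by the denominators at the members of [qs]. *)
Variables (I : Type) (qs : I -> A -> Prop) (q : A -> Prop).
Hypothesis q_prime : is_prime_ideal q.

(** Denominators dividing [P] can be bounded in this way; [removable c] says that
    this is not affected by a factor [c] of [P]. *)
Definition descends P : Prop :=
  forall a, (forall i, locally_divides (qs i) P a) -> locally_divides q P a.

Definition removable c : Prop := forall P, descends P -> descends (c * P).

Lemma removable1 : removable 1.
Proof. by move=> P; rewrite mul1r. Qed.

Lemma removableM c c' : removable c -> removable c' -> removable (c * c').
Proof. by move=> rc rc' P dP; rewrite -mulrA; apply/rc/rc'. Qed.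

Lemma removable_prod J (r : seq J) (Q : pred J) (c : J -> A) :
  (forall j, Q j -> removable (c j)) -> removable (\prod_(j <- r | Q j) c j).
Proof. by move=> rc; apply: big_ind rc; [exact: removable1 | exact: removableM]. Qed.

Lemma removableX c k : removable c -> removable (c ^+ k).
Proof.
by move=> rc; elim: k => [|k IHk]; [exact: removable1 | rewrite exprS; apply: removableM].
Qed.

Lemma removable_notin c : ~ q c -> removable c.
Proof.
move=> qc P dP a cPa; have [i|u [qu [b uab]]] := dP a.
  by have [u [qu [b uab]]] := cPa i; exists u; split=> //; exists (c * b); rewrite uab mulrA [P * c]mulrC.
exists (c * u); split; first exact: notin_primeM.
by exists b; rewrite -!mulrA uab.
Qed.

(** A prime [c] in [qs i] is no denominator at [qs i] of a fraction that is
    integral there, so it divides the numerator. *)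
Lemma removable_prime c i : is_ideal (qs i) -> qs i c -> c != 0 ->
  is_prime_ideal (fun z => exists w, z = c * w) -> removable c.
Proof.
move=> [_ _ qiM] qic c0 [_ _ c_prime] P dP a cPa.
have [a' aE] : exists a', a = c * a'.
  have [u [qu [b uab]]] := cPa i.
  have [|[w uE]|//] := c_prime u a; first by exists (P * b); rewrite uab mulrA.
  by case: qu; rewrite uE mulrC; apply: qiM.
have [k|u [qu [b uab]]] := dP a'.
  have [u [qu [b uab]]] := cPa k; exists u; split=> //; exists b.
  by apply: (mulfI c0); rewrite mulrCA -aE uab mulrA.
by exists u; split=> //; exists b; rewrite aE mulrCA uab mulrA.
Qed.

End Cancellation.

(** * Blocks and chains *)

(** The family need not exhaust the irreducible characters: for the specialized
    algebra, only the specializations of characters of [H] are known. *)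
Section CharacterFamily.
Variables (B : idomainType) (H : falgType B) (T : choiceType) (S : {fset T}).
Local Notation L := {fraction B}.
Local Notation E := (fracalg H).
Local Notation charT := 'Hom(fracalg H, {fraction B}^o).
Variables (e : T -> E) (char : T -> charT).
Hypothesis e_splits : forall x, x \in S -> block_idempotent (char x) (e x).
Hypothesis e_orth : forall x y, x \in S -> y \in S -> e x * e y = if x == y then e x else 0.
Variable q : B -> Prop.
Hypothesis q_prime : is_prime_ideal q.
Local Notation loc := (@in_localization B H q).

Lemma family_attached x : x \in S -> attached_idempotent (char x) (e x).
Proof. by move=> /e_splits[n [rho [rho_e rho_x]]]; exact (splits_attached rho_e rho_x). Qed.

Lemma family_attached_unique x f : x \in S -> attached_idempotent (char x) f -> f = e x.
Proof. by move=> /e_splits[n [rho [rho_e rho_x]]]; exact (@attached_unique _ _ _ _ _ rho_e _ rho_x f). Qed.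

Lemma family_neq0 x : x \in S -> e x != 0.
Proof. by move=> /e_splits[n [rho [rho_e rho_x]]]; exact: splits_neq0 rho_e. Qed.

Lemma family_inj : {in S &, injective char}.
Proof.
move=> x y xS yS xy; have exy : e x = e y.
  by apply: (family_attached_unique yS); rewrite -xy; exact: family_attached.
have := e_orth xS yS; rewrite -exy e_orth // eqxx.
by case: (x =P y) => // _ ex0; have := family_neq0 xS; rewrite ex0 eqxx.
Qed.

Lemma family_sum (C : {fset T}) (f : charT -> E) : (C `<=` S)%fset ->
  (forall chi, chi \in [fset char x | x in C]%fset -> attached_idempotent chi (f chi)) ->
  \sum_(chi <- [fset char x | x in C]%fset) f chi = \sum_(x <- C) e x.
Proof.
move=> /fsubsetP CS f_att; rewrite big_imfset /=; last first.
  by move=> x y xC yC; exact: family_inj (CS _ xC) (CS _ yC).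
apply: eq_big_seq => x xC; apply: (family_attached_unique (CS _ xC)).
by apply: f_att; apply: in_imfset.
Qed.

Lemma family_integral (C : {fset T}) : (C `<=` S)%fset ->
  integral_sum q [fset char x | x in C]%fset <-> loc (\sum_(x <- C) e x).
Proof.
move=> CS; split=> [[f [f_att]]|locC]; first by rewrite family_sum.
have /boolp.choice[f fP] (chi : charT) : exists f, forall x, x \in S -> char x = chi -> f = e x.
  have [[x xS <-]|nx] := boolp.pselect (exists2 x, x \in S & char x = chi).
    by exists (e x) => y yS /(family_inj yS xS) ->.
  by exists 0 => x xS xchi; case: nx; exists x.
have f_att chi : chi \in [fset char x | x in C]%fset -> attached_idempotent chi (f chi).
  move=> /imfsetP[x /= xC ->]; have xS := fsubsetP CS _ xC.
  by rewrite (fP _ x xS) //; exact: family_attached.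
by exists f; split=> //; rewrite family_sum.
Qed.

Lemma minimal_same_block C x y : minimal_integral S e loc C -> x \in C -> y \in C ->
  same_block q (char x) (char y).
Proof.
move=> [C0 [CS locC] C_min] xC yC; exists [fset char x | x in C]%fset.
split; [|exact: in_imfset|exact: in_imfset]; split.
- by apply/fset0Pn; exists (char x); exact: in_imfset.
- move=> _ /imfsetP[z /= zC ->].
  by have [n [rho [rho_e rho_z]]] := e_splits (fsubsetP CS _ zC); exact (splits_irr rho_e rho_z).
- exact/family_integral.
move=> C' C'C C'0 intC'.
pose D := [fset z in C | char z \in C']%fset.
have DC : (D `<=` C)%fset by apply/fsubsetP => z; rewrite !inE => /andP[].
have DE : [fset char x | x in D]%fset = C'.
  apply/fsetP => chi; apply/imfsetP/idP => [[z /=]|chiC'].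
    by rewrite !inE => /andP[_ ?] ->.
  have /imfsetP[z /= zC zE] := fsubsetP C'C _ chiC'; exists z => //=.
  by rewrite !inE zC -zE.
have DS := fsubset_trans DC CS.
suff DCE : D = C by rewrite -DE DCE.
apply: C_min => //.
  have /fset0Pn[chi chiC'] := C'0.
  have /imfsetP[z /= zC zE] := fsubsetP C'C _ chiC'.
  by apply/fset0Pn; exists z; rewrite !inE zC -zE.
by split=> //; apply/family_integral; rewrite // DE.
Qed.

(** Multiplication by an integral sum of idempotents cuts a block down to an
    integral subset. *)
Lemma same_block_integral (D : {fset T}) x y : (D `<=` S)%fset -> loc (\sum_(z <- D) e z) ->
  x \in S -> y \in S -> same_block q (char x) (char y) -> x \in D -> y \in D.
Proof.
move=> DS locD xS yS [C [[C0 C_irr [f [f_att locC]] C_min] xC yC]] xD.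
have fE z : z \in S -> char z \in C -> f (char z) = e z.
  by move=> zS zC; apply: (family_attached_unique zS); exact: f_att.
pose g := \sum_(z <- D) e z.
have gE z : z \in S -> g * e z = if z \in D then e z else 0 by exact: block_sumE.
have g_central : central g.
  move=> h; rewrite /g mulr_suml mulr_sumr; apply: eq_big_seq => z zD.
  by have [[cz _ _ _] _] := family_attached (fsubsetP DS _ zD).
have gg : g * g = g.
  by rewrite {2}/g mulr_sumr; apply: eq_big_seq => z zD; rewrite gE ?zD // (fsubsetP DS).
have g_dich chi : chi \in C -> g * f chi = 0 \/ g * f chi = f chi.
  move=> chiC; have [[cf ff f0 f_prim] _] := f_att _ chiC.
  apply: f_prim.
  - by move=> h; rewrite -mulrA cf !mulrA g_central.
  - by rewrite -mulrA [f chi * _]mulrA (cf g) !mulrA gg -mulrA ff.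
  - by rewrite mulrA (cf g) -mulrA ff.
pose C' := [fset chi in C | g * f chi == f chi]%fset.
have C'C : (C' `<=` C)%fset by apply/fsubsetP => z; rewrite !inE => /andP[].
have C'E : \sum_(chi <- C') f chi = g * \sum_(chi <- C) f chi.
  rewrite /C' -big_fset_condE mulr_sumr.
  rewrite [RHS](bigID (fun chi => g * f chi == f chi)) /= [X in _ = _ + X]big_seq_cond.
  rewrite [X in _ = _ + X]big1 => [|chi /andP[chiC gf]]; last first.
    by case: (g_dich _ chiC) => // gfE; rewrite gfE eqxx in gf.
  by rewrite addr0; apply: eq_bigr => chi /eqP ->.
have xC' : char x \in C' by rewrite !inE xC fE //= gE // xD.
have C'eq : C' = C.
  apply: C_min => //; first by apply/fset0Pn; exists (char x).
  exists f; split=> [chi chiC'|]; first exact/f_att/(fsubsetP C'C).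
  by rewrite C'E; apply: localizationM.
move: yC; rewrite -{1}C'eq !inE => /andP[yC]; rewrite fE // gE //.
by case: ifP => // _; rewrite eq_sym (negbTE (family_neq0 yS)).
Qed.

End CharacterFamily.

Section BlockChains.
Variables (A B : idomainType) (f : {rmorphism A -> B}) (H : falgType A).
Local Notation E := (fracalg H).
Local Notation E' := (fracalg (scalext f H)).
Local Notation inj := (@scalext_in A {fraction A} (@tofrac A) H).
Local Notation inj' := (@scalext_in B {fraction B} (@tofrac B) (scalext f H)).
Local Notation inf := (@scalext_in A B f H).
Local Notation charT := 'Hom(fracalg H, {fraction A}^o).
Local Notation charT' := 'Hom(fracalg (scalext f H), {fraction B}^o).
Variables (T : choiceType) (S : {fset T}) (d : T -> H) (s : T -> A).
Variables (char : T -> charT) (char' : T -> charT').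
Local Notation e x := ((s x)%:F^-1 *: inj (d x)).
Local Notation e' x := ((f (s x))%:F^-1 *: inj' (inf (d x))).
Hypothesis fs0 : forall x, x \in S -> f (s x) != 0.
Hypothesis e_splits : forall x, x \in S ->
  block_idempotent (char x) (e x).
Hypothesis e'_splits : forall x, x \in S ->
  block_idempotent (char' x) (e' x).
Hypothesis e_orth : forall x y, x \in S -> y \in S -> e x * e y = if x == y then e x else 0.
Hypothesis e_one : \sum_(x <- S) e x = 1.
Hypothesis f_surj : forall b, exists a, f a = b.
Hypothesis lift : forall x, x \in S -> forall h v, inj' (inf h) * e' x = v%:F *: e' x ->
  exists G : {poly A}, e x * inj (horner_alg h G) = 0 /\ exists k, map_poly f G = ('X - v%:P) ^+ k.
Variables (p : B -> Prop) (N : nat) (qs : nat -> A -> Prop).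
Hypothesis p_prime : is_prime_ideal p.
Hypothesis qs_prime : forall j, (j <= N)%N -> is_prime_ideal (qs j).
Hypothesis qs_sub : forall j a, (j <= N)%N -> qs j a -> p (f a).
Hypothesis descent : forall D : {fset T}, (D `<=` S)%fset ->
  (forall j, (j <= N)%N -> in_localization (qs j) (\sum_(x <- D) e x)) ->
  in_localization (fun a => p (f a)) (\sum_(x <- D) e x).

Lemma preimage_prime : is_prime_ideal (fun a => p (f a)).
Proof.
have [[p0 pD pM] p1 pP] := p_prime; split; first split.
- by rewrite rmorph0.
- by move=> x y px py; rewrite rmorphD; apply: pD.
- by move=> b x px; rewrite rmorphM; apply: pM.
- by rewrite rmorph1.
- by move=> x y; rewrite rmorphM; apply: pP.
Qed.

Let e_central x : x \in S -> central (e x).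
Proof. by move=> /e_splits[n [rho [[ce _ _ _] _]]]. Qed.

Definition block_chain x y :=
  exists n (c : nat -> T) (j : nat -> nat),
    [/\ forall i, (i <= n)%N -> c i \in S,
        forall i, (1 <= i <= n)%N -> (j i <= N)%N,
        c 0%N = x, c n = y &
        forall i, (1 <= i <= n)%N -> same_block (qs (j i)) (char (c i.-1)) (char (c i))].

Lemma block_chain_refl x : x \in S -> block_chain x x.
Proof.
move=> xS; exists 0%N, (fun=> x), (fun=> 0%N); split=> // i.
by rewrite leqn0 lt0n => /andP[/negbTE->].
Qed.

Lemma block_chain_step x y z k : block_chain x y -> z \in S -> (k <= N)%N ->
  same_block (qs k) (char y) (char z) -> block_chain x z.
Proof.
move=> [n [c [j [cS jN c0 cn cj]]]] zS kN yz.
exists n.+1, (fun i => if (i <= n)%N then c i else z), (fun i => if (i <= n)%N then j i else k).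
split=> [i _|i /andP[i1 _]|//||i /andP[i1]].
- by case: ifP => // /cS.
- by case: ifP => // ile; apply: jN; rewrite i1.
- by rewrite ltnn.
rewrite leq_eqVlt ltnS => /orP[/eqP->|ile]; first by rewrite /= leqnn ltnn cn.
by rewrite ile (leq_trans (leq_pred i) ile); apply: cj; rewrite i1.
Qed.

Let loc_D q (q_prime : is_prime_ideal q) := localizationD (H := H) q_prime.
Let loc_M q (q_prime : is_prime_ideal q) := localizationM (H := H) q_prime.

Let loc_1 q : is_prime_ideal q -> @in_localization A H q 1.
Proof. by move=> q_prime; rewrite -(rmorph1 inj); exact: localization_in. Qed.

(** The set of characters that are linked to [x] by a chain is integral at each
    of the primes [qs j]. *)
Lemma chain_same_block x y : x \in S -> y \in S ->
  same_block p (char' x) (char' y) -> block_chain x y.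
Proof.
move=> xS yS xy; pose D := [fset z in S | boolp.asbool (block_chain x z)]%fset.
have DS : (D `<=` S)%fset by apply/fsubsetP => z; rewrite !inE => /andP[].
have locD : in_localization (fun a => p (f a)) (\sum_(z <- D) e z).
  apply: descent => // j jN; have qj := qs_prime jN.
  have [] // := closed_integral e_orth e_one (loc_1 qj) (@loc_D _ qj)
    (@localizationN _ _ _) (@loc_M _ qj) DS _.
  move=> C z C_min zC; rewrite !inE => /andP[zS /boolp.asboolP xz].
  apply/fsubsetP => w wC; have [_ [/fsubsetP CS _] _] := C_min.
  rewrite !inE CS //=; apply/boolp.asboolP; apply: block_chain_step xz (CS _ wC) jN _.
  exact (minimal_same_block e_splits e_orth C_min zC wC).
have := specialize_integral fs0 p_prime DS locD.
move=> /(same_block_integral e'_splits (e'_orth fs0 e_orth) p_prime DS)/(_ xS yS xy).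
rewrite !inE xS yS /= => yD; apply/boolp.asboolP/yD/boolp.asboolP.
exact: block_chain_refl.
Qed.

(** A block at the preimage of [p] is integral at the smaller primes [qs j], so
    that chains do not leave it; and it specializes to a block at [p]. *)
Lemma same_block_chain x y : block_chain x y -> same_block p (char' x) (char' y).
Proof.
move=> [n [c [j [cS jN c0 cn cj]]]].
have q_prime := preimage_prime.
have xS : x \in S by rewrite -c0; apply: cS.
have [D D_min xD] := exists_block e_orth e_one (loc_1 q_prime) (@loc_D _ q_prime)
    (@localizationN _ _ _) (@loc_M _ q_prime) xS.
have [D0 [DS locD] Dmin] := D_min.
have cD i : (i <= n)%N -> c i \in D.
  elim: i => [|i IHi] ilen; first by rewrite c0.
  have jiN : (j i.+1 <= N)%N by apply: jN.
  apply: (same_block_integral e_splits e_orth (qs_prime jiN) DS _ (cS i (ltnW ilen)) (cS _ ilen)).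
  - have [h [a [pa DE]]] := locD; exists h, a; split; last exact: DE.
    by move=> /(qs_sub jiN).
  - exact: (cj i.+1).
  - exact/IHi/ltnW.
have yD : y \in D by rewrite -cn; apply: cD.
apply: (minimal_same_block e'_splits (e'_orth fs0 e_orth) (C := D)) => //.
split=> //; first by split; [exact: DS | exact (specialize_integral fs0 p_prime DS locD)].
move=> C CD C0 [CS locC]; apply: Dmin => //; split=> //.
exact (lift_integral fs0 e_orth e_central e_one f_surj lift p_prime CS locC).
Qed.

End BlockChains.

(** * Schur elements of essential algebras *)

Section FractionSums.
Variables (A : idomainType) (H : falgType A) (T : choiceType) (d : T -> H) (s : T -> A).
Local Notation inj := (@scalext_in A {fraction A} (@tofrac A) H).

Lemma sum_common_denominator (D : {fset T}) : (forall x, x \in D -> s x != 0) ->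
  \sum_(x <- D) (s x)%:F^-1 *: inj (d x) =
  (\prod_(x <- D) s x)%:F^-1 *: inj (\sum_(x <- D) (\prod_(y <- D | y != x) s y) *: d x).
Proof.
move=> s0; rewrite scalext_in_sum scaler_sumr; apply: eq_big_seq => x xD.
rewrite scalext_inZ scalerA (bigD1_seq x) ?fset_uniq //= tofracM invfM -mulrA mulVf ?mulr1 //.
rewrite tofrac_eq0 big_seq_cond; elim/big_ind: _ => [|y z y0 z0|y /andP[yD _]].
- exact: oner_neq0.
- exact: mulf_neq0 y0 z0.
- exact: s0.
Qed.

(** Over the common denominator [\prod_(x <- D) s x], the coordinates of the sum
    are quotients to which [descends] applies. *)
Lemma descend_integral I (qs : I -> A -> Prop) (q : A -> Prop) (U : A -> Prop)
    (c b : T -> A) (D : {fset T}) :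
  is_prime_ideal q -> (forall i, is_prime_ideal (qs i)) ->
  U 1 -> (forall a a', U a -> U a' -> U (a * a')) -> (forall a, U a -> descends qs q a) ->
  (forall x, x \in D -> [/\ s x != 0, s x = c x * b x, removable qs q (c x) & U (b x)]) ->
  (forall i, in_localization (qs i) (\sum_(x <- D) (s x)%:F^-1 *: inj (d x))) ->
  in_localization q (\sum_(x <- D) (s x)%:F^-1 *: inj (d x)).
Proof.
move=> q_prime qs_prime U1 UM U_desc sP.
have s0 x : x \in D -> s x != 0 by move=> /sP[].
have P0 : \prod_(x <- D) s x != 0.
  rewrite big_seq; elim/big_ind: _ => [|y z y0 z0|y yD].
  - exact: oner_neq0.
  - exact: mulf_neq0 y0 z0.
  - exact: s0.
rewrite (sum_common_denominator s0) => locD; apply/(localization_coordinates q_prime _ P0) => k.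
suff desc : descends qs q (\prod_(x <- D) s x).
  by apply: desc => i; apply/(localization_coordinates (qs_prime i) _ P0): k; exact: locD.
have -> : \prod_(x <- D) s x = \prod_(x <- D) c x * \prod_(x <- D) b x.
  by rewrite -big_split; apply: eq_big_seq => x /sP[].
have rem : removable qs q (\prod_(x <- D) c x).
  by rewrite big_seq; apply: (removable_prod (Q := mem D)) => x /sP[].
apply/rem/U_desc; rewrite big_seq; apply: big_ind => // x /sP[].
by [].
Qed.

End FractionSums.

Section SchurFactors.
Variables (R : idomainType) (n k : nat) (f : {rmorphism laurent R n.+1 -> laurent R k}).
Hypothesis f_mono : monomial_morphism f.

(** If [M] is not sent to [1], the image of [Psi(M)] is a monic polynomial at a
    nontrivial monomial; otherwise it is the constant [Psi(1)]. *)
Lemma factor_value_in (p : R -> Prop) Psi (M : 'rV[int]_n.+1) : is_ideal p -> ~ p 1 ->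
  essential_poly Psi -> ext_ideal p (f (map_poly (@laurentC R n.+1) Psi).[laurent_mono R M]) ->
  f (laurent_mono R M) = 1 /\ p Psi.[1].
Proof.
move=> p_ideal p1 [Psi_monic _ _ _ _]; rewrite (monomial_horner f_mono).
have [_ [ga [_ fmono]]] := f_mono; rewrite fmono.
have [->|gaM] := eqVneq (ga M) 0; last by move=> /(monic_value_notin p_ideal p1 Psi_monic gaM).
rewrite laurent_mono0 => pPsi; split=> //; move: pPsi.
by rewrite -[1 in X in X -> _](rmorph1 (@laurentC R k)) horner_map ext_idealC.
Qed.

Lemma factor_value_neq0 Psi (M : 'rV[int]_n.+1) : essential_poly Psi ->
  f (map_poly (@laurentC R n.+1) Psi).[laurent_mono R M] != 0.
Proof.
move=> Psi_ess; have [z_ideal z1 _] := zero_prime R; apply/eqP => v0.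
have [|_ /eqP] := factor_value_in z_ideal z1 Psi_ess (M := M).
  by rewrite v0; case: (@ext_ideal_ideal R k (fun x => x = 0)).
by apply/negP; exact: essential_poly_value1.
Qed.

Variable F : factorization R n.+1.
Hypothesis F_ess : essential_fact F.

Lemma fact_value_image_neq0 : fact_value F != 0 -> f (fact_value F) != 0.
Proof.
have [fC [ga [_ fmono]]] := f_mono.
rewrite /fact_value !mulf_eq0 !negb_or => /andP[/andP[xi0 _] _].
rewrite (rmorphM f) (rmorphM f (laurentC _ _)) (fC (fact_xi F)) (fmono (fact_N F)) (rmorph_prod f).
apply: mulf_neq0; first apply: mulf_neq0.
- have [z_ideal _ _] := zero_prime R; apply: contra_neq xi0 => xi0.
  have /(ext_idealC k z_ideal)-> : ext_ideal (fun x => x = 0) (laurentC k (fact_xi F)).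
    by rewrite xi0; case: (@ext_ideal_ideal R k (fun x => x = 0)).
  exact: rmorph0.
- by apply: contraTneq (laurent_mono_unit R (ga (fact_N F))) => ->; rewrite unitr0.
elim/big_ind: _ => [|y z y0 z0|i _].
- exact: oner_neq0.
- exact: mulf_neq0 y0 z0.
rewrite rmorphXn; apply: expf_neq0; rewrite /fact_factor /=.
by have [Psi_ess _ _] := F_ess i; exact: factor_value_neq0.
Qed.

Variables (p : R -> Prop) (I : Type) (qs : I -> laurent R n.+1 -> Prop).
Hypothesis p_prime : is_prime_ideal p.
Hypothesis qs_prime : forall i, is_prime_ideal (qs i).
Hypothesis qs_F : forall j : 'I_(fact_size F), p (fact_Psi j).[1] ->
  f (laurent_mono R (fact_M j)) = 1 ->
  exists i, forall z, (exists a b, ext_ideal p a /\ z = a + (laurent_mono R (fact_M j) - 1) * b) -> qs i z.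
Local Notation q := (fun a => ext_ideal p (f a)).

(** The monomial is a unit; the factors [Psi(M)] are either outside the preimage of
    [p], or prime elements in one of the [qs i]. *)
Lemma fact_value_removable : exists2 c, removable qs q c & fact_value F = c * laurentC _ (fact_xi F).
Proof.
have q_prime : is_prime_ideal q by apply: preimage_prime; exact: ext_ideal_prime.
have [p_ideal p1 _] := p_prime.
exists (laurent_mono R (fact_N F) * \prod_(i < fact_size F) fact_factor i ^+ fact_mult i); last first.
  by rewrite /fact_value -mulrA mulrC.
apply: removableM.
  apply: (removable_notin q_prime).
  have [_ [ga [_ fmono]]] := f_mono; rewrite fmono => qm.
  have [[_ _ JM] J1 _] := @ext_ideal_prime R k p p_prime; apply: J1.
  by rewrite -(laurent_monoK R (ga (fact_N F))) mulrC; apply: (JM).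
apply: removable_prod => j _; apply: removableX.
have [Psi_ess M_prim _] := F_ess j.
have [/(factor_value_in p_ideal p1 Psi_ess)[fM pPsi]|] := boolp.pselect (q (fact_factor j)); last first.
  exact: (removable_notin q_prime).
have [i qi] := qs_F pPsi fM.
have [qi_ideal _ _] := qs_prime i.
apply: (removable_prime (i := i) qi_ideal).
- have [b bE] := map_poly_value1 (@laurentC R n.+1) (fact_Psi j) (laurent_mono R (fact_M j)).
  by apply: qi; exists (laurentC _ (fact_Psi j).[1]), b; rewrite ext_idealC.
- apply/eqP => fj0; have := factor_value_neq0 (fact_M j) Psi_ess.
  by rewrite [X in f X]fj0 rmorph0 eqxx.
- exact (essential_factor_prime M_prim Psi_ess).
Qed.

End SchurFactors.

Section ConstantDenominators.
Variables (R : idomainType) (n k : nat) (f : {rmorphism laurent R n -> laurent R k}).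
Variables (p : R -> Prop) (I : Type) (qs : I -> laurent R n -> Prop) (i0 : I).
Hypothesis f_mono : monomial_morphism f.
Hypothesis p_prime : is_prime_ideal p.
Hypothesis qs_i0 : forall a, ext_ideal p a -> qs i0 a.

Lemma constant_descends xi : descends qs (fun a => ext_ideal p (f a)) (laurentC n xi).
Proof.
move=> a /(_ i0)[u [qu [b uab]]].
have [||s ps [c sac]] := mccoy_laurent p_prime (xi := xi) (a := a) (d := u).
- by exists b; rewrite mulrC.
- by move=> /qs_i0.
exists (laurentC n s); split; last by exists c.
have [fC _] := f_mono; rewrite fC ext_idealC //.
by case: p_prime.
Qed.

End ConstantDenominators.

(** * Specialization of essential algebras *)

Section SpecializedCharacters.
Variables (A B : idomainType) (f : {rmorphism A -> B}) (H : falgType A) (t : {scalar H}).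
Hypotheses (A_closed : completely_closed (1 : A)) (t_symm : symmetrizing t).
Hypothesis H_split : split_semisimple (fracalg H).
Variables (V : {fraction A} -> Prop) (res : {fraction A} -> {fraction B}).
Hypothesis fV : extends_to_place f V res.
Local Notation E := (fracalg H).
Local Notation E' := (fracalg (scalext f H)).
Local Notation inj := (@scalext_in A {fraction A} (@tofrac A) H).
Local Notation inj' := (@scalext_in B {fraction B} (@tofrac B) (scalext f H)).
Local Notation inf := (@scalext_in A B f H).
Local Notation charT := 'Hom(fracalg H, {fraction A}^o).
Local Notation charT' := 'Hom(fracalg (scalext f H), {fraction B}^o).
Variable s : charT -> A.
Hypothesis s_schur : forall chi : charT, is_irr chi -> is_schur_element t chi (s chi).
Hypothesis fs_neq0 : forall chi : charT, is_irr chi -> s chi != 0 -> f (s chi) != 0.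
Local Notation e x dx := ((s x)%:F^-1 *: inj dx).
Local Notation e' x dx := ((f (s x))%:F^-1 *: inj' (inf dx)).

(** Gathers [split_semisimple_idempotents] and [schur_denominator], choosing for
    each irreducible character a numerator [d chi] of its idempotent and its
    specialization. *)
Lemma specialized_characters :
  exists (S : {fset charT}) (d : charT -> H) (spec : charT -> charT'),
  [/\ forall chi, chi \in S <-> is_irr chi,
      forall chi, chi \in S ->
      [/\ f (s chi) != 0,
          specializes chi (spec chi),
          block_idempotent chi (e chi (d chi)),
          block_idempotent (spec chi) (e' chi (d chi)) &
          forall h v, inj' (inf h) * e' chi (d chi) = v%:F *: e' chi (d chi) ->
          exists G : {poly A}, e chi (d chi) * inj (horner_alg h G) = 0 /\
            exists k, map_poly f G = ('X - v%:P) ^+ k],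
      forall chi psi, chi \in S -> psi \in S ->
        e chi (d chi) * e psi (d psi) = if chi == psi then e chi (d chi) else 0 &
      \sum_(chi <- S) e chi (d chi) = 1].
Proof.
have [h bh] := symmetrizing_basis t_symm.
have [S [e0 [S_irr e0_splits e0_one]]] :=
  split_semisimple_idempotents (symmetric_basis_ext (@tofrac A) bh) H_split.
have data (chi : charT) : exists dx : H * charT', is_irr chi ->
    [/\ f (s chi) != 0, specializes chi dx.2,
        block_idempotent chi (e chi dx.1),
        block_idempotent dx.2 (e' chi dx.1) &
        forall h v, inj' (inf h) * e' chi dx.1 = v%:F *: e' chi dx.1 ->
        exists G : {poly A}, e chi dx.1 * inj (horner_alg h G) = 0 /\
          exists k, map_poly f G = ('X - v%:P) ^+ k].
  have [chi_irr|nirr] := boolp.pselect (is_irr chi); last by exists (0, 0).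
  have [d [chi' [n [rho [rho_chi [s0 rho_e] spec rho' lift]]]]] :=
    schur_denominator A_closed t_symm H_split fV (s_schur chi_irr).
  have fs0 := fs_neq0 chi_irr s0.
  exists (d, chi') => _; split; [exact: fs0 | exact: spec | | | exact: lift fs0].
    by exists n, rho.
  by exists n; exact: rho' fs0.
have /boolp.choice[dx dxP] := data.
have e_splits chi : chi \in S -> block_idempotent chi (e chi (dx chi).1).
  by move=> /S_irr/dxP[].
exists S, (fun chi => (dx chi).1), (fun chi => (dx chi).2); split; first exact: S_irr.
- by move=> chi /S_irr/dxP.
- move=> chi psi /e_splits[n [rho [rho_e rho_chi]]] /e_splits[m [sg [sg_e sg_psi]]].
  have [xy|xy] := eqVneq chi psi; first by rewrite -xy; exact: splits_idem rho_e.
  exact (splits_orthogonal rho_e sg_e rho_chi sg_psi xy).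
rewrite -e0_one; apply: eq_big_seq => chi chiS.
have [n [rho [rho_e rho_chi]]] := e_splits chi chiS.
have [m [sg [sg_e sg_chi]]] := e0_splits chi ((S_irr chi).1 chiS).
exact (attached_unique sg_e sg_chi (splits_attached rho_e rho_chi)).
Qed.

End SpecializedCharacters.

Section EssentialAlgebras.
Variables (R : idomainType) (m k : nat) (f : {rmorphism laurent R m.+1 -> laurent R k}).
Hypothesis f_mono : monomial_morphism f.
Variables (p : R -> Prop) (Ms : seq 'rV[int]_m.+1).
Hypothesis p_prime : is_prime_ideal p.
Hypothesis Ms_prim : forall M, M \in Ms -> primitive_mono M.
Local Notation A := (laurent R m.+1).
Local Notation preimage := (fun a => ext_ideal p (f a)).

Lemma q_ideal_image j a : (forall M, M \in Ms -> f (laurent_mono R M) = 1) ->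
  (j <= size Ms)%N -> q_ideal p Ms j a -> ext_ideal p (f a).
Proof.
have [p_ideal _ _] := p_prime; move=> fM; case: j => [_|j jMs]; first exact: monomial_ext_ideal.
move=> [b [c [pb ->]]]; rewrite rmorphD rmorphM rmorphB rmorph1 /= fM ?mem_nth //.
by rewrite subrr mul0r addr0; exact: monomial_ext_ideal.
Qed.

Lemma essential_descent (H : falgType A) (T : choiceType) (d : T -> H) (F : T -> factorization R m.+1)
    (D : {fset T}) :
  (forall x, x \in D -> fact_value (F x) != 0 /\ essential_fact (F x)) ->
  (forall x, x \in D -> forall i : 'I_(fact_size (F x)), p (fact_Psi i).[1] ->
    f (laurent_mono R (fact_M i)) = 1 -> fact_M i \in Ms) ->
  (forall j, (j <= size Ms)%N -> in_localization (@q_ideal R m.+1 p Ms j)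
    (\sum_(x <- D) (fact_value (F x))%:F^-1 *: scalext_in (@tofrac A) (d x))) ->
  in_localization preimage (\sum_(x <- D) (fact_value (F x))%:F^-1 *: scalext_in (@tofrac A) (d x)).
Proof.
move=> F_ess F_Ms locD; pose qs (i : 'I_(size Ms).+1) := @q_ideal R m.+1 p Ms i.
have qs_prime i : is_prime_ideal (qs i) by apply: q_ideal_prime => //; rewrite -ltnS.
have /boolp.choice[c cP] x : exists c, x \in D ->
    removable qs preimage c /\ fact_value (F x) = c * laurentC _ (fact_xi (F x)).
  have [xD|] := boolp.pselect (x \in D); last by exists 0.
  have [_ Fx_ess] := F_ess x xD.
  have [i pi fM|c c_rem cE] := fact_value_removable f_mono Fx_ess p_prime qs_prime; last by exists c.
  have MMs := F_Ms x xD i pi fM.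
  have iMs : ((index (fact_M i) Ms).+1 < (size Ms).+1)%N by rewrite ltnS index_mem.
  by exists (Ordinal iMs) => z; rewrite /qs /= nth_index.
apply: (@descend_integral _ _ _ d (fun x => fact_value (F x)) _ qs _
    (fun a => exists xi, a = laurentC _ xi) c (fun x => laurentC _ (fact_xi (F x)))).
- exact/preimage_prime/ext_ideal_prime.
- exact: qs_prime.
- by exists 1; rewrite rmorph1.
- by move=> _ _ [a ->] [b ->]; exists (a * b); rewrite rmorphM.
- by move=> _ [xi ->]; apply: (constant_descends (i0 := ord0) f_mono p_prime).
- move=> x xD; have [Fx0 _] := F_ess x xD; have [cx sx] := cP x xD.
  by split; [exact: Fx0 | exact: sx | exact: cx | exists (fact_xi (F x))].
- by move=> i; apply: locD; rewrite -ltnS.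
Qed.

End EssentialAlgebras.

Theorem theorem3p3p2
  (R : idomainType) (R_noetherian : noetherian R) (R_closed : integrally_closed R)
  (m : nat)
  (H : falgType (laurent R m.+1)) (t : {scalar H})
  (t_symmetrizing : symmetrizing t)
  (H_split : split_semisimple (fracalg H))
  (F : 'Hom(fracalg H, {fraction laurent R m.+1}^o) -> factorization R m.+1)
  (H_essential : essential t F)
  (p : R -> Prop) (p_prime : is_prime_ideal p)
  (r : nat) (r_range : (1 <= r <= m.+1)%N)
  (phi : {rmorphism laurent R m.+1 -> laurent R (m.+1 - r)})
  (phi_adapted : adapted phi)
  (Ms : seq 'rV[int]_m.+1)
  (MsP : forall M, M \in Ms <->
     essential_monomial p F M /\ phi (laurent_mono R M) = 1)
  (chi psi : 'Hom(fracalg H, {fraction laurent R m.+1}^o))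
  (chi_irr : is_irr chi) (psi_irr : is_irr psi) :
  same_block_specialization phi (ext_ideal p) chi psi
  <->
  exists (n : nat) (c : nat -> 'Hom(fracalg H, {fraction laurent R m.+1}^o))
         (j : nat -> nat),
    [/\ forall i, (i <= n)%N -> is_irr (c i),
        forall i, (1 <= i <= n)%N -> (j i <= size Ms)%N,
        c 0%N = chi, c n = psi &
        forall i, (1 <= i <= n)%N ->
          same_block (q_ideal p Ms (j i)) (c i.-1) (c i)].
Proof.
pose charT := 'Hom(fracalg H, {fraction laurent R m.+1}^o).
have A_closed :=
  @completely_closed_laurent R m.+1 (noetherian_completely_closed R_noetherian R_closed).
have phi_mono := adapted_monomial phi_adapted.
have [V [res phiV]] := adapted_place phi_adapted.
have Ms_prim (M : 'rV[int]_m.+1) : M \in Ms -> primitive_mono M.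
  by move=> /(MsP M).1[[x [_ [M_prim _]]] _]; exact: M_prim.
have Ms_phi (M : 'rV[int]_m.+1) : M \in Ms -> phi (laurent_mono R M) = 1 by move=> /(MsP M).1[].
have Bp_prime : is_prime_ideal (@ext_ideal R (m.+1 - r) p) by exact: ext_ideal_prime.
have s_schur (x : charT) : is_irr x -> is_schur_element t x (fact_value (F x)).
  by move=> x_irr; case: (H_essential x x_irr).
have F_ess (x : charT) : is_irr x -> essential_fact (F x).
  by move=> x_irr; case: (H_essential x x_irr).
have s_phi (x : charT) (x_irr : is_irr x) :=
  fact_value_image_neq0 phi_mono (F_ess x x_irr).
have [S [d [spec [S_irr dP e_orth e_one]]]] :=
  specialized_characters A_closed t_symmetrizing H_split phiV s_schur s_phi.
have phi_s0 (x : charT) (xS : x \in S) := let: And5 phi_s0 _ _ _ _ := dP x xS in phi_s0.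
have x_spec (x : charT) (xS : x \in S) := let: And5 _ x_spec _ _ _ := dP x xS in x_spec.
have e_splits (x : charT) (xS : x \in S) := let: And5 _ _ e_splits _ _ := dP x xS in e_splits.
have e'_splits (x : charT) (xS : x \in S) := let: And5 _ _ _ e'_splits _ := dP x xS in e'_splits.
have lift (x : charT) (xS : x \in S) := let: And5 _ _ _ _ lift := dP x xS in lift.
have qs_prime j : (j <= size Ms)%N -> is_prime_ideal (@q_ideal R m.+1 p Ms j) by exact: q_ideal_prime.
have descent (D : {fset charT}) : (D `<=` S)%fset ->
    (forall j, (j <= size Ms)%N -> in_localization (@q_ideal R m.+1 p Ms j)
      (\sum_(x <- D) (fact_value (F x))%:F^-1 *: scalext_in (@tofrac _) (d x))) ->
    in_localization (fun a => ext_ideal p (phi a))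
      (\sum_(x <- D) (fact_value (F x))%:F^-1 *: scalext_in (@tofrac _) (d x)).
  move=> /fsubsetP DS; apply: (essential_descent phi_mono p_prime Ms_prim) => x /DS xS.
    split; last exact/F_ess/S_irr.
    have := s_neq0 phi_s0 xS; rewrite tofrac_eq0; exact.
  move=> i pi phiM; have x_irr := (S_irr x).1 xS; have [_ M_prim _] := F_ess x x_irr i.
  by apply/(MsP _).2; split=> //; exists x; split=> //; split=> //; exists i; split=> //; left.
have chiS := (S_irr chi).2 chi_irr; have psiS := (S_irr psi).2 psi_irr.
have spec_irr (x : charT) : x \in S -> is_irr (spec x).
  by move=> xS; have [n [rho [rho_e rho_x]]] := e'_splits x xS; exact (splits_irr rho_e rho_x).
have chainE : same_block (ext_ideal p) (spec chi) (spec psi) <->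
    block_chain S id (size Ms) (q_ideal p Ms) chi psi.
  split.
    exact (chain_same_block phi_s0 e_splits e'_splits e_orth e_one Bp_prime qs_prime descent chiS psiS).
  move=> chain; exact (same_block_chain phi_s0 e_splits e'_splits e_orth e_one
    (monomial_surjective phi_mono) lift Bp_prime qs_prime
    (fun j a jMs => q_ideal_image phi_mono p_prime Ms_phi jMs) chain).
split.
  move=> [chi' [psi' [_ _ chi_chi' psi_psi']]].
  rewrite (specializes_unique chi_chi' (x_spec chi chiS)).
  rewrite (specializes_unique psi_psi' (x_spec psi psiS)).
  move=> /chainE[n [c [j [cS jMs c0 cn cj]]]]; exists n, c, j; split=> // i ile.
  by apply/S_irr/cS.
move=> [n [c [j [c_irr jMs c0 cn cj]]]]; exists (spec chi), (spec psi).
split; [exact: spec_irr | exact: spec_irr | exact: x_spec | exact: x_spec |].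
apply/chainE; exists n, c, j; split=> // i ile.
by apply/S_irr/c_irr.
Qed.
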